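(* Let $v=(v(x),\,x\in\mathbb{R}^k)$ be a centered continuous $\mathbb{R}^d$-valued Gaussian random field with i.i.d. components, let $I\subset\mathbb{R}^k$ be a closed box, and let Assumption A (defined in the context) hold for $I$ with exponents $\gamma_1,\dots,\gamma_k>0$. Let $\alpha_j=(\gamma_j+1)^{-1}$, $\Delta(x,y)=\sum_{j=1}^k|x_j-y_j|^{\alpha_j}$ and $Q=\sum_{j=1}^k(\gamma_j+1)=\sum_{j=1}^k\alpha_j^{-1}$. Then there are constants $\tilde K<\infty$ and $\rho>0$ with the following property: for every $0<r_0<\rho$ and all $x_0\in I$, $$P\left\{\exists r\in[r_0^2,r_0]:\ \sup_{y:\,\Delta(y,x_0)<r}|v(y)-v(x_0)|\le\tilde K\,\frac{r}{(\log\log\frac1r)^{1/Q}}\right\}\ \ge\ 1-\exp\left[-\left(\log\frac1{r_0}\right)^{1/2}\right].$$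
   Context: Notation: $\mathbb{R}_+=[0,\infty[$, $|\cdot|$ is the Euclidean norm, $\|X\|_{L^2}=(E|X|^2)^{1/2}$. An $\mathbb{R}^d$-valued white noise based on a measure $\nu$ on $\mathcal{B}(\mathbb{R}_+)$ is a set function $A\mapsto W(A)$ such that each $W(A)$ is a centered normal random vector in $\mathbb{R}^d$ with covariance matrix $\nu(A)\cdot I_d$, and for disjoint $A,B$: $W(A\cup B)=W(A)+W(B)$ and $W(A),W(B)$ are independent. A closed box is a set $I=\prod_{j=1}^k[c_j,d_j]$ with $c_j<d_j$; $I^{(\varepsilon)}$ is the $\varepsilon$-enlargement of $I$ in Euclidean norm. Assumption A for the closed box $I$: there is a Gaussian random field $(v(A,x),\,A\in\mathcal{B}(\mathbb{R}_+),\,x\in\mathbb{R}^k)$ and $\varepsilon_0>0$ such that: (a) for all $x\in I^{(\varepsilon_0)}$, $A\mapsto v(A,x)$ is an $\mathbb{R}^d$-valued white noise (based on a measure that may depend on $x$), $v(\mathbb{R}_+,x)=v(x)$, and when $A$ and $B$ are disjoint, $v(A,\cdot)$ and $v(B,\cdot)$ are independent; (b) there are constants $c_0,a_0\in\mathbb{R}_+$ and $\gamma_j>0$, $j=1,\dots,k$, such that for all $a_0\le a\le b\le+\infty$ and $x,y\in I^{(\varepsilon_0)}$, $$\|v([a,b[,x)-v(x)-v([a,b[,y)+v(y)\|_{L^2}\le c_0\Big[\sum_{j=1}^k a^{\gamma_j}|x_j-y_j|+b^{-1}\Big]$$ (with $b^{-1}=0$ if $b=+\infty$) and $$\|v([0,a_0],x)-v([0,a_0],y)\|_{L^2}\le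 c_0\sum_{j=1}^k|x_j-y_j|.$$ *)

(* Defs.v *)
From HB Require Import structures.
From mathcomp Require Import all_boot all_order all_algebra.
From mathcomp Require Import all_classical all_reals all_analysis.
Set Implicit Arguments.
Unset Strict Implicit.
Unset Printing Implicit Defensive.
Import Order.TTheory GRing.Theory Num.Theory.
Import numFieldNormedType.Exports.
Local Open Scope classical_set_scope.
Local Open Scope ring_scope.

Section geometry.
Context {R : realType} {k : nat}.
Implicit Types (x y : 'rV[R]_k) (gamma : 'I_k -> R).

(* Euclidean norm; the library norm on row vectors is the sup norm. *)
Definition enorm x : R := Num.sqrt (\sum_(j < k) x 0 j ^+ 2).

Definition closed_box (lo hi : 'rV[R]_k) : set 'rV[R]_k :=
  [set x | forall j, lo 0 j <= x 0 j <= hi 0 j].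

Definition enlargement (A : set 'rV[R]_k) (eps : R) : set 'rV[R]_k :=
  [set x | exists2 y, A y & enorm (x - y) < eps].

Definition alpha gamma (j : 'I_k) : R := (gamma j + 1)^-1.

Definition Delta gamma x y : R :=
  \sum_(j < k) (`|x 0 j - y 0 j| `^ alpha gamma j).

Definition Qdim gamma : R := \sum_(j < k) (gamma j + 1).

End geometry.

Section gaussian.
Context {disp : measure_display} {T : measurableType disp} {R : realType}.
Variable P : probability T R.

(* [normal_prob m 0] is a default value (the uniform law) in the library; the
   normal law with standard deviation 0 is the Dirac mass at the mean. *)
Definition gaussian_law (m s : R) (B : set R) : \bar R :=
  if s == 0 then \d_m B else normal_prob m s B.

Definition gaussian_rv (X : T -> R) : Prop :=
  measurable_fun setT X /\
  exists m s : R,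
    forall B : set R, measurable B -> P (X @^-1` B) = gaussian_law m s B.

(* The R^d-valued field F is jointly Gaussian over the index set D: every finite
   linear combination of coordinates is a (possibly degenerate) normal variable.
   This includes measurability of every coordinate. *)
Definition gaussian_field {d : nat} {I : Type} (D : set I)
    (F : I -> T -> 'rV[R]_d) : Prop :=
  forall (n : nat) (t : 'I_n -> I) (c : 'I_n -> 'rV[R]_d),
    (forall i, D (t i)) ->
    gaussian_rv (fun w => \sum_(i < n) \sum_(j < d) c i 0 j * F (t i) w 0 j).

(* sigma-algebra generated by a family of real-valued functions *)
Definition sigma_of {I : Type} (X : I -> T -> R) : set (set T) :=
  <<s [set E | exists (i : I) (B : set R), measurable B /\ E = X i @^-1` B] >>.

Definition indep2 (F G : set (set T)) : Prop :=
  forall A B, F A -> G B -> P (A `&` B) = (P A * P B)%E.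

(* Mutual independence; subfamilies are covered by taking some A j = setT. *)
Definition mutual_indep {d : nat} (F : 'I_d -> set (set T)) : Prop :=
  forall A : 'I_d -> set T, (forall j, F j (A j)) ->
    P (\bigcap_j A j) = (\prod_j P (A j))%E.

(* equality in law of two real-valued processes *)
Definition same_law {I : Type} (X Y : I -> T -> R) : Prop :=
  forall (n : nat) (t : 'I_n -> I) (B : 'I_n -> set R),
    (forall i, measurable (B i)) ->
    P (\bigcap_i (X (t i) @^-1` B i)) =
    P (\bigcap_i (Y (t i) @^-1` B i)).

Definition iid_components {d : nat} {I : Type} (F : I -> T -> 'rV[R]_d) : Prop :=
  mutual_indep (fun j : 'I_d => sigma_of (fun (i : I) w => F i w 0 j)) /\
  forall j j' : 'I_d, same_law (fun i w => F i w 0 j) (fun i w => F i w 0 j').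

Definition centered {d : nat} (X : T -> 'rV[R]_d) : Prop :=
  forall j : 'I_d, 'E_P[fun w => X w 0%R j]%E = 0%E.

(* (E |X|^2)^(1/2), as an extended real *)
Definition L2norm {d : nat} (X : T -> 'rV[R]_d) : \bar R :=
  Lnorm P 2%:E (fun w => (enorm (X w))%:E).

(* B(R_+), as subsets of R *)
Definition borel_Rplus : set (set R) :=
  [set A : set R | measurable A /\ A `<=` `[0, +oo[].

Definition white_noise {d : nat} (W : set R -> T -> 'rV[R]_d) : Prop :=
  exists nu : {measure set (measurableTypeR R) -> \bar R},
    [/\ forall A, borel_Rplus A ->
          [/\ gaussian_field [set: unit] (fun _ => W A),
              centered (W A) &
              forall i j : 'I_d,
                covariance P (fun w => W A w 0 i) (fun w => W A w 0 j) =
                (if i == j then nu A else 0)%E],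
        forall A B, borel_Rplus A -> borel_Rplus B -> A `&` B = set0 ->
          {ae P, forall w, W (A `|` B) w = W A w + W B w} &
        forall A B, borel_Rplus A -> borel_Rplus B -> A `&` B = set0 ->
          indep2 (sigma_of (fun (j : 'I_d) w => W A w 0 j))
                 (sigma_of (fun (j : 'I_d) w => W B w 0 j))].

(* the interval [a, b[ of R, where b may be +oo *)
Definition co_itv (a : R) (b : \bar R) : set R :=
  [set t | a <= t /\ (t%:E < b)%E].

(* Identities between random vectors are almost sure. The bound involving [b^-1]
   is stated in the extended reals, where +oo^-1 = 0 and 0^-1 = +oo: it is void
   when a0 = a = b = 0 (for c0 > 0), as it should be. *)
Definition assumptionA {k d : nat} (v : 'rV[R]_k -> T -> 'rV[R]_d)
    (I : set 'rV[R]_k) (gamma : 'I_k -> R) : Prop :=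
  (forall j, 0 < gamma j) /\
  exists (V : set R -> 'rV[R]_k -> T -> 'rV[R]_d) (eps0 : R),
  let Ieps := enlargement I eps0 in
  [/\ 0 < eps0,
      gaussian_field [set p | borel_Rplus p.1]
        (fun p : set R * 'rV[R]_k => V p.1 p.2),
      [/\ forall x, Ieps x -> white_noise (fun A => V A x),
          forall x, Ieps x -> {ae P, forall w, V `[0%R, +oo[%classic x w = v x w} &
          forall A B, borel_Rplus A -> borel_Rplus B -> A `&` B = set0 ->
            indep2
              (sigma_of (fun (p : 'rV[R]_k * 'I_d) w => V A p.1 w 0 p.2))
              (sigma_of (fun (p : 'rV[R]_k * 'I_d) w => V B p.1 w 0 p.2))] &
      exists c0 a0 : R,
      [/\ 0 <= c0, 0 <= a0,
          forall (a : R) (b : \bar R), a0 <= a -> (a%:E <= b)%E ->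
            forall x y, Ieps x -> Ieps y ->
            (L2norm (fun w => V (co_itv a b) x w - v x w
                              - V (co_itv a b) y w + v y w)%R <=
             c0%:E * ((\sum_(j < k) (a `^ gamma j * `|x 0%R j - y 0%R j|))%:E
                      + b^-1))%E &
          forall x y, Ieps x -> Ieps y ->
            (L2norm (fun w => V `[0%R, a0]%classic x w - V `[0%R, a0]%classic y w)%R <=
             (c0 * \sum_(j < k) `|x 0%R j - y 0%R j|)%:E)%E]].

End gaussian.

(* Main.v *)
(* Split the white noise V(., x) along disjoint frequency bands [a_l, a_(l+1)[ with
   a_l = U^(2l+1)/r0.  At the radius r_l = r0/U^(2l+2) almost all of the increment of
   v around x0 is carried by the l-th band, so the field v is close to one of about
   log(1/r0)/loglog(1/r0) independent fields, and each of them has a chance of at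
   least log(1/r0)^(-1/4) to oscillate by less than K r_l/(loglog(1/r_l))^(1/Q).
   Hence all of them fail with probability at most exp(-sqrt(log(1/r0)))/2, and the
   remainders are controlled by Gaussian tails.

   The small ball probability is estimated without correlation inequalities: for
   independent copies X, X' of a Gaussian vector, X is distributed as
   (X - X')/sqrt 2, and X - X' is small when X and X' fall into the same cell of a
   partition, an event whose probability is at least exp(-entropy).  Oscillations
   over a box are handled by chaining along grids adapted to the anisotropic
   distance Delta, with thresholds concentrated around one level I. *)
Require Import Defs.
From HB Require Import structures.
From mathcomp Require Import all_boot all_order all_algebra.
From mathcomp Require Import all_classical all_reals all_analysis.
From mathcomp Require Import measurable_realfun ring lra zify.
Set Implicit Arguments.
Unset Strict Implicit.
Unset Printing Implicit Defensive.
Import Order.TTheory GRing.Theory Num.Theory.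
Import numFieldNormedType.Exports.
Local Open Scope classical_set_scope.
Local Open Scope ring_scope.

(** * Centered normal variables *)

(** The exponent 1/Q comes from entropy. At level i of the anisotropic grid there are about q^i
    increments, q = 4^Q, of standard deviation about r 4^-i; keeping their chaining sum below a
    multiple of r 4^-I costs an entropy of order q^I. With L = log(1/r0) and q^I about (log L)/(4
    C), the probability is at least L^(-1/4), while 4^-I is of order (log L)^(-1/Q). Since r_l is
    the geometric mean of 1/a_l and 1/a_(l+1), frequencies below and above the band both leave a
    remainder of relative size at most 1/L, once U is a power of L adapted to the exponents gamma_j;
    its Gaussian tail then beats the number of bands. Two features of the hypotheses shape the rest.
    Independence is given for two disjoint sets at a time: it yields vanishing correlations, and
    joint independence is recovered from joint Gaussianity by comparing means of cosines. And at
    each point v is the total noise only almost surely: the estimates are made on finite grids,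
    uniformly in their depth, and the continuity of v gives the rest. *)

Section normal_calculus.
Context {R : realType}.
Local Notation leb := (@lebesgue_measure R).
Local Notation N01 := (@normal_prob R 0 1).
Implicit Types (f : R -> R) (m s a b c : R).

(** The Radon-Nikodym derivative agrees almost everywhere with [normal_pdf m s], because both
    integrate to [normal_prob m s] over every measurable set. *)
Lemma ge0_integral_normal_prob m s (f : R -> \bar R) :
  (forall x, 0 <= f x)%E -> measurable_fun [set: R] f ->
  (\int[normal_prob m s]_x f x = \int[leb]_x (f x * (normal_pdf m s x)%:E))%E.
Proof.
move=> f0 mf.
pose g := Radon_Nikodym_SigmaFinite.f (normal_prob m s) leb.
have dom := normal_prob_dominates m s.
have mg : measurable_fun setT g.
  exact: measurable_int (Radon_Nikodym_SigmaFinite.f_integrable dom).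
rewrite -(Radon_Nikodym_SigmaFinite.change_of_variables dom f0 _ mf)//.
apply: ae_eq_integral => //.
- exact: emeasurable_funM.
- apply: emeasurable_funM => //; apply/measurable_EFinP.
  exact: measurable_normal_pdf.
- apply: ae_eqe_mul2l; apply: integral_ae_eq => //.
  + exact: Radon_Nikodym_SigmaFinite.f_integrable.
  + apply/measurable_EFinP; exact: measurable_normal_pdf.
  + by move=> E _ mE; rewrite -Radon_Nikodym_SigmaFinite.f_integral.
Qed.

Lemma ge0_lebesgue_integral_affine f a b : 0 < a ->
  continuous f -> (forall x, 0 <= f x) ->
  (\int[leb]_x (f x)%:E = \int[leb]_x (a * f (a * x + b))%:E)%E.
Proof.
move=> a0 cf f0.
pose F x := a * x + b.
have dF x : is_derive x (1:R) F a.
  by apply: is_derive_eq; rewrite addr0 scaler1.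
have F'E : F^`()%classic = cst a.
  by apply/funext => x; rewrite derive1E; apply: derive_val.
rewrite (@increasing_ge0_integration_by_substitutionT _ F f)//.
- by apply: eq_integral => x _; rewrite !fctE F'E /= mulrC.
- by move=> x y xy; rewrite /F ltrD2r ltr_pM2l.
- by rewrite F'E => x; exact: cvg_cst.
- by rewrite F'E; exact: is_cvg_cst.
- by rewrite F'E; exact: is_cvg_cst.
- apply: (@cvg_comp _ _ _ (fun x => a * x) (fun x => x + b)); last exact: cvg_addrr_Ny.
  by apply: gt0_cvgMrNy => //; exact: cvg_id.
- apply: (@cvg_comp _ _ _ (fun x => a * x) (fun x => x + b)); last exact: cvg_addrr.
  by apply: gt0_cvgMry => //; exact: cvg_id.
Qed.

Lemma ge0_lebesgue_integralN (f : R -> \bar R) :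
  (forall x, 0 <= f x)%E -> measurable_fun [set: R] f ->
  (\int[leb]_x f x = \int[leb]_x f (- x)%R)%E.
Proof.
move=> f0 mf.
rewrite -[LHS](_ : \int[pushforward leb (-%R : _ -> measurableTypeR R)]_x f x = _)%E.
  by rewrite ge0_integral_pushforward//.
by apply: eq_measure_integral => //= A mA _; exact: lebesgue_measureN.
Qed.

Lemma ge0_integral_normal_pdf m s f :
  (forall x, 0 <= f x) -> measurable_fun [set: R] f ->
  (\int[normal_prob m s]_x (f x)%:E = \int[leb]_x (f x * normal_pdf m s x)%:E)%E.
Proof.
by move=> f0 mf; rewrite ge0_integral_normal_prob//; apply/measurable_EFinP.
Qed.

Lemma normal_prob_std m s f : 0 < s ->
  continuous f -> (forall x, 0 <= f x) ->
  (\int[normal_prob m s]_x (f x)%:E = \int[N01]_x (f (m + s * x)%R)%:E)%E.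
Proof.
move=> s0 cf f0.
have sn0 : s != 0 by rewrite gt_eqF.
have cf' : continuous (fun x => f (m + s * x)).
  move=> x; apply: (@continuous_comp _ _ _ (fun x => m + s * x) f); last exact: cf.
  by apply: cvgD; [exact: cvg_cst|apply: cvgM; [exact: cvg_cst|exact: cvg_id]].
rewrite [LHS]ge0_integral_normal_pdf//; last exact: continuous_measurable_fun.
have -> := ge0_integral_normal_pdf 0 1 (fun x => f0 (m + s * x))
  (continuous_measurable_fun cf').
rewrite (@ge0_lebesgue_integral_affine _ s m)//.
- apply: eq_integral => x _; congr (_%:E).
  rewrite [m + _]addrC mulrCA; congr (_ * _).
  rewrite (normal_pdfE _ sn0) (normal_pdfE _ (oner_neq0 R)) /normal_peak /normal_fun.
  rewrite addrK subr0 expr1n mul1r mulrA; congr (_ * _).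
    rewrite -mulrnAr sqrtrM ?sqr_ge0// invfM mulrA.
    by rewrite sqrtr_sqr gtr0_norm// divff// mul1r.
  by congr expR; field.
- by move=> x; apply: cvgM; [exact: cf|exact: continuous_normal_pdf].
- by move=> x; rewrite mulr_ge0// normal_pdf_ge0.
Qed.

Lemma normal_prob_sym f : (forall x, 0 <= f x) -> measurable_fun [set: R] f ->
  (\int[N01]_x (f x)%:E = \int[N01]_x (f (- x)%R)%:E)%E.
Proof.
move=> f0 mf.
rewrite [LHS]ge0_integral_normal_pdf// [RHS]ge0_integral_normal_pdf//; last first.
  exact: measurableT_comp.
rewrite ge0_lebesgue_integralN.
- apply: eq_integral => x _; congr (_ * _)%:E.
  by rewrite !normal_pdfE ?oner_neq0// /normal_fun !subr0 sqrrN.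
- by move=> x; rewrite lee_fin mulr_ge0// normal_pdf_ge0.
- apply/measurable_EFinP; apply: measurable_funM => //.
  exact: measurable_normal_pdf.
Qed.

Lemma normal_prob_neg m s : normal_prob m (- s) = normal_prob m s.
Proof.
have [->|s0] := eqVneq s 0; first by rewrite oppr0.
apply/funext => A; apply: eq_integral => x _.
by rewrite !normal_pdfE ?oppr_eq0// /normal_peak /normal_fun sqrrN.
Qed.

End normal_calculus.

(** * Sums of independent normal variables *)

Section normal_convolution.
Context {R : realType}.
Local Notation leb := (@lebesgue_measure R).
Local Notation N01 := (@normal_prob R 0 1).
Implicit Types (f : R -> R) (m s a b c : R).

(** Two factorizations of the joint density of [x] and [u = a * x + b * y]: conditioning on [x] on
    the left, on [u] on the right. The exponents agree by completing the square. *)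
Lemma normal_pdf_mul a b c x u : 0 < a -> 0 < b -> 0 < c -> c ^+ 2 = a ^+ 2 + b ^+ 2 ->
  normal_pdf (a * x) b u * normal_pdf 0 1 x =
  normal_pdf 0 c u * normal_pdf (a * u / c ^+ 2) (b / c) x.
Proof.
move=> a0 b0 c0 cab.
have bn0 : b != 0 by rewrite gt_eqF.
have cn0 : c != 0 by rewrite gt_eqF.
have bcn0 : b / c != 0 by rewrite mulf_neq0// invr_eq0.
rewrite (normal_pdfE _ bn0) (normal_pdfE _ cn0) (normal_pdfE _ bcn0).
rewrite (normal_pdfE _ (oner_neq0 R)) /normal_peak /normal_fun.
have sq y : 0 < y -> (Num.sqrt (y ^+ 2 * pi *+ 2))^-1 = y^-1 / Num.sqrt (pi *+ 2).
  move=> y0; rewrite -mulrnAr sqrtrM ?sqr_ge0// sqrtr_sqr gtr0_norm// invfM.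
  by rewrite mulrC.
rewrite !sq ?divr_gt0//.
rewrite mulrACA -expRD [RHS]mulrACA -expRD; congr (_ * expR _).
  by rewrite invr1 mul1r invfM invrK; field; rewrite cn0 bn0 gt_eqF// sqrtr_gt0 pmulrn_lgt0// pi_gt0.
have c2 : a ^+ 2 + b ^+ 2 != 0 by rewrite -cab sqrf_eq0.
by rewrite expr_div_n cab; field; rewrite bn0 c2.
Qed.

(** The inner integral is written with the density of [u = a * x + b * y] given [x]; after
    exchanging the integrals, [normal_pdf_mul] leaves the conditional density of [x] given [u],
    which has mass 1. *)
Lemma normal_prob_conv a b c f : 0 < a -> 0 < b -> 0 < c ->
  c ^+ 2 = a ^+ 2 + b ^+ 2 -> continuous f -> (forall x, 0 <= f x) ->
  (\int[N01]_x \int[N01]_y (f (a * x + b * y)%R)%:E =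
   \int[N01]_z (f (c * z)%R)%:E)%E.
Proof.
move=> a0 b0 c0 cab cf f0.
have mf : measurable_fun [set: R] f by exact: continuous_measurable_fun.
pose g (xu : measurableTypeR R * measurableTypeR R) : R :=
  f xu.2 * (normal_peak b * expR (- (xu.2 - a * xu.1) ^+ 2 / (b ^+ 2 *+ 2))).
have g0 xu : 0 <= g xu by rewrite !mulr_ge0// ?normal_peak_ge0 ?expR_ge0.
have mg : measurable_fun setT g.
  apply: measurable_funM; first exact: measurableT_comp.
  apply: measurable_funM => //; apply: measurableT_comp => //.
  apply: measurable_funM => //; apply: measurableT_comp => //.
  apply: measurable_funX; apply: measurable_funB => //.
  exact: measurable_funM.
have gE x u : g (x, u) = f u * normal_pdf (a * x) b u.
  by rewrite normal_pdfE// gt_eqF.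
transitivity (\int[N01]_x \int[leb]_u (g (x, u))%:E)%E.
  apply: eq_integral => x _.
  rewrite -(@normal_prob_std _ (a * x) b)// ge0_integral_normal_pdf//.
  by apply: eq_integral => u _; rewrite gE.
rewrite ge0_integral_normal_prob; last 2 first.
- by move=> x; apply: integral_ge0 => u _; rewrite lee_fin.
- have := @measurable_fun_fubini_tonelli_F _ _ (measurableTypeR R) (measurableTypeR R) R leb (EFin \o g).
  apply; first exact/measurable_EFinP.
  by move=> xu; rewrite lee_fin.
pose h (xu : measurableTypeR R * measurableTypeR R) : R :=
  g xu * normal_pdf 0 1 xu.1.
have h0 xu : 0 <= h xu by rewrite mulr_ge0// normal_pdf_ge0.
have mh : measurable_fun setT h.
  apply: measurable_funM => //; apply: measurableT_comp => //.
  exact: measurable_normal_pdf.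
transitivity (\int[leb]_x \int[leb]_u (h (x, u))%:E)%E.
  apply: eq_integral => x _.
  rewrite -ge0_integralZr//; last 3 first.
  - by apply/measurable_EFinP; exact: measurableT_comp (measurable_pair1 x).
  - by move=> u _; rewrite lee_fin.
  - by rewrite lee_fin normal_pdf_ge0.
rewrite (@fubini_tonelli _ _ (measurableTypeR R) (measurableTypeR R) R leb leb (EFin \o h)); last 2 first.
- exact/measurable_EFinP.
- by move=> xu; rewrite lee_fin.
transitivity (\int[normal_prob 0 c]_u (f u)%:E)%E; last first.
  rewrite normal_prob_std//; apply: eq_integral => z _.
  by rewrite add0r.
rewrite ge0_integral_normal_pdf//.
apply: eq_integral => u _.
transitivity (\int[leb]_x ((f u * normal_pdf 0 c u)%:E *
   (normal_pdf (a * u / c ^+ 2) (b / c) x)%:E))%E.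
  apply: eq_integral => x _ /=; rewrite -EFinM /h gE; congr (_%:E).
  by rewrite -[LHS]mulrA -[RHS]mulrA /=; congr (_ * _); exact: normal_pdf_mul.
rewrite ge0_integralZl//; last 3 first.
- by apply/measurable_EFinP; exact: measurable_normal_pdf.
- by move=> x _; rewrite lee_fin normal_pdf_ge0.
- by rewrite lee_fin mulr_ge0// normal_pdf_ge0.
by rewrite integral_normal_pdf mule1.
Qed.

(** The weight turns the standard density into [s] times the density of deviation [s]. It is used
    with [s = sqrt 2], for exponential moments, and with [s = 1 / sqrt 2], for the positivity of the
    variance. *)
Lemma normal_expR_sqr s : 0 < s ->
  (\int[N01]_x (expR ((1 - s ^- 2) / 2 * x ^+ 2))%:E = s%:E)%E.
Proof.
move=> s0; have sn0 : s != 0 by rewrite gt_eqF.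
rewrite ge0_integral_normal_pdf//; last first.
  by apply: measurableT_comp => //; apply: measurable_funM => //; exact: measurable_funX.
transitivity (\int[leb]_x (s%:E * (normal_pdf 0 s x)%:E))%E.
  apply: eq_integral => x _; rewrite -EFinM; congr (_%:E).
  rewrite (normal_pdfE _ sn0) (normal_pdfE _ (oner_neq0 R)) /normal_peak /normal_fun.
  have sq y : 0 < y -> (Num.sqrt (y ^+ 2 * pi *+ 2))^-1 = y^-1 / Num.sqrt (pi *+ 2).
    move=> y0; rewrite -mulrnAr sqrtrM ?sqr_ge0// sqrtr_sqr gtr0_norm// invfM.
    by rewrite mulrC.
  rewrite !sq// mulrCA -expRD !mulrA divff// !mul1r invr1 mul1r; congr (_ * expR _).
  by rewrite subr0; field.
rewrite ge0_integralZl//; last 3 first.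
- by apply/measurable_EFinP; exact: measurable_normal_pdf.
- by move=> x _; rewrite lee_fin normal_pdf_ge0.
- by rewrite lee_fin ltW.
by rewrite integral_normal_pdf mule1.
Qed.

End normal_convolution.

Section bounded_expectation.
Context {d} {T : measurableType d} {R : realType}.
Variable P : probability T R.
Implicit Types (f g : T -> R) (M : R).

Lemma bounded_integrable f M : measurable_fun setT f ->
  (forall x, `|f x| <= M) -> P.-integrable setT (EFin \o f).
Proof.
move=> mf fM; apply: measurable_bounded_integrable => //.
  exact: le_lt_trans (probability_le1 P measurableT) (ltry 1).
exists M; split; first exact: num_real.
by move=> x Mx y _ /=; apply: le_trans (ltW Mx).
Qed.

Lemma Rintegral_cst1 (c : R) : (\int[P]_w c)%R = c.
Proof.
by rewrite Rintegral_cst//= [X in fine X](probability_setT P) /= mulr1.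
Qed.

Lemma Rintegral_addc f c : P.-integrable setT (EFin \o f) ->
  (\int[P]_w (f w + c) = \int[P]_w f w + c)%R.
Proof.
move=> fi; have ic : P.-integrable setT (EFin \o (fun=> c : R)).
  exact: (bounded_integrable (M := `|c|)).
by rewrite RintegralD//; have := Rintegral_cst1 c; move=> ->.
Qed.

End bounded_expectation.
Arguments bounded_integrable {d T R P f} M.

Lemma measurable_normr_lt {d} {T : measurableType d} {R : realType}
    (X : T -> R) (a : R) :
  measurable_fun setT X -> measurable [set w | `|X w| < a].
Proof.
move=> mX; rewrite (_ : [set w | _] = setT `&` X @^-1` `]- a, a[); last first.
  by rewrite setTI; apply/seteqP; split=> w /=; rewrite in_itv /= ltr_norml.
exact: mX.
Qed.

(** * Centered Gaussian variables, degenerate ones included *)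

Section centered_gaussian.
Context {R : realType}.
Local Notation N01 := (@normal_prob R 0 1).

(** [X] has the law of [s] times a standard normal variable. Testing against nonnegative continuous
    functions requires no integrability and no separate case for [s = 0]. *)
Definition cgauss {d} {T : measurableType d} (P : probability T R)
    (X : T -> R) (s : R) : Prop :=
  [/\ measurable_fun setT X, 0 <= s &
    forall f : R -> R, continuous f -> (forall x, 0 <= f x) ->
      (\int[P]_w (f (X w))%:E = \int[N01]_z (f (s * z)%R)%:E)%E].

(** The characteristic function exp(- s^2 / 2) of the centered normal law, kept unevaluated; it acts
    through its multiplicativity [gcos_conv]. *)
Definition gcos (s : R) : R := (\int[N01]_z cos (s * z))%R.

(** Adding the bound [M] gives a nonnegative function, to which [cgauss] applies. *)
Lemma cgauss_bounded {d} {T : measurableType d} (P : probability T R) X s f M :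
  cgauss P X s -> continuous f -> (forall x, `|f x| <= M) ->
  (\int[P]_w f (X w) = \int[N01]_z f (s * z))%R.
Proof.
move=> [mX s0 Xs] cf fM.
have mf : measurable_fun [set: R] f by exact: continuous_measurable_fun.
have i1 : P.-integrable setT (EFin \o (f \o X)).
  exact: (bounded_integrable M (measurableT_comp mf mX) (fun x => fM (X x))).
have i2 : N01.-integrable setT (EFin \o (fun z => f (s * z))).
  apply: (bounded_integrable M) => [|x]; last exact: fM.
  by apply: measurableT_comp => //; exact: measurable_funM.
have cfM : continuous (fun x => f x + M).
  by move=> x; apply: cvgD; [exact: cf|exact: cvg_cst].
have fM0 x : 0 <= f x + M.
  by have := fM x; rewrite ler_norml => /andP[+ _]; rewrite -lerBlDr sub0r.
have := congr1 fine (Xs _ cfM fM0).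
have e1 : (\int[P]_w (f (X w) + M) = \int[P]_w f (X w) + M)%R.
  exact: Rintegral_addc i1.
have e2 : (\int[N01]_z (f (s * z) + M) = \int[N01]_z f (s * z) + M)%R.
  exact: Rintegral_addc i2.
rewrite /Rintegral /= in e1 e2 *; rewrite e1 e2.
exact: addIr.
Qed.

Lemma cgauss_std s : 0 <= s -> cgauss N01 (fun z => s * z) s.
Proof. by move=> s0; split=> //; exact: measurable_funM. Qed.

Lemma normal_sin0 s : (\int[N01]_z sin (s * z) = 0)%R.
Proof.
have ms : measurable_fun [set: R] (fun z => sin (s * z)).
  apply: measurableT_comp; last exact: measurable_funM.
  by apply: continuous_measurable_fun; exact: continuous_sin.
have i1 : N01.-integrable setT (EFin \o (fun z => sin (s * z))).
  apply: (bounded_integrable 1) => // x.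
  by rewrite ler_norml sin_geN1 sin_le1.
have i2 : N01.-integrable setT (EFin \o (fun z => - sin (s * z))).
  apply: (bounded_integrable 1) => //; first exact: measurableT_comp.
  by move=> x; rewrite normrN ler_norml sin_geN1 sin_le1.
have ic : N01.-integrable setT (EFin \o (fun=> 1)).
  by apply: (bounded_integrable 1) => // x; rewrite normr1.
have s1 (x : R) : 0 <= 1 + sin x.
  by have := sin_geN1 x; rewrite -lerBlDl sub0r.
have := @normal_prob_sym R (fun z => 1 + sin (s * z)) (fun z => s1 (s * z)).
move=> /(_ (measurable_funD (measurable_cst _) ms)) /(congr1 fine).
have e1 : (\int[N01]_z (1 + sin (s * z)) = 1 + \int[N01]_z sin (s * z))%R.
  by under eq_Rintegral do rewrite addrC; rewrite Rintegral_addc// addrC.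
have e2 : (\int[N01]_z (1 + sin (s * - z)) = 1 - \int[N01]_z sin (s * z))%R.
  transitivity (\int[N01]_z (- sin (s * z) + 1))%R.
    by apply: eq_Rintegral => z _; rewrite mulrN sinN addrC.
  rewrite Rintegral_addc// addrC; congr (_ + _).
  rewrite -[RHS]mulN1r -RintegralZl//.
  by apply: eq_Rintegral => z _; rewrite mulN1r.
rewrite /Rintegral /= in e1 e2 *; rewrite e1 e2 => /addrI H; lra.
Qed.

Lemma cgauss_cos {d} {T : measurableType d} (P : probability T R) X s th :
  cgauss P X s -> (\int[P]_w cos (X w + th) = cos th * gcos s)%R.
Proof.
move=> Xs.
rewrite (@cgauss_bounded _ _ P X s (fun x => cos (x + th)) 1)//; last 2 first.
- move=> x; apply: (@continuous_comp _ _ _ (fun x => x + th) cos).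
    by apply: cvgD; [exact: cvg_id|exact: cvg_cst].
  exact: continuous_cos.
- by move=> x; rewrite ler_norml cos_geN1 cos_le1.
have mc : measurable_fun [set: R] (fun z => cos (s * z)).
  apply: measurableT_comp; last exact: measurable_funM.
  by apply: continuous_measurable_fun; exact: continuous_cos.
have ms : measurable_fun [set: R] (fun z => sin (s * z)).
  apply: measurableT_comp; last exact: measurable_funM.
  by apply: continuous_measurable_fun; exact: continuous_sin.
have i1 : N01.-integrable setT (EFin \o (fun z => sin (s * z))).
  apply: (bounded_integrable 1) => // x.
  by rewrite ler_norml sin_geN1 sin_le1.
have i2 : N01.-integrable setT (EFin \o (fun z => cos (s * z))).
  apply: (bounded_integrable 1) => // x.
  by rewrite ler_norml cos_geN1 cos_le1.
transitivity (\int[N01]_z (cos th * cos (s * z) - sin th * sin (s * z)))%R.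
  by apply: eq_Rintegral => z _; rewrite cosD; ring.
rewrite RintegralB//; last 2 first.
- exact: (integrableZl measurableT (cos th) i2).
- exact: (integrableZl measurableT (sin th) i1).
by rewrite !RintegralZl// normal_sin0 mulr0 subr0.
Qed.

Lemma gcos0 : gcos 0 = 1.
Proof.
rewrite /gcos; under eq_Rintegral do rewrite mul0r cos0.
exact: Rintegral_cst1.
Qed.

(** This is [normal_prob_conv] for the nonnegative function [1 + cos]. That lemma asks for positive
    deviations, hence the separate cases [a = 0] and [b = 0]. *)
Lemma gcos_conv a b c : 0 <= a -> 0 <= b -> 0 <= c ->
  c ^+ 2 = a ^+ 2 + b ^+ 2 -> gcos c = gcos a * gcos b.
Proof.
move=> a0 b0 c0 cab.
have sqI (x y : R) : 0 <= x -> 0 <= y -> x ^+ 2 = y ^+ 2 -> x = y.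
  by move=> x0 y0 /eqP; rewrite eqrXn2// => /eqP.
have [a00|an0] := eqVneq a 0.
  rewrite a00 gcos0 mul1r; congr gcos; apply: sqI => //.
  by rewrite cab a00 expr0n /= add0r.
have [b00|bn0] := eqVneq b 0.
  rewrite b00 gcos0 mulr1; congr gcos; apply: sqI => //.
  by rewrite cab b00 expr0n /= addr0.
have a1 : 0 < a by rewrite lt_neqAle eq_sym an0.
have b1 : 0 < b by rewrite lt_neqAle eq_sym bn0.
have c1 : 0 < c.
  rewrite lt_neqAle c0 andbT eq_sym -sqrf_eq0 cab gt_eqF//.
  by rewrite addr_gt0// exprn_gt0.
have c10 (x : R) : 0 <= 1 + cos x.
  by have := cos_geN1 x; rewrite -lerBlDl sub0r.
have cc : continuous (fun x : R => 1 + cos x).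
  by move=> x; apply: cvgD; [exact: cvg_cst|exact: continuous_cos].
have ibd (f : R -> R) M : measurable_fun [set: R] f -> (forall x, `|f x| <= M) ->
    N01.-integrable setT (EFin \o f) by move=> *; exact: (bounded_integrable M).
have mcos (u v : R) : measurable_fun [set: R] (fun z => cos (u * z + v)).
  apply: measurableT_comp.
    by apply: continuous_measurable_fun; exact: continuous_cos.
  by apply: measurable_funD => //; exact: measurable_funM.
have icos (u v : R) : N01.-integrable setT (EFin \o (fun z => cos (u * z + v))).
  by apply: (ibd _ 1) => // x; rewrite ler_norml cos_geN1 cos_le1.
have i1 : N01.-integrable setT (EFin \o (fun=> 1)).
  by apply: (ibd _ 1) => // x; rewrite normr1.
have Ec (u v : R) : 0 <= u ->
    (\int[N01]_z (1 + cos (u * z + v))%:E = (1 + cos v * gcos u)%:E)%E.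
  move=> u0; have := cgauss_cos v (cgauss_std u0).
  have e : (\int[N01]_z (1 + cos (u * z + v)) = 1 + \int[N01]_z cos (u * z + v))%R.
    by under eq_Rintegral do rewrite addrC; rewrite Rintegral_addc// addrC.
  move=> <-; rewrite -e /Rintegral fineK//.
  by apply: integrable_fin_num => //; exact: (integrableD measurableT i1 (icos u v)).
have := normal_prob_conv a1 b1 c1 cab cc c10.
have -> : (\int[N01]_z (1 + cos (c * z))%:E = (1 + gcos c)%:E)%E.
  have := Ec c 0 c0; rewrite cos0 mul1r => <-.
  by apply: eq_integral => z _; rewrite addr0.
under eq_integral => x _.
  under eq_integral do rewrite [_ + b * _]addrC.
  rewrite Ec//; over.
have -> : (\int[N01]_x (1 + cos (a * x) * gcos b)%:E = (1 + gcos a * gcos b)%:E)%E.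
  have ia : N01.-integrable setT (EFin \o (fun z => cos (a * z))).
    have := icos a 0; apply: eq_integrable => // z _ /=; by rewrite addr0.
  have e : (\int[N01]_z (1 + cos (a * z) * gcos b) = 1 + gcos a * gcos b)%R.
    under eq_Rintegral do rewrite addrC.
    rewrite Rintegral_addc; last exact: (integrableZr measurableT (gcos b) ia).
    by rewrite RintegralZr// addrC.
  rewrite -e /Rintegral fineK//.
  apply: integrable_fin_num => //.
  exact: (integrableD measurableT i1 (integrableZr measurableT (gcos b) ia)).
by case=> /addrI.
Qed.

Lemma normal_expR4 : (\int[N01]_x (expR (x ^+ 2 / 4))%:E = (Num.sqrt 2)%:E)%E.
Proof.
have := @normal_expR_sqr R (Num.sqrt 2); rewrite sqrtr_gt0 => <-//.
apply: eq_integral => x _; congr (expR _)%:E.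
by rewrite sqr_sqrtr//; field.
Qed.

(** The function [expR (x ^+ 2 / 4)] serves as a universal majorant: its mean is [sqrt 2], and it
    dominates every polynomial up to a constant. *)
Lemma normal_dominated (f : R -> R) c : measurable_fun [set: R] f ->
  (forall x, `|f x| <= c * expR (x ^+ 2 / 4)) -> N01.-integrable setT (EFin \o f).
Proof.
move=> mf fc.
have me : measurable_fun [set: R] (fun x : R => expR (x ^+ 2 / 4)).
  by apply: measurableT_comp => //; apply: measurable_funM => //; exact: measurable_funX.
have ie : N01.-integrable setT (EFin \o (fun x : R => expR (x ^+ 2 / 4))).
  apply/integrableP; split; first exact/measurable_EFinP.
  under eq_integral do rewrite /= ger0_norm ?expR_ge0//.
  by rewrite normal_expR4 ltry.
apply: (le_integrable measurableT _ _ (integrableZl measurableT c ie)) => //.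
  exact/measurable_EFinP.
by move=> x _; rewrite /= lee_fin (le_trans (fc x)) ?ler_norm.
Qed.

Lemma normr_le_expR4 (x : R) : `|x| <= expR (x ^+ 2 / 4).
Proof.
apply: le_trans (expR_ge1Dx _).
have : 0 <= (`|x| / 2 - 1) ^+ 2 by exact: sqr_ge0.
rewrite -(real_normK (num_real x)); lra.
Qed.

Lemma normal_id_integrable : N01.-integrable setT (EFin \o (@id R)).
Proof.
by apply: (@normal_dominated id 1) => // x; rewrite mul1r; exact: normr_le_expR4.
Qed.

Lemma normal_mean0 : (\int[N01]_x x%:E = 0)%E.
Proof.
have mp : measurable_fun [set: R] (fun x : R => Num.max x 0).
  exact: measurable_maxr.
rewrite integralE.
have -> : (\int[N01]_x (EFin^\+ x) = \int[N01]_x (Num.max x 0)%:E)%E.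
  by apply: eq_integral => x _; rewrite funeposE -EFin_max.
have -> : (\int[N01]_x (EFin^\- x) = \int[N01]_x (Num.max (- x)%R 0)%:E)%E.
  by apply: eq_integral => x _; rewrite funenegE -EFin_max.
rewrite -(@normal_prob_sym R (fun x => Num.max x 0))//; last first.
  by move=> x; rewrite le_max lexx orbT.
rewrite subee// fin_real//; apply/andP; split.
  by rewrite (lt_le_trans (ltNyr 0))// integral_ge0// => x _; rewrite lee_fin le_max lexx orbT.
have := normal_id_integrable => /integrableP[_]; apply: le_lt_trans.
apply: ge0_le_integral => //.
- by move=> x _; rewrite lee_fin le_max lexx orbT.
- exact/measurable_EFinP.
- by apply: measurableT_comp => //; exact/measurable_EFinP.
- by move=> x _; rewrite /= lee_fin ge_max ler_norm normr_ge0.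
Qed.

(** The point is that the location parameter [m] vanishes. The positive and negative parts are
    nonnegative and continuous, so [key] identifies their integrals with those of [m + s * z]; hence
    the mean of [X] is [m]. *)
Lemma gaussian_rv_cgauss {d} {T : measurableType d} (P : probability T R) X :
  gaussian_rv P X -> (\int[P]_w (X w)%:E = 0)%E -> exists s, cgauss P X s.
Proof.
move=> [mX [m [s0 Xms]]] EX.
(* The parameter in [gaussian_rv] may be negative; the law depends only on its absolute value. *)
pose s : R := `|s0|.
pose Xm : {mfun T >-> measurableTypeR R} :=
  HB.pack X (@isMeasurableFun.Build _ _ T (measurableTypeR R) X mX).
have key (f : R -> R) : continuous f -> (forall x, 0 <= f x) ->
    (\int[P]_w (f (X w))%:E = \int[N01]_z (f (m + s * z)%R)%:E)%E.
  move=> cf f0.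
  have mf : measurable_fun [set: R] f by exact: continuous_measurable_fun.
  have -> : (\int[P]_w (f (X w))%:E = \int[distribution P Xm]_y (f y)%:E)%E.
    by rewrite ge0_integral_distribution//; exact/measurable_EFinP.
  have [s00|sn0] := eqVneq s0 0.
    rewrite (@eq_measure_integral _ (measurableTypeR R) R setT \d_(m : measurableTypeR R)); last first.
      move=> A mA _.
      by have := Xms A mA; rewrite /gaussian_law s00 eqxx.
    rewrite integral_dirac//; last exact/measurable_EFinP.
    rewrite diracT mul1e /s s00 normr0.
    under eq_integral do rewrite mul0r addr0.
    by rewrite integral_cst// [X in _ = (_ * X)%E](probability_setT N01) mule1.
  rewrite -normal_prob_std ?normr_gt0//.
  have nE : normal_prob m s = normal_prob m s0.
    by rewrite /s; case: (ler0P s0) => _; [exact: normal_prob_neg|].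
  apply: (@eq_measure_integral _ (measurableTypeR R) R setT (normal_prob m s) (distribution P Xm)) => A mA _.
  apply: etrans (Xms A mA) _; rewrite /gaussian_law (negbTE sn0).
  exact: (congr1 (fun g => g A) (esym nE)).
suff m0 : m = 0.
  exists s; split; [exact: mX|exact: normr_ge0|move=> f cf f0; rewrite key//].
  by apply: eq_integral => z _; rewrite m0 add0r.
have cp : continuous (fun x : R => Num.max x 0).
  by move=> x; apply: continuous_max; [exact: cvg_id|exact: cvg_cst].
have cn : continuous (fun x : R => Num.max (- x) 0).
  by move=> x; apply: continuous_max; [apply: cvgN; exact: cvg_id|exact: cvg_cst].
have mx0 (x : R) : 0 <= Num.max x 0 by rewrite le_max lexx orbT.
have ic : N01.-integrable setT (EFin \o (fun=> m)).
  exact: (bounded_integrable `|m|).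
have iz : N01.-integrable setT (EFin \o (fun z => s * z)).
  exact: (integrableZl measurableT s normal_id_integrable).
apply: EFin_inj; apply: etrans EX.
transitivity (\int[N01]_z (m + s * z)%:E)%E.
  transitivity (\int[N01]_z (m%:E + (s * z)%:E))%E; last by [].
  rewrite (integralD measurableT ic iz).
  rewrite integral_cst// [X in (_ * X)%E](probability_setT N01) mule1.
  have -> : (\int[N01]_x (EFin \o (fun z => (s * z)%R)) x = 0)%E.
    transitivity (\int[N01]_x (s%:E * x%:E))%E; first by [].
    rewrite integralZl//; last exact: normal_id_integrable.
    by rewrite normal_mean0 mule0.
  by rewrite adde0.
rewrite integralE [RHS]integralE; congr (_ - _)%E.
- transitivity (\int[N01]_z (Num.max (m + s * z) 0)%:E)%E.
    by apply: eq_integral => z _; rewrite funeposE -EFin_max.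
  rewrite -(key _ cp mx0).
  by apply: eq_integral => z _; rewrite funeposE -EFin_max.
- transitivity (\int[N01]_z (Num.max (- (m + s * z)) 0)%:E)%E.
    by apply: eq_integral => z _; rewrite funenegE -EFin_max.
  rewrite -(key _ cn (fun x => mx0 (- x))).
  by apply: eq_integral => z _; rewrite funenegE -EFin_max.
Qed.

End centered_gaussian.

Section gaussian_moments.
Context {R : realType}.
Local Notation N01 := (@normal_prob R 0 1).

(** The variance of the standard normal law, kept as an unevaluated positive constant: it cancels
    when variances are compared, or is absorbed in [sd_factor]. *)
Definition normal_sqr : R := (\int[N01]_z (z ^+ 2))%R.

Lemma sqr_integrable : N01.-integrable setT (EFin \o (fun z : R => z ^+ 2)).
Proof.
apply: (@normal_dominated _ _ 4); first exact: measurable_funX.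
move=> x; rewrite ger0_norm ?sqr_ge0//.
have := expR_ge1Dx (x ^+ 2 / 4); lra.
Qed.

(** From [1 - expR (- z ^+ 2 / 2) <= z ^+ 2 / 2], whose left side has mean [1 - 1 / sqrt 2]. *)
Lemma normal_sqr_gt0 : 0 < normal_sqr.
Proof.
have mE : measurable_fun [set: R] (fun x : R => expR (- (x ^+ 2 / 2))).
  by do 2 apply: measurableT_comp => //; apply: measurable_funM => //; exact: measurable_funX.
have sq2 : 0 < (Num.sqrt (2 : R))^-1 by rewrite invr_gt0 sqrtr_gt0.
have E : (\int[N01]_x (expR (- (x ^+ 2 / 2)))%:E = (Num.sqrt (2 : R))^-1%:E)%E.
  have := @normal_expR_sqr R (Num.sqrt 2)^-1; move=> /(_ sq2) <-.
  apply: eq_integral => x _; congr (expR _)%:E.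
  by rewrite exprVn invrK sqr_sqrtr//; field.
have iE : N01.-integrable setT (EFin \o (fun x : R => expR (- (x ^+ 2 / 2)))).
  apply/integrableP; split; first exact/measurable_EFinP.
  under eq_integral do rewrite /= ger0_norm ?expR_ge0//.
  by rewrite E ltry.
have i0 : N01.-integrable setT (EFin \o (fun=> 1 : R)).
  by apply: (bounded_integrable 1) => // x; rewrite normr1.
have i1 : N01.-integrable setT (EFin \o (fun x : R => 1 - expR (- (x ^+ 2 / 2)))).
  exact: (integrableB measurableT i0 iE).
have : (\int[N01]_x (1 - expR (- (x ^+ 2 / 2))) <= \int[N01]_x (2^-1 * x ^+ 2))%R.
  apply: le_Rintegral => //; first exact: (integrableZl measurableT 2^-1 sqr_integrable).
  by move=> x _; have := expR_ge1Dx (- (x ^+ 2 / 2)); lra.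
rewrite RintegralZl//; last exact: sqr_integrable.
rewrite RintegralB//.
have -> : (\int[N01]_x expR (- (x ^+ 2 / 2)) = (Num.sqrt 2)^-1)%R by rewrite /Rintegral E.
have := Rintegral_cst1 N01 1; move=> ->.
have : (Num.sqrt (2 : R))^-1 < 1.
  rewrite invf_lt1 ?sqrtr_gt0// -[ltLHS]sqrtr1 ltr_sqrt// ltr1n//.
rewrite /normal_sqr; lra.
Qed.

Context {d} {T : measurableType d} (P : probability T R).
Implicit Types (X : T -> R) (s t : R).

Lemma cgauss_sqr X s : cgauss P X s ->
  (\int[P]_w (X w ^+ 2)%:E = (s ^+ 2 * normal_sqr)%:E)%E.
Proof.
move=> [mX s0 Xs].
rewrite (Xs (fun x => x ^+ 2)); last 2 first.
- by move=> x; exact: exprn_continuous.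
- by move=> x; exact: sqr_ge0.
under eq_integral do rewrite exprMn EFinM.
rewrite integralZl//; last exact: sqr_integrable.
rewrite [RHS]EFinM; congr (_ * _)%E.
by rewrite /normal_sqr /Rintegral fineK// integrable_fin_num//; exact: sqr_integrable.
Qed.

(** Markov's inequality for [expR ((x / sigma) ^+ 2 / 4)], whose mean is at most [sqrt 2 <= 2] when
    [s <= sigma]. The rate 1/4, instead of the sharp 1/2, keeps this mean finite. *)
Lemma cgauss_tail X s sigma t : cgauss P X s -> s <= sigma -> 0 < sigma -> 0 <= t ->
  (P [set w | (t <= `|X w|)%R] <= (2 * expR (- ((t / sigma) ^+ 2 / 4)))%:E)%E.
Proof.
move=> [mX s0 Xs] ss sig0 t0.
set A := [set w | _].
have mA : measurable A.
  rewrite (_ : A = ~` [set w | `|X w| < t]); last first.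
    by apply/seteqP; split=> w; rewrite /A /= leNgt => /negP.
  exact/measurableC/measurable_normr_lt.
pose c := expR (- ((t / sigma) ^+ 2 / 4)).
pose f (x : R) := c * expR ((x / sigma) ^+ 2 / 4).
have f0 x : 0 <= f x by rewrite mulr_ge0// expR_ge0.
have cf : continuous f.
  have c1 : continuous (fun x : R => x / sigma).
    by move=> x; apply: cvgM; [exact: cvg_id|exact: cvg_cst].
  have c2 : continuous (fun x : R => (x / sigma) ^+ 2 / 4).
    move=> x; apply: cvgM; last exact: cvg_cst.
    exact: (continuous_comp (c1 x) (@exprn_continuous _ 2 _)).
  move=> x; apply: cvgM; first exact: cvg_cst.
  exact: (continuous_comp (c2 x) (@continuous_expR _ _)).
have -> : P A = (\int[P]_w (\1_A w)%:E)%E by rewrite integral_indic// setIT.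
apply: (@le_trans _ _ (\int[P]_w (f (X w))%:E)%E).
  apply: ge0_le_integral => //.
  - exact/measurable_EFinP/measurable_indic.
  - by apply/measurable_EFinP; apply: measurableT_comp => //; exact: continuous_measurable_fun.
  - move=> w _; rewrite lee_fin indicE; case: (boolP (w \in A)) => //= wA.
    rewrite /f /c -expRD -[leLHS]expR0 ler_expR.
    move: wA; rewrite inE /A /= => tX.
    have : (t / sigma) ^+ 2 <= (X w / sigma) ^+ 2.
      rewrite -[leRHS](real_normK (num_real _)) ler_pXn2r// ?nnegrE ?divr_ge0 ?(ltW sig0)//.
      by rewrite normrM (gtr0_norm (x := sigma^-1)) ?invr_gt0// ler_pM2r ?invr_gt0.
    lra.
rewrite (Xs f cf f0).
apply: (@le_trans _ _ (\int[N01]_z (c * expR (z ^+ 2 / 4))%:E)%E).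
  apply: ge0_le_integral => //.
  - by move=> z _; rewrite lee_fin.
  - by apply/measurable_EFinP; apply: measurableT_comp; [exact: continuous_measurable_fun|exact: measurable_funM].
  - apply/measurable_EFinP; apply: measurable_funM => //.
    by apply: measurableT_comp => //; apply: measurable_funM => //; exact: measurable_funX.
  - move=> z _; rewrite lee_fin /f ler_pM2l ?expR_gt0// ler_expR ler_pM2r//.
    rewrite mulrAC exprMn ler_piMl ?sqr_ge0//.
    by rewrite expr_le1// ?divr_ge0 ?(ltW sig0)// ler_pdivrMr// mul1r.
under eq_integral do rewrite EFinM.
rewrite ge0_integralZl//; last 2 first.
- by apply/measurable_EFinP; apply: measurableT_comp => //; apply: measurable_funM => //; exact: measurable_funX.
- by rewrite lee_fin expR_ge0.
rewrite normal_expR4 -EFinM lee_fin mulrC ler_pM2r ?expR_gt0//.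
by rewrite -[leRHS]gtr0_norm// -sqrtr_sqr ler_sqrt// expr2; lra.
Qed.

End gaussian_moments.

(** * Small balls of Gaussian vectors *)

Section step_polynomials.
Context {R : realType}.
Implicit Types (y z q : R) (n m : nat).

Lemma bernoulli_ineq y n : -1 <= y -> 1 + n%:R * y <= (1 + y) ^+ n.
Proof.
move=> y1; elim: n => [|n IH]; first by rewrite mul0r addr0 expr0.
rewrite exprS.
have y0 : 0 <= 1 + y by lra.
apply: le_trans (ler_wpM2l y0 IH).
have : 0 <= n%:R * y ^+ 2 by rewrite mulr_ge0// sqr_ge0.
rewrite -natr1 expr2; lra.
Qed.

(** With [s] the square root of [q], Bernoulli's inequality bounds [m * s ^+ m], and the other
    factor [s ^+ m] tends to 0. *)
Lemma cvg_natmul_expr q : 0 <= q < 1 -> (fun m => m%:R * q ^+ m) @ \oo --> (0 : R).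
Proof.
move=> /andP[q0 q1].
have [->|qn0] := eqVneq q 0.
  rewrite (_ : (fun m => _) = cst 0); first exact: cvg_cst.
  by apply/funext => -[|m]; rewrite ?mul0r// expr0n mulr0.
have s0 : 0 < Num.sqrt q by rewrite sqrtr_gt0 lt_neqAle eq_sym qn0.
set s := Num.sqrt q in s0.
have s1 : s < 1 by rewrite -(@sqrtr1 R) ltr_sqrt.
have qE : q = s * s by rewrite -expr2 sqr_sqrtr.
have h0 : 0 < s^-1 - 1 by rewrite subr_gt0 invf_gt1.
have bd m : m%:R * s ^+ m <= (s^-1 - 1)^-1.
  rewrite -ler_pdivlMr ?exprn_gt0// -[leLHS](mulfK (lt0r_neq0 h0)) [leRHS]mulrC.
  rewrite ler_pM2r ?invr_gt0// -exprVn.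
  apply: (@le_trans _ _ (1 + m%:R * (s^-1 - 1))); first lra.
  rewrite (le_trans (bernoulli_ineq _ _))//; first lra.
  by rewrite addrC subrK.
apply: (@squeeze_cvgr _ _ _ _ (cst 0) (fun m => (s^-1 - 1)^-1 * s ^+ m)).
- near=> m; rewrite /= mulr_ge0 ?exprn_ge0//= qE exprMn mulrA.
  by rewrite ler_pM2r ?exprn_gt0.
- exact: cvg_cst.
- rewrite -[X in _ --> X](mulr0 (s^-1 - 1)^-1).
  apply: cvgM; first exact: cvg_cst.
  by apply: cvg_expr; rewrite ger0_norm ?ltW.
Unshelve. all: by end_near.
Qed.

(* The exponent [m * 2 ^ m] makes the limit vanish at the threshold [1/2] too. *)
Definition step_poly m z : R := (1 - z ^+ m) ^+ (m * 2 ^ m).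

Lemma step_poly_bound m z : 0 <= z <= 1 -> 0 <= step_poly m z <= 1.
Proof.
move=> /andP[z0 z1]; rewrite /step_poly.
have zm1 : z ^+ m <= 1 by exact: exprn_ile1.
have zm0 : 0 <= z ^+ m by exact: exprn_ge0.
by rewrite exprn_ge0 ?exprn_ile1 ?subr_ge0// lerBlDr lerDl.
Qed.

(** The exponent times [z ^+ m] is [m * (2 * z) ^+ m]. Below 1/2 this tends to 0 and Bernoulli's
    inequality forces the limit 1. From 1/2 on it is at least [m], and [(1 - t) ^+ n <= 1 / (1 + t)
    ^+ n <= 1 / (1 + n * t)] forces the limit 0. *)
Lemma step_poly_cvg z : 0 <= z <= 1 ->
  (fun m => step_poly m z) @ \oo --> ((z < 2^-1)%R%:R : R).
Proof.
move=> z01; have /andP[z0 z1] := z01.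
have nE m : (m * 2 ^ m)%:R * z ^+ m = m%:R * (2 * z) ^+ m.
  by rewrite natrM natrX exprMn mulrA.
have [zlt|zge] := ltP z 2^-1.
- apply: (@squeeze_cvgr _ _ _ _ (fun m => 1 - m%:R * (2 * z) ^+ m) (cst 1)).
  + near=> m; have /andP[_ ->] := step_poly_bound m z01; rewrite andbT.
    have zm1 : z ^+ m <= 1 by exact: exprn_ile1.
    have := @bernoulli_ineq (- z ^+ m) (m * 2 ^ m).
    by rewrite mulrN nE; apply; rewrite lerN2.
  + rewrite -[X in _ --> X]subr0; apply: cvgB; first exact: cvg_cst.
    by apply: cvg_natmul_expr; lra.
  + exact: cvg_cst.
- apply: (@squeeze_cvgr _ _ _ _ (cst 0) (@harmonic R)).
  + near=> m; have /andP[-> _] := step_poly_bound m z01; rewrite /=.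
    have zm0 : 0 <= z ^+ m by exact: exprn_ge0.
    have zm1 : z ^+ m <= 1 by exact: exprn_ile1.
    have h1 : m.+1%:R <= (1 + z ^+ m) ^+ (m * 2 ^ m).
      apply: le_trans (bernoulli_ineq _ _); last lra.
      rewrite nE -natr1 addrC lerD2l ler_peMr// exprn_ege1//.
      by rewrite -ler_pdivrMl// mulr1.
    have h2 : (1 - z ^+ m) ^+ (m * 2 ^ m) * (1 + z ^+ m) ^+ (m * 2 ^ m) <= 1.
      rewrite -exprMn exprn_ile1//; first by rewrite mulr_ge0// ?subr_ge0// addr_ge0.
      by rewrite -subr_sqr expr1n lerBlDr lerDl sqr_ge0.
    rewrite /step_poly -[leRHS]mul1r ler_pdivlMr//.
    apply: le_trans h2; rewrite ler_wpM2l// exprn_ge0// subr_ge0//.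
  + exact: cvg_cst.
  + exact: cvg_harmonic.
Unshelve. all: by end_near.
Qed.

End step_polynomials.

Lemma cvg_prodr {R : realType} {J : Type} (r : seq J) (f : J -> nat -> R) (l : J -> R) :
  (forall j, f j n @[n --> \oo] --> l j) ->
  (\prod_(j <- r) f j n) @[n --> \oo] --> \prod_(j <- r) l j.
Proof.
move=> fl; elim: r => [|j r IH].
  by rewrite big_nil; under eq_cvg do rewrite big_nil; exact: cvg_cst.
by rewrite big_cons; under eq_cvg do rewrite big_cons; apply: cvgM.
Qed.

(** * Probabilities of boxes from means of cosines *)

Section trigonometric_polynomials.
Context {R : realType} {I : finType}.
Implicit Types (F G : (I -> R) -> R) (c : I -> R) (th a : R).

(** The functions whose means are known once those of cosines of affine forms are. Stability under
    products, which comes from the product formula for cosines, is what gives access to powers and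
    hence to approximate indicators. *)
Inductive trigpoly : ((I -> R) -> R) -> Prop :=
| trigpoly_cos c th : trigpoly (fun x => cos (\sum_i c i * x i + th))
| trigpolyD F G : trigpoly F -> trigpoly G -> trigpoly (fun x => F x + G x)
| trigpolyZ a F : trigpoly F -> trigpoly (fun x => a * F x).

Lemma trigpoly_cst a : trigpoly (fun=> a).
Proof.
rewrite (_ : (fun=> a) =
    (fun x : I -> R => a * cos (\sum_i (fun=> 0) i * x i + 0))).
  exact/trigpolyZ/trigpoly_cos.
apply/funext => x; rewrite big1 ?addr0 ?cos0 ?mulr1// => i _; exact: mul0r.
Qed.

Lemma trigpolyM F G : trigpoly F -> trigpoly G -> trigpoly (fun x => F x * G x).
Proof.
move=> tF tG; elim: tF => [c th|F1 F2 _ IH1 _ IH2|a F1 _ IH].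
- elim: tG => [c' th'|G1 G2 _ IH1 _ IH2|a G1 _ IH].
  + rewrite (_ : (fun x => _) = (fun x =>
        2^-1 * (cos (\sum_i (fun i => c i + c' i) i * x i + (th + th')) +
                cos (\sum_i (fun i => c i - c' i) i * x i + (th - th'))))).
      by apply: trigpolyZ; apply: trigpolyD; exact: trigpoly_cos.
    apply/funext => x.
    have -> : \sum_i (c i + c' i) * x i + (th + th') =
        (\sum_i c i * x i + th) + (\sum_i c' i * x i + th').
      by rewrite addrACA -big_split /=; under eq_bigr do rewrite mulrDl.
    have -> : \sum_i (c i - c' i) * x i + (th - th') =
        (\sum_i c i * x i + th) - (\sum_i c' i * x i + th').
      rewrite opprD addrACA -sumrN -big_split /=.
      by under eq_bigr do rewrite mulrBl.
    set A := \sum_i c i * x i + th; set B := \sum_i c' i * x i + th'.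
    by rewrite (cosD A B) (cosB A B); field.
  + rewrite (_ : (fun x => _) = (fun x =>
      cos (\sum_i c i * x i + th) * G1 x + cos (\sum_i c i * x i + th) * G2 x)).
      exact: trigpolyD.
    by apply/funext => x; rewrite mulrDr.
  + rewrite (_ : (fun x => _) = (fun x => a * (cos (\sum_i c i * x i + th) * G1 x))).
      exact: trigpolyZ.
    by apply/funext => x; rewrite mulrCA.
- rewrite (_ : (fun x => _) = (fun x => F1 x * G x + F2 x * G x)).
    exact: trigpolyD.
  by apply/funext => x; rewrite mulrDl.
- rewrite (_ : (fun x => _) = (fun x => a * (F1 x * G x))); first exact: trigpolyZ.
  by apply/funext => x; rewrite mulrA.
Qed.

Lemma trigpolyX F n : trigpoly F -> trigpoly (fun x => F x ^+ n).
Proof.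
move=> tF; elim: n => [|n IH]; first exact: trigpoly_cst.
rewrite (_ : (fun x => _) = (fun x => F x * F x ^+ n)); first exact: trigpolyM.
by apply/funext => x; rewrite exprS.
Qed.

Lemma trigpoly_prod (J : Type) (r : seq J) (F : J -> (I -> R) -> R) :
  (forall j, trigpoly (F j)) -> trigpoly (fun x => \prod_(j <- r) F j x).
Proof.
move=> tF; elim: r => [|j r IH].
  rewrite (_ : (fun x => _) = (fun=> 1)); first exact: trigpoly_cst.
  by apply/funext => x; rewrite big_nil.
rewrite (_ : (fun x => _) = (fun x => F j x * \prod_(j <- r) F j x)).
  exact: trigpolyM.
by apply/funext => x; rewrite big_cons.
Qed.

Lemma trigpoly_cos1 i a : trigpoly (fun x => cos (a * x i)).
Proof.
rewrite (_ : (fun x => _) =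
    (fun x : I -> R => cos (\sum_j (fun j => a *+ (j == i)) j * x j + 0))).
  exact: trigpoly_cos.
apply/funext => x; rewrite addr0 (bigD1 i)//= eqxx mulr1n big1 ?addr0//.
by move=> j /negbTE ->; rewrite mul0r.
Qed.

(* In [0, 1], and below [1/2] exactly when [cos (x / N) > cos (a / N)]. *)
Definition cos_gap (N : nat) (a x : R) : R :=
  2^-1 - 4^-1 * (cos (N.+1%:R^-1 * x) - cos (N.+1%:R^-1 * a)).

Lemma cos_gap_bound N a x : 0 <= cos_gap N a x <= 1.
Proof.
rewrite /cos_gap.
have := cos_geN1 (N.+1%:R^-1 * x); have := cos_le1 (N.+1%:R^-1 * x).
have := cos_geN1 (N.+1%:R^-1 * a); have := cos_le1 (N.+1%:R^-1 * a).
lra.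
Qed.

(** For large [N] both arguments, up to sign, lie in [0, pi], where cosine decreases. *)
Lemma cos_gap_lt a x : 0 < a ->
  \forall N \near \oo, (cos_gap N a x < 2^-1) = (`|x| < a).
Proof.
move=> a0; near=> N.
have N0 : 0 < (N.+1%:R : R) by rewrite ltr0n.
have hN : `|x| + a <= N.+1%:R * pi.
  have : `|x| + a <= N%:R.
    by near: N; exact: nbhs_infty_ger.
  move=> /le_trans; apply.
  apply: (@le_trans _ _ N.+1%:R); first by rewrite ler_nat.
  rewrite ler_peMr ?ltW//.
  by have := pi_ge2 R; lra.
rewrite /cos_gap gtrBl pmulr_rgt0 ?invr_gt0// subr_gt0.
have -> : cos (N.+1%:R^-1 * x) = cos (N.+1%:R^-1 * `|x|).
  by case: (ger0P x) => // _; rewrite mulrN cosN.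
have bd u : 0 <= u -> u <= `|x| + a -> N.+1%:R^-1 * u \in `[0, pi].
  move=> u0 ux; rewrite in_itv /= mulr_ge0 ?invr_ge0 ?(ltW N0)//=.
  by rewrite ler_pdivrMl//; exact: le_trans hN.
have x0 := normr_ge0 x.
rewrite ltr_cos ?ltr_pM2l ?invr_gt0//; apply: bd; lra.
Unshelve. all: by end_near.
Qed.

(** An approximation of the indicator of the box [|x i| < a i], reached by letting [m] and then [N]
    tend to infinity. *)
Definition slab_poly (N m : nat) (a x : I -> R) : R :=
  \prod_i step_poly m (cos_gap N (a i) (x i)).

Lemma trigpoly_slab N m (a : I -> R) : trigpoly (slab_poly N m a).
Proof.
apply: trigpoly_prod => i; apply: trigpolyX.
rewrite (_ : (fun x => _) = (fun x => 1 + -1 * cos_gap N (a i) (x i) ^+ m)).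
  apply: trigpolyD; first exact: trigpoly_cst.
  apply/trigpolyZ/trigpolyX.
  rewrite (_ : (fun x => _) = (fun x : I -> R =>
     (2^-1 + 4^-1 * cos (N.+1%:R^-1 * a i)) + (- 4^-1) * cos (N.+1%:R^-1 * x i))).
    apply: trigpolyD; first exact: trigpoly_cst.
    exact/trigpolyZ/trigpoly_cos1.
  by apply/funext => x; rewrite /cos_gap; ring.
by apply/funext => x; rewrite mulN1r.
Qed.

End trigonometric_polynomials.

Lemma measurable_slabs {d} {T : measurableType d} {R : realType} {I : finType}
    (X : I -> T -> R) (a : I -> R) :
  (forall i, measurable_fun setT (X i)) ->
  measurable [set w | forall i, `|X i w| < a i].
Proof.
move=> mX.
rewrite (_ : [set w | _] = \bigcap_(i in setT) [set w | `|X i w| < a i]).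
  by apply: fin_bigcap_measurable => // i _; exact: measurable_normr_lt.
by apply/seteqP; split=> w /= h; [move=> i _; exact: h|move=> i; exact: h].
Qed.

Section equality_of_laws.
Context {R : realType} {I : finType}.
Context {d1} {T1 : measurableType d1} (P1 : probability T1 R) (X : I -> T1 -> R).
Context {d2} {T2 : measurableType d2} (P2 : probability T2 R) (Y : I -> T2 -> R).
Hypothesis mX : forall i, measurable_fun setT (X i).
Hypothesis mY : forall i, measurable_fun setT (Y i).
Hypothesis cosXY : forall (c : I -> R) th,
  (\int[P1]_w cos (\sum_i c i * X i w + th) =
   \int[P2]_w cos (\sum_i c i * Y i w + th))%R.
Implicit Types (F G : (I -> R) -> R).

Let same_mean F :=
  [/\ P1.-integrable setT (fun w => (F (X^~ w))%:E),
      P2.-integrable setT (fun w => (F (Y^~ w))%:E) &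
      (\int[P1]_w (F (X^~ w))%:E = \int[P2]_w (F (Y^~ w))%:E)%E].

Let same_mean_trigpoly F : trigpoly F -> same_mean F.
Proof.
elim=> [c th|F1 F2 _ [iX1 iY1 e1] _ [iX2 iY2 e2]|a F1 _ [iX iY e]].
- have ml d (T : measurableType d) (Z : I -> T -> R) :
      (forall i, measurable_fun setT (Z i)) ->
      measurable_fun setT (fun w => cos (\sum_i c i * Z i w + th)).
    move=> mZ; apply: measurableT_comp.
      by apply: continuous_measurable_fun; exact: continuous_cos.
    apply: measurable_funD => //; apply: measurable_sum => i.
    exact: measurable_funM.
  have il d (T : measurableType d) (Q : probability T R) (Z : I -> T -> R) :
      (forall i, measurable_fun setT (Z i)) ->
      Q.-integrable setT (EFin \o (fun w => cos (\sum_i c i * Z i w + th))).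
    move=> mZ; apply: (bounded_integrable 1 (ml _ _ _ mZ)) => w.
    by rewrite ler_norml cos_geN1 cos_le1.
  split; [exact: il|exact: il|].
  have h1 := fineK (integrable_fin_num measurableT (il _ _ P1 _ mX)).
  have h2 := fineK (integrable_fin_num measurableT (il _ _ P2 _ mY)).
  have h3 := congr1 EFin (cosXY c th).
  exact: etrans (etrans (esym h1) h3) h2.
- split; [exact: (integrableD measurableT iX1 iX2)|exact: (integrableD measurableT iY1 iY2)|].
  under eq_integral do rewrite EFinD.
  under [RHS]eq_integral do rewrite EFinD.
  by rewrite !integralD// e1 e2.
- split; [exact: (integrableZl measurableT a iX)|exact: (integrableZl measurableT a iY)|].
  under eq_integral do rewrite EFinM.
  under [RHS]eq_integral do rewrite EFinM.
  by rewrite !integralZl// e.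
Qed.

Let same_mean_lim (F : nat -> (I -> R) -> R) G :
  (forall n, same_mean (F n)) -> (forall n x, `|F n x| <= 1) ->
  (forall x, F n x @[n --> \oo] --> G x) -> same_mean G.
Proof.
move=> sF bF FG.
have dc d (T : measurableType d) (Q : probability T R) (Z : I -> T -> R) :
    (forall n, Q.-integrable setT (fun w => (F n (Z^~ w))%:E)) ->
    Q.-integrable setT (fun w => (G (Z^~ w))%:E) /\
    (\int[Q]_w (F n (Z^~ w))%:E)%E @[n --> \oo] --> (\int[Q]_w (G (Z^~ w))%:E)%E.
  move=> iF.
  have cF w : (F n (Z^~ w))%:E @[n --> \oo] --> (G (Z^~ w))%:E.
    by apply: cvg_EFin; [exact: nearW|exact: FG].
  have mG : measurable_fun setT (fun w => (G (Z^~ w))%:E).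
    apply: (emeasurable_fun_cvg (fun n w => (F n (Z^~ w))%:E)) => // n.
    exact: measurable_int (iF n).
  have i1 : Q.-integrable setT (EFin \o (fun=> 1)).
    by apply: (bounded_integrable 1) => // w; rewrite normr1.
  have mF n : measurable_fun setT (fun w => (F n (Z^~ w))%:E).
    exact: measurable_int (iF n).
  have ae1 : {ae Q, forall w, setT w -> (F n (Z^~ w))%:E @[n --> \oo] --> (G (Z^~ w))%:E}.
    by apply: aeW => w _.
  have ae2 : {ae Q, forall w n, setT w -> (`|(F n (Z^~ w))%:E| <= (EFin \o (fun=> 1%R)) w)%E}.
    by apply: aeW => w n _ /=; rewrite lee_fin.
  by have [iG _ cG] := dominated_convergence measurableT mF mG ae1 i1 ae2.
have [iX cX] := dc _ _ P1 X (fun n => let: And3 i _ _ := sF n in i).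
have [iY cY] := dc _ _ P2 Y (fun n => let: And3 _ i _ := sF n in i).
split=> //; apply: cvg_unique cX _ => //.
rewrite (_ : (fun n => _) = (fun n => \int[P2]_w (F n (Y^~ w))%:E)%E)//.
by apply/funext => n; case: (sF n).
Qed.

(** A Cramer-Wold argument for symmetric boxes: two dominated passages to the limit carry the
    equality of means from trigonometric polynomials to the indicator of the box. *)
Lemma eq_prob_slabs (a : I -> R) : (forall i, 0 < a i) ->
  P1 [set w | forall i, `|X i w| < a i] = P2 [set w | forall i, `|Y i w| < a i].
Proof.
move=> a0.
have pb (f : I -> R) : (forall i, 0 <= f i <= 1) -> `|\prod_i f i| <= 1.
  move=> f01; suff /andP[p0 p1] : 0 <= \prod_i f i <= 1 by rewrite ger0_norm.
  apply: (big_ind (fun u => 0 <= u <= 1)) => [|u v /andP[u0 u1] /andP[v0 v1]|i _].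
  - by rewrite ler01 lexx.
  - by rewrite mulr_ge0//= mulr_ile1.
  - exact: f01.
have s1 N : same_mean (fun x => \prod_i ((cos_gap N (a i) (x i) < 2^-1)%R%:R : R)).
  apply: (same_mean_lim (F := fun m => slab_poly N m a)).
  - by move=> m; exact/same_mean_trigpoly/trigpoly_slab.
  - by move=> m x; apply: pb => i; apply: step_poly_bound; exact: cos_gap_bound.
  - move=> x; apply: cvg_prodr => i.
    apply: step_poly_cvg; exact: cos_gap_bound.
have s2 : same_mean (fun x => \prod_i ((`|x i| < a i)%R%:R : R)).
  apply: (same_mean_lim s1).
  - by move=> N x; apply: pb => i; case: (_ < _); rewrite ?lexx ?ler01.
  - move=> x; apply: cvg_prodr => i.
    apply: cvg_near_cst.
    by apply: filterS (cos_gap_lt (x i) (a0 i)) => N ->.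
have PE d (T : measurableType d) (Q : probability T R) (Z : I -> T -> R) :
    (forall i, measurable_fun setT (Z i)) ->
    (\int[Q]_w (\prod_i ((`|Z i w| < a i)%R%:R : R))%:E =
     Q [set w | forall i, (`|Z i w| < a i)%R])%E.
  move=> mZ.
  rewrite -[X in _ = Q X]setIT -integral_indic//; last exact: measurable_slabs.
  apply: eq_integral => w _; congr (_%:E); rewrite indicE.
  have [wA|wA] := boolP (w \in _).
    by apply: big1 => i _; move: wA; rewrite inE /= => ->.
  move: wA; rewrite notin_setE /= => /existsNP[i /negP wi].
  by rewrite (bigD1 i)//= (negbTE wi) mul0r.
by have [_ _] := s2; rewrite !PE.
Qed.

End equality_of_laws.

(** * Independent copies and Gaussian spaces *)

Section product_probability.
Context {R : realType} {d1 d2} {T1 : measurableType d1} {T2 : measurableType d2}.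
Variables (P : probability T1 R) (Q : probability T2 R).

Definition prodP : set (T1 * T2) -> \bar R := (P \x Q)%E.

HB.instance Definition _ := Measure.copy prodP (P \x Q)%E.

Let prodP_setT : prodP setT = 1%E.
Proof.
rewrite /prodP -setXTT product_measure1E//.
rewrite [X in (X * _)%E](probability_setT P) [X in (_ * X)%E](probability_setT Q).
by rewrite mule1.
Qed.

HB.instance Definition _ := Measure_isProbability.Build _ _ _ prodP prodP_setT.

Lemma prodP_setX A B : measurable A -> measurable B ->
  (prodP (A `*` B) = P A * Q B)%E.
Proof. exact: product_measure1E. Qed.

Lemma Rintegral_prodP (f : T1 * T2 -> R) M : measurable_fun setT f ->
  (forall x, `|f x| <= M) ->
  (\int[prodP]_z f z = \int[P]_x \int[Q]_y f (x, y))%R.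
Proof.
move=> mf fM.
have fi : (P \x Q)%E.-integrable setT (EFin \o f).
  exact: (@bounded_integrable _ _ _ prodP f M mf fM).
rewrite /Rintegral -(integral12_prod_meas1 fi); congr fine.
apply: eq_integral => x _; rewrite /fubini_F /= fineK//.
apply: (integrable_fin_num measurableT).
apply: (bounded_integrable M); last by move=> y; exact: fM.
exact: measurableT_comp (measurable_pair1 x).
Qed.

End product_probability.

Section gaussian_spaces.
Context {R : realType} {d} {T : measurableType d} (P : probability T R).
Implicit Types (X Y : T -> R) (H : set (T -> R)).

(* Joint Gaussianity: a linear space all of whose members are centered normal. *)
Definition gspace H : Prop :=
  [/\ forall X Y, H X -> H Y -> H (fun w => X w + Y w),
      forall a X, H X -> H (fun w => a * X w) &
      forall X, H X -> exists s, cgauss P X s].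

Variables (H : set (T -> R)) (gH : gspace H).

Lemma gspace_measurable X : H X -> measurable_fun setT X.
Proof. by have [_ _ cH] := gH; move=> /cH[s []]. Qed.

Lemma gspace_sum (I : finType) (i0 : I) (X : I -> T -> R) (c : I -> R) :
  (forall i, H (X i)) -> H (fun w => \sum_i c i * X i w).
Proof.
have [HD HZ _] := gH; move=> HX.
have H0 : H (fun=> 0).
  rewrite (_ : (fun=> 0) = (fun w => 0 * X i0 w)); first exact: HZ.
  by apply/funext => w; rewrite mul0r.
elim: (index_enum I) => [|i r IH].
  rewrite (_ : (fun w => _) = (fun=> 0)); first exact: H0.
  by apply/funext => w; rewrite big_nil.
rewrite (_ : (fun w => _) = (fun w => c i * X i w + \sum_(j <- r) c j * X j w)).
  by apply: HD => //; exact: HZ.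
by apply/funext => w; rewrite big_cons.
Qed.

Lemma sqr_integrable_cgauss X s : cgauss P X s ->
  P.-integrable setT (fun w => (X w ^+ 2)%:E).
Proof.
move=> Xs; have [mX _ _] := Xs; apply/integrableP; split.
  by apply/measurable_EFinP; exact: measurable_funX.
under eq_integral do rewrite /= ger0_norm ?sqr_ge0//.
by rewrite (cgauss_sqr Xs) ltry.
Qed.

Lemma mul_integrable X Y : H X -> H Y ->
  P.-integrable setT (fun w => (X w * Y w)%:E).
Proof.
have [_ _ cH] := gH; move=> HX HY.
have [s Xs] := cH _ HX; have [t Yt] := cH _ HY.
have [mX _ _] := Xs; have [mY _ _] := Yt.
apply: (le_integrable measurableT _ _
  (integrableD measurableT (sqr_integrable_cgauss Xs) (sqr_integrable_cgauss Yt))).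
  by apply/measurable_EFinP; exact: measurable_funM.
move=> w _ /=; rewrite lee_fin [leRHS]ger0_norm ?addr_ge0 ?sqr_ge0//.
rewrite normrM -(real_normK (num_real (X w))) -(real_normK (num_real (Y w))).
have : 0 <= (`|X w| - `|Y w|) ^+ 2 by exact: sqr_ge0.
have : 0 <= `|X w| * `|Y w| by rewrite mulr_ge0.
rewrite sqrrB; lra.
Qed.

Lemma orthogonal_sum (I : finType) (i0 : I) (X : I -> T -> R) (c : I -> R) Y :
  (forall i, H (X i)) -> H Y -> (forall i, \int[P]_w (X i w * Y w) = 0)%R ->
  (\int[P]_w ((\sum_i c i * X i w) * Y w) = 0)%R.
Proof.
move=> HX HY XY0; have [HD HZ _] := gH.
have H0 : H (fun=> 0).
  rewrite (_ : (fun=> 0) = (fun w => 0 * X i0 w)); first exact: HZ.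
  by apply/funext => w; rewrite mul0r.
suff : forall r : seq I, H (fun w => \sum_(i <- r) c i * X i w) /\
    (\int[P]_w ((\sum_(i <- r) c i * X i w) * Y w) = 0)%R.
  by move=> /(_ (index_enum I)) [].
elim=> [|i r [IH1 IH2]].
  split.
    rewrite (_ : (fun w => _) = (fun=> 0)); first exact: H0.
    by apply/funext => w; rewrite big_nil.
  under eq_Rintegral do rewrite big_nil mul0r.
  by rewrite Rintegral_cst// mul0r.
split.
  rewrite (_ : (fun w => _) = (fun w => c i * X i w + \sum_(j <- r) c j * X j w)).
    by apply: HD => //; exact: HZ.
  by apply/funext => w; rewrite big_cons.
transitivity (\int[P]_w (c i * (X i w * Y w) + (\sum_(j <- r) c j * X j w) * Y w))%R.
  by apply: eq_Rintegral => w _; rewrite big_cons mulrDl mulrA.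
have i1 := mul_integrable (HX i) HY.
rewrite RintegralD//; last 2 first.
- exact: (integrableZl measurableT (c i) i1).
- exact: mul_integrable.
by rewrite IH2 RintegralZl// XY0 mulr0 addr0.
Qed.

Lemma cgauss_sqrD X Y s t u :
  H X -> H Y -> cgauss P X s -> cgauss P Y t -> cgauss P (fun w => X w + Y w) u ->
  (\int[P]_w (X w * Y w) = 0)%R -> u ^+ 2 = s ^+ 2 + t ^+ 2.
Proof.
move=> HX HY Xs Yt XYu XY0.
have i1 := sqr_integrable_cgauss Xs.
have i2 := sqr_integrable_cgauss Yt.
have i3 := mul_integrable HX HY.
have sqE Z z : cgauss P Z z -> (\int[P]_w (Z w ^+ 2) = z ^+ 2 * normal_sqr)%R.
  by move=> Zz; rewrite /Rintegral (cgauss_sqr Zz).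
have := sqE _ _ XYu.
have -> : (\int[P]_w ((X w + Y w) ^+ 2) =
   \int[P]_w (X w ^+ 2) + \int[P]_w (Y w ^+ 2) + 2 * \int[P]_w (X w * Y w))%R.
  transitivity (\int[P]_w (X w ^+ 2 + Y w ^+ 2 + 2 * (X w * Y w)))%R.
    by apply: eq_Rintegral => w _; rewrite sqrrD; ring.
  rewrite RintegralD//; last 2 first.
  - exact: (integrableD measurableT i1 i2).
  - exact: (integrableZl measurableT 2 i3).
  by rewrite RintegralD// RintegralZl.
rewrite XY0 mulr0 addr0 (sqE _ _ Xs) (sqE _ _ Yt) -mulrDl.
by move=> /(mulIf (lt0r_neq0 (@normal_sqr_gt0 R))).
Qed.

Lemma cgauss_prodP X Y s t th : cgauss P X s -> cgauss P Y t ->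
  (\int[prodP P P]_z cos (X z.1 + Y z.2 + th) = cos th * (gcos s * gcos t))%R.
Proof.
move=> Xs Yt; have [mX _ _] := Xs; have [mY _ _] := Yt.
have mcos : measurable_fun [set: R] (@cos R).
  by apply: continuous_measurable_fun; exact: continuous_cos.
rewrite (@Rintegral_prodP _ _ _ _ _ _ _ _ 1); last 2 first.
- apply: measurableT_comp => //; apply: measurable_funD => //.
  by apply: measurable_funD; exact: measurableT_comp.
- by move=> z; rewrite ler_norml cos_geN1 cos_le1.
transitivity (\int[P]_x (cos (X x + th) * gcos t))%R.
  apply: eq_Rintegral => x _; rewrite -(cgauss_cos _ Yt).
  by apply: eq_Rintegral => y _ /=; congr cos; ring.
rewrite RintegralZr//; last first.
  apply: (bounded_integrable 1).
    by apply: measurableT_comp => //; exact: measurable_funD.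
  by move=> z; rewrite ler_norml cos_geN1 cos_le1.
by rewrite (cgauss_cos _ Xs) mulrA.
Qed.

(** The joined family is compared with its version [Z'] on the product space, where the two parts
    are independent by construction. Any linear combination splits into two uncorrelated parts whose
    variances add up, so by [gcos_conv] its cosines have the same mean on both sides. *)
Lemma independent_slabs (I J : finType) (X : I -> T -> R) (Y : J -> T -> R)
    (a : I -> R) (b : J -> R) (i0 : I) (j0 : J) :
  (forall i, H (X i)) -> (forall j, H (Y j)) ->
  (forall i, 0 < a i) -> (forall j, 0 < b j) ->
  (forall i j, \int[P]_w (X i w * Y j w) = 0)%R ->
  (P ([set w | forall i, (`|X i w| < a i)%R] `&` [set w | forall j, (`|Y j w| < b j)%R]) =
   P [set w | forall i, (`|X i w| < a i)%R] * P [set w | forall j, (`|Y j w| < b j)%R])%E.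
Proof.
move=> HX HY a0 b0 XY0; have [HD HZ cH] := gH.
pose Z (k : I + J) : T -> R := match k with inl i => X i | inr j => Y j end.
pose Z' (k : I + J) (z : T * T) : R :=
  match k with inl i => X i z.1 | inr j => Y j z.2 end.
pose ab (k : I + J) := match k with inl i => a i | inr j => b j end.
have mX i : measurable_fun setT (X i) by exact: gspace_measurable.
have mY j : measurable_fun setT (Y j) by exact: gspace_measurable.
have mZ k : measurable_fun setT (Z k) by case: k.
have mZ' k : measurable_fun setT (Z' k).
  by case: k => ? /=; exact: measurableT_comp.
have := @eq_prob_slabs R (I + J)%type _ _ P Z _ _ (prodP P P) Z' mZ mZ' _ ab.
have -> : [set w | forall k, `|Z k w| < ab k] =
    [set w | forall i, `|X i w| < a i] `&` [set w | forall j, `|Y j w| < b j].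
  apply/seteqP; split=> w /=.
    by move=> h; split=> [i|j]; [exact: (h (inl i))|exact: (h (inr j))].
  by move=> [h1 h2] [i|j]; [exact: h1|exact: h2].
have -> : [set z | forall k, `|Z' k z| < ab k] =
    [set w | forall i, `|X i w| < a i] `*` [set w | forall j, `|Y j w| < b j].
  apply/seteqP; split=> w /=.
    by move=> h; split=> [i|j]; [exact: (h (inl i))|exact: (h (inr j))].
  by move=> [h1 h2] [i|j]; [exact: h1|exact: h2].
move=> E; apply: etrans (prodP_setX P P (measurable_slabs a mX) (measurable_slabs b mY)).
apply: E; last by case.
move=> c th.
pose L1 w := \sum_i c (inl i) * X i w; pose L2 w := \sum_j c (inr j) * Y j w.
have HL1 : H L1 by exact: (gspace_sum i0 (c \o inl)).
have HL2 : H L2 by exact: (gspace_sum j0 (c \o inr)).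
have [s L1s] := cH _ HL1; have [t L2t] := cH _ HL2.
have [u Lu] := cH _ (HD _ _ HL1 HL2).
have L12 : (\int[P]_w (L1 w * L2 w) = 0)%R.
  apply: (orthogonal_sum i0 (c \o inl)) => // i.
  under eq_Rintegral do rewrite mulrC.
  apply: (orthogonal_sum j0 (c \o inr)) => // j.
  by under eq_Rintegral do rewrite mulrC; exact: XY0.
have uE := cgauss_sqrD HL1 HL2 L1s L2t Lu L12.
transitivity (\int[P]_w cos (L1 w + L2 w + th))%R.
  by apply: eq_Rintegral => w _; rewrite big_sumType.
rewrite (cgauss_cos th Lu) (@gcos_conv _ s t u)//.
- rewrite -(cgauss_prodP th L1s L2t); apply: eq_Rintegral => z _.
  by rewrite big_sumType.
- by case: L1s.
- by case: L2t.
- by case: Lu.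
Qed.

Lemma symmetrized_slabs (I : finType) (X : I -> T -> R) (a : I -> R) (i0 : I) :
  (forall i, H (X i)) -> (forall i, 0 < a i) ->
  P [set w | forall i, (`|X i w| < a i)%R] =
  prodP P P [set z | forall i, (`|X i z.1 - X i z.2| < Num.sqrt 2 * a i)%R].
Proof.
move=> HX a0; have [HD HZ cH] := gH.
have sq2 : 0 < Num.sqrt (2 : R) by rewrite sqrtr_gt0.
pose r := (Num.sqrt (2 : R))^-1.
have r0 : 0 < r by rewrite invr_gt0.
pose Z (i : I) (z : T * T) : R := r * (X i z.1 - X i z.2).
have mX i : measurable_fun setT (X i) by exact: gspace_measurable.
have mZ i : measurable_fun setT (Z i).
  by apply: measurable_funM => //; apply: measurable_funB; exact: measurableT_comp.
have -> : [set z : T * T | forall i, `|X i z.1 - X i z.2| < Num.sqrt 2 * a i] =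
    [set z | forall i, `|Z i z| < a i].
  apply/seteqP; split=> z /= h i; have := h i.
    by rewrite /Z normrM (gtr0_norm r0) ltr_pdivrMl.
  by rewrite /Z normrM (gtr0_norm r0) ltr_pdivrMl.
apply: eq_prob_slabs => // c th.
pose L w := \sum_i c i * X i w.
have HL : H L by exact: gspace_sum.
have [s Ls] := cH _ HL.
have [s1 L1] := cH _ (HZ r _ HL); have [s2 L2] := cH _ (HZ (- r) _ HL).
have sE a' t : cgauss P (fun w => a' * L w) t -> t ^+ 2 = a' ^+ 2 * s ^+ 2.
  move=> at'; have := cgauss_sqr at'.
  under eq_integral do rewrite exprMn EFinM.
  rewrite integralZl//; last exact: sqr_integrable_cgauss Ls.
  rewrite (cgauss_sqr Ls) -EFinM => -[]; rewrite mulrA => h.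
  exact: esym (mulIf (lt0r_neq0 (@normal_sqr_gt0 R)) h).
have r2 : r ^+ 2 = 2^-1 by rewrite /r exprVn sqr_sqrtr.
(* The multiples [r * L] and [- r * L] each carry half of the variance, since [r ^+ 2] is 1/2. *)
have s12 : s ^+ 2 = s1 ^+ 2 + s2 ^+ 2.
  by rewrite (sE _ _ L1) (sE _ _ L2) sqrrN r2; lra.
rewrite (cgauss_cos th Ls) (@gcos_conv _ s1 s2 s)//.
- rewrite -(cgauss_prodP th L1 L2); apply: eq_Rintegral => z _.
  congr (cos (_ + _)); rewrite /Z /L mulNr -mulrBr -sumrB big_distrr /=.
  by apply: eq_bigr => i _; ring.
- by case: L1.
- by case: L2.
- by case: Ls.
Qed.

End gaussian_spaces.

(** The collision probability of [p] is at least the exponential of minus its entropy (Jensen), and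
    the entropy is at most the mean code length (Gibbs). Both are used in pointwise tangent form,
    which tolerates a missing mass [delta], at the price of the factor [1 - delta * (2 + h)]. *)
Lemma entropy_sum_sqr {R : realType} (C : finType) (p L : C -> R) (h delta : R) :
  (forall c, 0 <= p c) -> \sum_c expR (- L c) <= 1 -> 1 - delta <= \sum_c p c ->
  \sum_c p c * L c <= h -> 0 <= h ->
  expR (- h) * (1 - delta * (2 + h)) <= \sum_c p c ^+ 2.
Proof.
move=> p0 L1 p1 pL h0.
have pt c : expR (- h) * (2 * p c - p c * L c - expR (- L c) + h * p c) <= p c ^+ 2.
  have [pc0|pcn0] := eqVneq (p c) 0.
    rewrite pc0 !(mulr0, mul0r) subr0 add0r addr0 expr0n /=.
    by rewrite mulrN oppr_le0 mulr_ge0// expR_ge0.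
  have pc : 0 < p c by rewrite lt_neqAle eq_sym pcn0 p0.
  (* [e1] is the tangent for Jensen and [e2] the one for Gibbs; multiplied by [p c] and added, they
     lose their logarithms. *)
  have e1 := expR_ge1Dx (ln (p c) + h).
  have e2 := expR_ge1Dx (- L c - ln (p c)).
  rewrite expRD lnK ?posrE// in e1.
  rewrite expRB lnK ?posrE// ler_pdivlMr// in e2.
  rewrite expRN mulrC ler_pdivrMr ?expR_gt0//.
  have : p c * (1 + (ln (p c) + h)) <= p c * (p c * expR h) by rewrite ler_pM2l.
  rewrite expr2; lra.
apply: le_trans (ler_sum _ (fun c _ => pt c)).
rewrite -mulr_sumr ler_pM2l ?expR_gt0// big_split /= -mulr_sumr.
rewrite !sumrB -mulr_sumr.
set S := \sum_c p c in p1 *.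
have : 0 <= (2 + h) * (S - (1 - delta)) by rewrite mulr_ge0 ?subr_ge0//; lra.
lra.
Qed.

Section finite_families_of_sets.
Context {R : realType} {d} {T : measurableType d} (mu : probability T R).
Context (C : finType) (F : C -> set T).
Hypothesis mF : forall c, measurable (F c).

Let sum_indicE (a : C -> R) : (forall c, 0 <= a c) ->
  (\sum_c (a c)%:E * mu (F c) = \int[mu]_w (\sum_c a c * \1_(F c) w)%R%:E)%E.
Proof.
move=> a0; under [RHS]eq_integral do rewrite -sumEFin.
rewrite ge0_integral_sum//.
- apply: eq_bigr => c _; under eq_integral do rewrite EFinM.
  rewrite ge0_integralZl//; last 2 first.
  - exact/measurable_EFinP/measurable_indic.
  - by rewrite lee_fin.
  by rewrite integral_indic// setIT.
- move=> c; apply/measurable_EFinP; apply: measurable_funM => //.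
- by move=> c w _; rewrite lee_fin mulr_ge0.
Qed.

Let measurable_sum_indic (a : C -> R) :
  measurable_fun setT (fun w => (\sum_c a c * \1_(F c) w)%R%:E).
Proof.
apply/measurable_EFinP; apply: measurable_sum => c.
by apply: measurable_funM.
Qed.

Lemma sum_measure_le_integral (a : C -> R) (f : T -> R) :
  (forall c, 0 <= a c) -> measurable_fun setT f -> (forall w, 0 <= f w) ->
  (forall c w, F c w -> a c <= f w) ->
  (forall c c' w, F c w -> F c' w -> c = c') ->
  (\sum_c (a c)%:E * mu (F c) <= \int[mu]_w (f w)%:E)%E.
Proof.
move=> a0 mf f0 af disj; rewrite sum_indicE//; apply: ge0_le_integral => //.
- by move=> w _; rewrite lee_fin; apply: sumr_ge0 => c _; rewrite mulr_ge0.
- exact/measurable_EFinP.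
- move=> w _; rewrite lee_fin.
  have [[c0 wc0]|nc] := pselect (exists c, F c w); last first.
    by rewrite big1// => c _; rewrite indicE memNset ?mulr0// => wc; apply: nc; exists c.
  rewrite (bigD1 c0)//= big1 ?addr0.
    by rewrite indicE mem_set// mulr1; exact: af.
  move=> c cc0; rewrite indicE memNset ?mulr0// => wc.
  by move: cc0; rewrite (disj _ _ _ wc wc0) eqxx.
Qed.

Lemma measure_le_sum (G : set T) : measurable G -> (forall w, G w -> exists c, F c w) ->
  (mu G <= \sum_c mu (F c))%E.
Proof.
move=> mG GF.
have -> : (\sum_c mu (F c) = \sum_c (1%:E * mu (F c)))%E.
  by apply: eq_bigr => c _; rewrite mul1e.
rewrite (@sum_indicE (fun=> 1))//.
have -> : mu G = (\int[mu]_w (\1_G w)%:E)%E by rewrite integral_indic// setIT.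
apply: ge0_le_integral => //.
- exact/measurable_EFinP/measurable_indic.
- move=> w _; rewrite lee_fin [leLHS]indicE.
  have s0 : 0 <= \sum_c 1 * (\1_(F c) w : R) by apply: sumr_ge0 => c _; rewrite mulr_ge0.
  case: (boolP (w \in G)) => // /set_mem /GF [c wc].
  by rewrite (bigD1 c)//= [\1_(F c) w]indicE mem_set// mulr1 lerDl; apply: sumr_ge0 => c' _; rewrite mulr_ge0.
Qed.

End finite_families_of_sets.

Section small_ball.
Context {R : realType} {d} {T : measurableType d} (P : probability T R).
Variables (H : set (T -> R)) (gH : gspace P H).
Variables (I : finType) (i0 : I) (X : I -> T -> R) (eps : I -> R).
Hypothesis HX : forall i, H (X i).
Hypothesis eps0 : forall i, 0 < eps i.

Let mX i : measurable_fun setT (X i). Proof. exact: (gspace_measurable gH (HX i)). Qed.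

(** Rounding to the nearest multiple of [eps i]. Cell 0 is centered at 0, so that a variable much
    smaller than [eps i] is almost always in it and has small entropy. *)
Let cell i (x : R) : int := Num.floor (x / eps i + 2^-1).

Let cell_dist i x y : cell i x = cell i y -> `|x - y| < eps i.
Proof.
rewrite /cell => xy.
have := floor_itv (x / eps i + 2^-1).
have := floor_itv (y / eps i + 2^-1).
rewrite -xy !(intrD, mulr1z) => /andP[y1 y2] /andP[x1 x2].
have : `|x / eps i - y / eps i| < 1 by rewrite ltr_norml; lra.
rewrite -mulrBl normrM (@gtr0_norm _ (eps i)^-1) ?invr_gt0//.
by rewrite ltr_pdivrMr// mul1r.
Qed.

(** The ordinal [c i] encodes the cell number [c i - m], between [- m] and [m]: finitely many cells,
    with a missing mass that vanishes as [m] grows. *)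
Let box m (c : {ffun I -> 'I_(m.*2.+1)}) : set T :=
  [set w | forall i, cell i (X i w) = (c i)%:Z - m%:Z].

Let measurable_box m c : measurable (@box m c).
Proof.
rewrite /box.
rewrite (_ : [set w | _] =
   \bigcap_(i in setT) [set w | cell i (X i w) = (c i)%:Z - m%:Z]); last first.
  by apply/seteqP; split=> w /= h; [move=> i _; exact: h|move=> i; exact: h].
apply: fin_bigcap_measurable => // i _.
set n := (c i)%:Z - m%:Z.
rewrite (_ : [set w | _] = setT `&` (fun w => X i w / eps i + 2^-1) @^-1` `[n%:~R, (n + 1)%:~R[).
  have : measurable_fun setT (fun w => X i w / eps i + 2^-1).
    by apply: measurable_funD => //; exact: measurable_funM.
  by apply.
rewrite setTI; apply/seteqP; split=> w /=; rewrite in_itv /=.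
  by rewrite /cell => <-; exact: floor_itv.
by move=> h; rewrite /cell; apply/eqP; rewrite floor_eq.
Qed.

Let disjoint_box m (c c' : {ffun I -> 'I_(m.*2.+1)}) w : box c w -> box c' w -> c = c'.
Proof.
move=> h h'; apply/ffunP => i; apply: val_inj => /=.
have := h' i; rewrite (h i) => /addIr; by case.
Qed.

Let box_cover m w : (forall i, `|X i w| < eps i * m%:R) -> exists c, @box m c w.
Proof.
move=> h.
have b i : 0 <= cell i (X i w) + m%:Z < m.*2.+1%:Z.
  have hy : `|X i w / eps i| < m%:R.
    by rewrite normrM (@gtr0_norm _ (eps i)^-1) ?invr_gt0// ltr_pdivrMr// mulrC.
  have := floor_itv (X i w / eps i + 2^-1); rewrite -/(cell i _) intrD mulr1z => /andP[c1 c2].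
  move: hy; rewrite ltr_norml => /andP[y1 y2].
  apply/andP; split.
    rewrite -ltzD1 -(ltr_int R) !(intrD, mulr1z, mulr0z) /= -pmulrn; lra.
  rewrite -(ltr_int R) intrD -muln2 -!pmulrn -natr1 natrM; lra.
have ltb i : (absz (cell i (X i w) + m%:Z)%R < m.*2.+1)%N.
  by have /andP[b1 b2] := b i; rewrite -ltz_nat gez0_abs.
exists [ffun i => Ordinal (ltb i)] => i; rewrite ffunE /=.
by have /andP[b1 b2] := b i; rewrite gez0_abs// addrK.
Qed.

Variables (lam : I -> int -> R) (Lam : I -> R -> R) (h : I -> R).
Hypothesis lam0 : forall i n, 0 <= lam i n.
Hypothesis lam_sum : forall i m, \sum_(j < m.*2.+1) expR (- lam i (j%:Z - m%:Z)) <= 1.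
Hypothesis mLam : forall i, measurable_fun [set: R] (Lam i).
Hypothesis Lam0 : forall i x, 0 <= Lam i x.
Hypothesis lam_Lam : forall i x, lam i (Num.floor (x / eps i + 2^-1)) <= Lam i x.
Hypothesis Lam_h : forall i, (\int[P]_w (Lam i (X i w))%:E <= (h i)%:E)%E.

(* Pigeonhole: if the independent copies [X] and [X'] fall into the same cell then
   [X - X'], which has the law of [sqrt 2 * X], is small; and the collision
   probability is at least the exponential of minus the entropy of the cell. *)
Lemma small_ball_entropy :
  ((expR (- \sum_i h i))%:E <= P [set w | forall i, (`|X i w| < eps i)%R])%E.
Proof.
set B := [set w | _]; pose hh := \sum_i h i.
have h0 i : 0 <= h i.
  by rewrite -lee_fin; apply: le_trans (Lam_h i); apply: integral_ge0 => w _; rewrite lee_fin.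
have hh0 : 0 <= hh by exact: sumr_ge0.
have mB : measurable B by exact: measurable_slabs.
have PB : P B \is a fin_num by exact: fin_num_measure.
pose p m (c : {ffun I -> 'I_(m.*2.+1)}) := fine (P (box c)).
have pE m (c : {ffun I -> 'I_(m.*2.+1)}) : P (box c) = (p m c)%:E.
  by rewrite /p fineK//; apply: fin_num_measure; exact: measurable_box.
have p0 m c : 0 <= p m c by rewrite /p fine_ge0.
have sqr_le m : \sum_c p m c ^+ 2 <= fine (P B).
  rewrite -lee_fin fineK// (symmetrized_slabs gH i0 HX eps0).
  pose G (c : {ffun I -> 'I_(m.*2.+1)}) := box c `*` box c.
  have mG c : measurable (G c) by apply: measurableX; exact: measurable_box.
  set B2 := [set z | _].
  have mB2 : measurable B2.
    apply: measurable_slabs => i.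
    by apply: measurable_funB; exact: measurableT_comp.
  have -> : prodP P P B2 = (\int[prodP P P]_z (\1_B2 z)%:E)%E.
    by rewrite integral_indic// setIT.
  apply: le_trans (@sum_measure_le_integral _ _ _ (prodP P P) _ G mG (fun=> 1) _ _ _ _ _ _) => //.
  - rewrite -sumEFin; apply: lee_sum => c _; rewrite mul1e.
    have e := prodP_setX P P (measurable_box c) (measurable_box c).
    have -> : ((p m c ^+ 2)%:E = P (box c) * P (box c))%E by rewrite !pE -EFinM expr2.
    by rewrite le_eqVlt; apply/orP; left; apply/eqP; exact: esym e.
  - move=> c z [z1 z2]; rewrite indicE mem_set// => i /=.
    apply: (@lt_trans _ _ (eps i)); first by apply: cell_dist; rewrite (z1 i) (z2 i).
    by rewrite ltr_pMl// -[ltLHS]sqrtr1 ltr_sqrt// ltr1n.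
  - by move=> c c' z [z1 _] [z1' _]; exact: disjoint_box z1 z1'.
have cost_le m : \sum_c p m c * (\sum_i lam i ((c i)%:Z - m%:Z)) <= hh.
  rewrite -lee_fin -sumEFin.
  have -> : (hh%:E = \sum_i (h i)%:E)%E by rewrite sumEFin.
  apply: (@le_trans _ _ (\int[P]_w (\sum_i Lam i (X i w))%:E)%E); last first.
    under eq_integral do rewrite -sumEFin.
    rewrite ge0_integral_sum//; last 2 first.
    - by move=> i; apply/measurable_EFinP; exact: measurableT_comp.
    - by move=> i w _; rewrite lee_fin.
    by apply: lee_sum => i _; exact: Lam_h.
  apply: le_trans (@sum_measure_le_integral _ _ _ P _ (@box m) (@measurable_box m)
    (fun c => \sum_i lam i ((c i)%:Z - m%:Z)) _ _ _ _ _ _).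
  - by apply: lee_sum => c _; rewrite pE -EFinM mulrC.
  - by move=> c; apply: sumr_ge0.
  - by apply: measurable_sum => i; exact: measurableT_comp.
  - by move=> w; apply: sumr_ge0.
  - by move=> c w wc; apply: ler_sum => i _; rewrite -(wc i); exact: lam_Lam.
  - by move=> c c' w; exact: disjoint_box.
have weight_le m : \sum_(c : {ffun I -> 'I_(m.*2.+1)}) expR (- \sum_i lam i ((c i)%:Z - m%:Z)) <= 1.
  under eq_bigr do rewrite -sumrN expR_sum.
  rewrite -(bigA_distr_bigA (fun i (j : 'I_(m.*2.+1)) => expR (- lam i (j%:Z - m%:Z)))).
  set Pi := \prod_i _; suff [//] : Pi <= 1 /\ 0 <= Pi.
  apply: (big_ind (fun u => u <= 1 /\ 0 <= u)) => [|u v [u1 u0] [v1 v0]|i _].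
  - by rewrite lexx ler01.
  - by rewrite mulr_ge0// mulr_ile1.
  - by split; [exact: lam_sum|apply: sumr_ge0 => j _; exact: expR_ge0].
have cover delta : 0 < delta -> exists m, 1 - delta <= \sum_c p m c.
  move=> delta0.
  pose G m := [set w | forall i, `|X i w| < eps i * m%:R].
  have mG m : measurable (G m) by exact: measurable_slabs.
  have GT : \bigcup_m G m = setT.
    apply/seteqP; split=> // w _.
    pose M := \sum_i `|X i w| / eps i.
    exists (Num.truncn M).+1 => //= i; rewrite mulrC -ltr_pdivrMr//.
    apply: le_lt_trans (truncnS_gt _).
    rewrite /M (bigD1 i)//= lerDl; apply: sumr_ge0 => j _.
    by rewrite divr_ge0// ltW.
  have cG : P (G m) @[m --> \oo] --> 1%E.
    have <- : P (\bigcup_m G m) = 1%E by rewrite GT; exact: probability_setT.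
    apply: nondecreasing_cvg_mu => //; first exact: bigcupT_measurable.
    move=> m n mn; apply/subsetPset => w /= wm i; apply: lt_le_trans (wm i) _.
    by rewrite ler_pM2l// ler_nat.
  have /cG : nbhs (1%E : \bar R) [set x | ((1 - delta)%:E < x)%E].
    by apply: open_nbhs_nbhs; split; [exact: open_ereal_gt_ereal|rewrite /= lte_fin gtrBl].
  move=> [m _ /(_ m (leqnn m)) /= Gm]; exists m.
  rewrite -lee_fin; apply: (le_trans (ltW Gm)).
  have := @measure_le_sum _ _ _ P _ (@box m) (@measurable_box m) (G m) (mG m).
  move=> /(_ (fun w wG => box_cover wG)) h1; apply: le_trans h1 _.
  by rewrite -sumEFin; apply: lee_sum => c _; rewrite pE.
rewrite -(fineK PB) lee_fin -/hh.
rewrite leNgt; apply/negP => lt.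
(* With this choice [1 - delta * (2 + hh)] is the midpoint between 1 and the ratio of [P B] to
   [expR (- hh)], which is below 1 by assumption. *)
pose delta := (1 - fine (P B) / expR (- hh)) / (2 + hh) / 2.
have e0 := expR_gt0 (- hh).
have r1 : 0 < 1 - fine (P B) / expR (- hh) by rewrite subr_gt0 ltr_pdivrMr// mul1r.
have h2 : 0 < 2 + hh by lra.
have delta0 : 0 < delta by rewrite /delta !divr_gt0.
have [m hm] := cover _ delta0.
have := le_trans (entropy_sum_sqr (p0 m) (weight_le m) hm (cost_le m) hh0) (sqr_le m).
have -> : delta * (2 + hh) = (1 - fine (P B) / expR (- hh)) / 2.
  by rewrite /delta; field; rewrite !gt_eqF.
rewrite mulrC -ler_pdivlMr//; lra.
Qed.

End small_ball.

(** * Code lengths for the cell of a Gaussian variable *)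

Section cell_costs.
Context {R : realType}.
Local Notation N01 := (@normal_prob R 0 1).

Lemma sum_symmetric_range (f : int -> R) m :
  \sum_(j < m.*2.+1) f (j%:Z - m%:Z) = f 0 + \sum_(i < m) (f i.+1%:Z + f (- i.+1%:Z)).
Proof.
elim: m => [|m IH]; first by rewrite big_ord_recl !big_ord0 subr0.
rewrite doubleS big_ord_recl big_ord_recr /= [in RHS]big_ord_recr /=.
have -> : \sum_(i < m.*2.+1) f ((bump 0 i)%:Z - m.+1%:Z) =
    \sum_(j < m.*2.+1) f (j%:Z - m%:Z).
  by apply: eq_bigr => j _; congr f; rewrite /bump /=; lia.
rewrite IH sub0r.
have -> : (bump 0 m.*2.+1)%:Z - m.+1%:Z = m.+1%:Z by rewrite /bump /=; lia.
by ring.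
Qed.

Lemma sum_inv_sqr m : \sum_(i < m) (i.+2%:R ^- 2 : R) <= 1.
Proof.
suff : \sum_(i < m) (i.+2%:R ^- 2 : R) <= 1 - m.+1%:R^-1.
  by move/le_trans; apply; rewrite lerBlDr lerDl.
elim: m => [|m IH]; first by rewrite big_ord0 invr1 subrr.
rewrite big_ord_recr /=; apply: le_trans (lerD IH (lexx _)) _.
have h1 : 0 < (m.+1%:R : R) by rewrite ltr0n.
have h2 : (m.+2%:R : R) = m.+1%:R + 1 by rewrite -natr1.
rewrite h2; set x := m.+1%:R in h1 *.
rewrite -subr_ge0 (_ : _ - _ = (x * (x + 1) ^+ 2)^-1); first by rewrite invr_ge0 mulr_ge0 ?sqr_ge0// ltW.
by field; rewrite !gt_eqF//; lra.
Qed.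

(* The entropy of the law of the index of the cell of width [eps] containing [X] is at
   most [h]: by Gibbs' inequality it is at most the mean of any code length [lam]
   satisfying Kraft's inequality, and [Lam] is a majorant that can be integrated. *)
Definition cell_cost {d} {T : measurableType d} (P : probability T R)
    (X : T -> R) (eps h : R) : Prop :=
  exists (lam : int -> R) (Lam : R -> R),
  [/\ (forall n, 0 <= lam n) /\
        (forall m, \sum_(j < m.*2.+1) expR (- lam (j%:Z - m%:Z)) <= 1),
      measurable_fun [set: R] Lam, (forall x, 0 <= Lam x),
      (forall x, lam (Num.floor (x / eps + 2^-1)) <= Lam x) &
      (\int[P]_w (Lam (X w))%:E <= h%:E)%E].

Lemma small_ball {d} {T : measurableType d} (P : probability T R) H (I : finType)
    (i0 : I) (X : I -> T -> R) (eps h : I -> R) :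
  gspace P H -> (forall i, H (X i)) -> (forall i, 0 < eps i) ->
  (forall i, cell_cost P (X i) (eps i) (h i)) ->
  ((expR (- \sum_i h i))%:E <= P [set w | forall i, (`|X i w| < eps i)%R])%E.
Proof.
move=> gH HX eps0 /choice[lam /choice[Lam hL]].
apply: (small_ball_entropy gH i0 HX eps0 (lam := lam) (Lam := Lam)).
- by move=> i; have [[]] := hL i.
- by move=> i; have [[]] := hL i.
- by move=> i; have [] := hL i.
- by move=> i; have [] := hL i.
- by move=> i; have [] := hL i.
- by move=> i; have [] := hL i.
Qed.

Lemma absz_floor_le (y : R) :
  (absz (Num.floor (y + 2^-1)))%:R <= `|y| + 2^-1 /\
  (Num.floor (y + 2^-1) != 0 -> 2^-1 <= `|y|).
Proof.
have := floor_itv (y + 2^-1); set n := Num.floor _; rewrite intrD mulr1z => /andP[n1 n2].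
have hn : `|n%:~R : R| <= `|y| + 2^-1.
  rewrite ler_norml; have := ler_norm y; have := ler_norm (- y); rewrite normrN; lra.
split; first by rewrite natr_absz intr_norm.
move=> n0; have : (1 : R) <= `|n%:~R|.
  by rewrite -intr_norm (ler_int R 1) -gtz0_ge1 normr_gt0.
lra.
Qed.

Lemma ln1D_le_sqrt (t : R) : 0 <= t -> ln (1 + t) <= 2 * Num.sqrt t.
Proof.
move=> t0; have s0 : 0 <= Num.sqrt t by exact: sqrtr_ge0.
apply: (@le_trans _ _ (ln ((1 + Num.sqrt t) ^+ 2))).
  rewrite ler_ln ?posrE ?exprn_gt0 ?ltr_pwDl//.
  by rewrite sqrrD expr1n sqr_sqrtr// mul1r; lra.
have p0 : 0 < 1 + Num.sqrt t by lra.
rewrite lnXn// -[_ *+ 2]mulr_natl ler_pM2l//; apply: le_ln1Dx; lra.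
Qed.

(** The code length [ln 3 + 2 * ln (1 + |n|)] satisfies Kraft's inequality by [sum_inv_sqr].
    Replacing the logarithm by a square root gives a majorant that is easy to integrate and still
    grows slowly enough in [rho] to be summed over the coarse levels. *)
Lemma cell_cost_coarse {d} {T : measurableType d} (P : probability T R) X s eps rho :
  cgauss P X s -> 0 < eps -> 0 <= rho -> s <= rho * eps ->
  cell_cost P X eps (6 + 8 * Num.sqrt rho).
Proof.
move=> [mX s0 Xs] e0 r0 se.
pose lam (n : int) : R := ln 3 + 2 * ln (1 + (absz n)%:R).
pose Lam (x : R) : R := 6 + 4 * Num.sqrt (`|x| / eps).
have Lam0 x : 0 <= Lam x by rewrite addr_ge0// mulr_ge0// sqrtr_ge0.
have ln0 (n : int) : 0 <= ln (1 + (absz n)%:R : R) by rewrite ln_ge0// lerDl.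
have cLam : continuous Lam.
  move=> x; apply: cvgD; first exact: cvg_cst.
  apply: cvgM; first exact: cvg_cst.
  have c1 : continuous (fun x : R => `|x| / eps).
    by move=> y; apply: cvgM; [exact: norm_continuous|exact: cvg_cst].
  exact: (continuous_comp (c1 x) (@sqrt_continuous _ _)).
exists lam, Lam; split.
- split=> [n|m].
    by rewrite addr_ge0 ?ln_ge0 ?mulr_ge0// ler1n.
  have E n : expR (- lam n) = 3^-1 * (1 + (absz n)%:R) ^- 2.
    have p0 : 0 < 1 + (absz n)%:R :> R by rewrite ltr_pwDl.
    rewrite /lam opprD expRD expRN lnK ?posrE//; congr (_ * _).
    have -> : 2 * ln (1 + (absz n)%:R) = ln ((1 + (absz n)%:R) ^+ 2) :> R.
      by rewrite lnXn// -[RHS]mulr_natl.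
    by rewrite expRN lnK// posrE exprn_gt0.
  rewrite (sum_symmetric_range (fun n => expR (- lam n))) E /= addr0 expr1n invr1 mulr1.
  have -> : \sum_(i < m) (expR (- lam i.+1%:Z) + expR (- lam (- i.+1%:Z))) =
      \sum_(i < m) (3^-1 * 2) * (i.+2%:R ^- 2 : R).
    apply: eq_bigr => i _; rewrite (E i.+1%:Z) absz_nat.
    by rewrite -[(i.+2)%:R]natr1 [_ + 1]addrC; ring.
  rewrite -mulr_sumr; have := sum_inv_sqr m; lra.
- exact: continuous_measurable_fun.
- exact: Lam0.
- move=> x; have [h1 _] := absz_floor_le (x / eps); rewrite /lam /Lam.
  set n := Num.floor _ in h1 *.
  have l3 : ln (3 : R) <= 2.
    by have := @le_ln1Dx R 2; rewrite (_ : 1 + 2 = 3 :> R); [apply; lra|ring].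
  have := ln1D_le_sqrt (ler0n R (absz n)).
  have : Num.sqrt (absz n)%:R <= Num.sqrt (`|x| / eps) + 1.
    have q0 : 0 <= `|x| / eps by rewrite divr_ge0// ltW.
    have sq0 : 0 <= Num.sqrt (`|x| / eps) by exact: sqrtr_ge0.
    rewrite -[leRHS]ger0_norm ?addr_ge0// -sqrtr_sqr ler_sqrt ?sqr_ge0//.
    apply: le_trans h1 _; rewrite normrM (@gtr0_norm _ eps^-1) ?invr_gt0//.
    by rewrite sqrrD sqr_sqrtr// expr1n mulr1; lra.
  lra.
- rewrite (Xs _ cLam Lam0).
  apply: (@le_trans _ _ (\int[N01]_z (6 + 4 * Num.sqrt rho * expR (z ^+ 2 / 4))%:E)%E).
    apply: ge0_le_integral => //.
    + by move=> z _; rewrite lee_fin.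
    + apply/measurable_EFinP; apply: measurableT_comp; last exact: measurable_funM.
      exact: continuous_measurable_fun.
    + apply/measurable_EFinP.
      apply: measurable_funD => //; apply: measurable_funM => //.
      by apply: measurableT_comp => //; apply: measurable_funM => //; exact: measurable_funX.
    + move=> z _; rewrite lee_fin lerD2l -mulrA ler_pM2l//.
      apply: (@le_trans _ _ (Num.sqrt rho * Num.sqrt `|z|)).
        rewrite -sqrtrM// ler_sqrt ?mulr_ge0//.
        rewrite normrM (ger0_norm s0) mulrAC ler_wpM2r//.
        by rewrite ler_pdivrMr.
      rewrite ler_wpM2l ?sqrtr_ge0//.
      have E1 : 1 <= expR (z ^+ 2 / 4).
        by have := expR_ge1Dx (z ^+ 2 / 4); have := sqr_ge0 z; lra.
      apply: (@le_trans _ _ (Num.sqrt (expR (z ^+ 2 / 4) ^+ 2))).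
        rewrite ler_sqrt ?sqr_ge0//; apply: le_trans (normr_le_expR4 z) _.
        by rewrite expr2 ler_peMl// expR_ge0.
      by rewrite sqrtr_sqr ger0_norm// expR_ge0.
  under eq_integral do rewrite EFinD.
  rewrite ge0_integralD//; last first.
  + apply/measurable_EFinP; apply: measurable_funM => //.
    by apply: measurableT_comp => //; apply: measurable_funM => //; exact: measurable_funX.
  rewrite integral_cst// [X in (_ * X + _)%E](probability_setT N01) mule1.
  under eq_integral do rewrite EFinM.
  rewrite ge0_integralZl//; last first.
    by apply/measurable_EFinP; apply: measurableT_comp => //; apply: measurable_funM => //; exact: measurable_funX.
  rewrite normal_expR4 -EFinM -EFinD lee_fin lerD2l.
  have q2 : Num.sqrt 2 <= 2 :> R.
    by rewrite -[leRHS]gtr0_norm// -sqrtr_sqr ler_sqrt// expr2; lra.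
  have : 0 <= Num.sqrt rho * (2 - Num.sqrt 2) by rewrite mulr_ge0 ?sqrtr_ge0// subr_ge0.
  lra.
Qed.

Lemma natexp_le_expR4 n : exists2 c : R, 0 <= c &
  forall z : R, (2 * `|z|) ^+ n <= c * expR (z ^+ 2 / 4).
Proof.
exists (1 + 16 ^+ n * n`!%:R); first by rewrite addr_ge0// mulr_ge0// exprn_ge0.
move=> z; have q0 : 0 <= z ^+ 2 / 4 by rewrite divr_ge0// sqr_ge0.
have E1 : 1 <= expR (z ^+ 2 / 4) by have := expR_ge1Dx (z ^+ 2 / 4); lra.
have Eq : (z ^+ 2 / 4) ^+ n <= n`!%:R * expR (z ^+ 2 / 4).
  case: n => [|n]; first by rewrite expr0 fact0 mul1r.
  have := expR_ge1Dxn n q0.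
  have f0 : 0 < (n.+1`!%:R : R) by rewrite ltr0n fact_gt0.
  move=> h; rewrite -ler_pdivrMl// mulrC; apply: le_trans h.
  by rewrite lerDr.
have uu : (2 * `|z|) ^+ n <= 1 + ((2 * `|z|) ^+ 2) ^+ n.
  rewrite exprAC; have u0 : 0 <= (2 * `|z|) ^+ n by rewrite exprn_ge0// mulr_ge0.
  have : 0 <= ((2 * `|z|) ^+ n - 1) ^+ 2 by exact: sqr_ge0.
  rewrite sqrrB; nra.
have hu : ((2 * `|z|) ^+ 2) ^+ n <= 16 ^+ n * n`!%:R * expR (z ^+ 2 / 4).
  rewrite [(2 * `|z|) ^+ 2]exprMn real_normK ?num_real//.
  have -> : (2 : R) ^+ 2 * z ^+ 2 = 16 * (z ^+ 2 / 4) by field.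
  by rewrite exprMn -mulrA ler_pM2l ?exprn_gt0.
apply: le_trans uu _; move: hu; set A := _ ^+ n; set B := _ * n`!%:R; lra.
Qed.

(** Cell 0 gets the short length [rho ^+ M]; the other cells pay about [M * ln (1 / rho)], but are
    rarely reached. In [Lam] the factor [(2 * |x| / eps) ^+ M.+1] is at least 1 outside cell 0 and
    has mean of order [rho ^+ M.+1], one power of [rho] being spent on [M / rho], which bounds the
    logarithm. *)
Lemma cell_cost_fine (M : nat) : exists2 C : R, 0 <= C &
  forall d (T : measurableType d) (P : probability T R) X s eps rho,
    cgauss P X s -> 0 < eps -> 0 < rho <= 1 -> s <= rho * eps ->
    cell_cost P X eps (C * rho ^+ M).
Proof.
pose G (z : R) := 1 + (2 * `|z|) ^+ M.+1 * (3 + M%:R + 4 * `|z|).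
have cnorm : continuous (fun z : R => `|z|) by move=> z; exact: norm_continuous.
have G0 z : 0 <= G z.
  by rewrite addr_ge0// mulr_ge0 ?exprn_ge0 ?addr_ge0 ?mulr_ge0.
have cG : continuous G.
  have c1 : continuous (fun z : R => 2 * `|z|).
    by move=> z; apply: cvgM; [exact: cvg_cst|exact: cnorm].
  move=> z; apply: cvgD; first exact: cvg_cst.
  apply: cvgM; first exact: (continuous_comp (c1 z) (@exprn_continuous _ M.+1 _)).
  apply: cvgD; first exact: cvg_cst.
  by apply: cvgM; [exact: cvg_cst|exact: cnorm].
have mG : measurable_fun [set: R] G by exact: continuous_measurable_fun.
have iG : N01.-integrable setT (EFin \o G).
  have [c1 c10 h1] := natexp_le_expR4 M.+1.
  have [c2 c20 h2] := natexp_le_expR4 M.+2.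
  apply: (@normal_dominated _ G (1 + (3 + M%:R) * c1 + 2 * c2) mG) => z.
  rewrite ger0_norm//.
  have E1 : 1 <= expR (z ^+ 2 / 4).
    by have := expR_ge1Dx (z ^+ 2 / 4); have := sqr_ge0 z; lra.
  have := h2 z; have := h1 z; set E := expR _ in E1 *; rewrite /G => g1 g2.
  have g3 : (2 * `|z|) ^+ M.+1 * (4 * `|z|) = 2 * (2 * `|z|) ^+ M.+2.
    by rewrite [in RHS]exprS; ring.
  have g4 : (3 + M%:R) * (2 * `|z|) ^+ M.+1 <= (3 + M%:R) * (c1 * E).
    by rewrite ler_wpM2l// addr_ge0.
  move: g2 g3 g4; move: (_ ^+ M.+1) (_ ^+ M.+2) => A A2 g2 g3 g4.
  by rewrite mulrDr g3 !mulrDl; lra.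
have IG : (\int[N01]_z (G z)%:E)%E \is a fin_num by exact: integrable_fin_num.
exists (fine (\int[N01]_z (G z)%:E)%E).
  by apply: fine_ge0; apply: integral_ge0 => z _; rewrite lee_fin.
move=> d T P X s eps rho [mX s0 Xs] e0 /andP[r0 r1] se.
have rM0 : 0 < rho ^+ M by rewrite exprn_gt0.
have rM1 : rho ^+ M <= 1 by rewrite exprn_ile1// ltW.
pose lam (n : int) : R := if n == 0 then rho ^+ M else
  ln (4 / rho ^+ M) + 2 * ln (1 + (absz n)%:R).
pose Lam (x : R) : R := rho ^+ M +
  (2 * (`|x| / eps)) ^+ M.+1 * (3 + M%:R / rho + 4 * (`|x| / eps)).
have y0 (x : R) : 0 <= `|x| / eps by rewrite divr_ge0// ltW.
have Lam0 x : 0 <= Lam x.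
  by rewrite addr_ge0 ?(ltW rM0)// mulr_ge0 ?exprn_ge0 ?addr_ge0 ?mulr_ge0 ?divr_ge0// ?invr_ge0// ltW.
have ln0 (n : int) : 0 <= ln (1 + (absz n)%:R : R) by rewrite ln_ge0// lerDl.
have l4 : 1 <= 4 / rho ^+ M by rewrite ler_pdivlMr// mul1r; lra.
have cLam : continuous Lam.
  have c0 : continuous (fun x : R => `|x| / eps).
    by move=> x; apply: cvgM; [exact: cnorm|exact: cvg_cst].
  have c1 : continuous (fun x : R => 2 * (`|x| / eps)).
    by move=> x; apply: cvgM; [exact: cvg_cst|exact: c0].
  move=> x; apply: cvgD; first exact: cvg_cst.
  apply: cvgM; first exact: (continuous_comp (c1 x) (@exprn_continuous _ M.+1 _)).
  apply: cvgD; first exact: cvg_cst.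
  by apply: cvgM; [exact: cvg_cst|exact: c0].
exists lam, Lam; split.
- split=> [n|m].
    by rewrite /lam; case: ifP => _; [exact: ltW|rewrite addr_ge0 ?ln_ge0 ?mulr_ge0].
  have E n : n != 0 -> expR (- lam n) = rho ^+ M / 4 * (1 + (absz n)%:R) ^- 2.
    move=> n0; have p0 : 0 < 1 + (absz n)%:R :> R by rewrite ltr_pwDl.
    rewrite /lam (negbTE n0) opprD expRD expRN lnK ?posrE ?divr_gt0// invf_div.
    congr (_ * _).
    have -> : 2 * ln (1 + (absz n)%:R) = ln ((1 + (absz n)%:R) ^+ 2) :> R.
      by rewrite lnXn// -[RHS]mulr_natl.
    by rewrite expRN lnK// posrE exprn_gt0.
  rewrite (sum_symmetric_range (fun n => expR (- lam n))) {1}/lam eqxx.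
  have -> : \sum_(i < m) (expR (- lam i.+1%:Z) + expR (- lam (- i.+1%:Z))) =
      \sum_(i < m) (rho ^+ M / 2) * (i.+2%:R ^- 2 : R).
    apply: eq_bigr => i _; rewrite (E i.+1%:Z)// absz_nat.
    by rewrite -[(i.+2)%:R]natr1 [_ + 1]addrC; field; rewrite gt_eqF// ltr_pwDl.
  rewrite -mulr_sumr.
  have h1 : rho ^+ M / 2 * (\sum_(i < m) i.+2%:R ^- 2) <= rho ^+ M / 2.
    by rewrite ler_piMr ?divr_ge0 ?(ltW rM0)//; exact: sum_inv_sqr.
  (* Cell 0 leaves room [rho ^+ M / 2] in Kraft's inequality, which is what [h1] allots to the other
     cells. *)
  have h2 : expR (- rho ^+ M) <= 1 - rho ^+ M / 2.
    have e1 := expR_ge1Dx (rho ^+ M).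
    rewrite expRN -[leLHS]mul1r ler_pdivrMr ?expR_gt0//.
    apply: (@le_trans _ _ ((1 - rho ^+ M / 2) * (1 + rho ^+ M))).
      have : 0 <= rho ^+ M * (1 - rho ^+ M) by rewrite mulr_ge0 ?subr_ge0// ltW.
      lra.
    by rewrite ler_wpM2l// subr_ge0; lra.
  lra.
- exact: continuous_measurable_fun.
- exact: Lam0.
- move=> x; have [h1 h2] := absz_floor_le (x / eps).
  have xe : `|x / eps| = `|x| / eps by rewrite normrM (@gtr0_norm _ eps^-1) ?invr_gt0.
  rewrite xe in h1 h2; set n := Num.floor _ in h1 h2 *.
  have := y0 x; set y := `|x| / eps in h1 h2 * => yy0.
  have Mr : 0 <= M%:R / rho by rewrite divr_ge0// ltW.
  have q0 : 0 <= 3 + M%:R / rho + 4 * y by lra.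
  rewrite /lam /Lam -/y; case: ifPn => [_|n0].
    by rewrite lerDl mulr_ge0// exprn_ge0// mulr_ge0.
  have y2 := h2 n0.
  have l1 : ln (4 / rho ^+ M) <= 3 + M%:R / rho.
    rewrite ln_div ?posrE// lnXn//.
    have l41 : ln (4 : R) <= 3.
      by have := @le_ln1Dx R 3; rewrite (_ : 1 + 3 = 4 :> R); [apply; lra|ring].
    have lr : - ln rho <= rho^-1.
      by rewrite -lnV ?posrE//; apply: ltW; apply: ln_sublinear; rewrite invr_gt0.
    have : M%:R * (- ln rho) <= M%:R * rho^-1 by rewrite ler_wpM2l.
    rewrite -[ln rho *+ M]mulr_natl; lra.
  have l2 : ln (1 + (absz n)%:R) <= 2 * y.
    apply: (@le_trans _ _ (absz n)%:R); last lra.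
    by apply: le_ln1Dx; rewrite (lt_le_trans (ltrN10 _)).
  have u1 : 1 <= (2 * y) ^+ M.+1 by rewrite exprn_ege1//; lra.
  have : 3 + M%:R / rho + 4 * y <= (2 * y) ^+ M.+1 * (3 + M%:R / rho + 4 * y).
    by rewrite ler_peMl.
  lra.
- rewrite (Xs _ cLam Lam0) mulrC EFinM fineK//.
  rewrite -ge0_integralZl//; last 3 first.
  + exact/measurable_EFinP.
  + by move=> z _; rewrite lee_fin.
  + by rewrite lee_fin ltW.
  under [leRHS]eq_integral do rewrite -EFinM.
  apply: ge0_le_integral => //.
  + by move=> z _; rewrite lee_fin.
  + apply/measurable_EFinP; apply: measurableT_comp; last exact: measurable_funM.
    exact: continuous_measurable_fun.
  + by apply/measurable_EFinP; exact: measurable_funM.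
  + move=> z _; rewrite lee_fin /Lam /G.
    set y := `|s * z| / eps.
    have yz : y <= rho * `|z|.
      rewrite /y normrM (ger0_norm s0) mulrAC ler_wpM2r//.
      by rewrite ler_pdivrMr.
    have yy0 : 0 <= y by exact: y0.
    have z0 := normr_ge0 z.
    rewrite [leRHS]mulrDr mulr1 lerD2l.
    apply: (@le_trans _ _ ((2 * (rho * `|z|)) ^+ M.+1 * (3 + M%:R / rho + 4 * (rho * `|z|)))).
      apply: ler_pM.
      * by rewrite exprn_ge0// mulr_ge0.
      * by rewrite !addr_ge0// ?mulr_ge0// ?invr_ge0 ltW.
      * apply: lerXn2r; rewrite ?nnegrE.
        - exact: mulr_ge0.
        - by rewrite !mulr_ge0// ltW.
        - by rewrite ler_pM2l.
      * by rewrite lerD2l ler_pM2l.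
    rewrite [2 * _]mulrCA exprMn exprSr -!mulrA ler_pM2l//.
    rewrite mulrCA ler_wpM2l ?exprn_ge0 ?mulr_ge0//.
    have -> : rho * (3 + M%:R / rho + 4 * (rho * `|z|)) =
        rho * 3 + M%:R + 4 * (rho ^+ 2 * `|z|) by field; rewrite gt_eqF.
    apply: lerD; first by rewrite lerD2r; lra.
    by rewrite ler_pM2l// ler_piMl// exprn_ile1// ltW//.
Qed.

End cell_costs.

(** * Independent blocks *)

Section independent_events.
Context {R : realType} {d} {T : measurableType d} (P : probability T R).
Variables (S : nat -> set T).
Hypothesis mS : forall l, measurable (S l).
Local Notation all_in s := [set w | forall l : nat, l \in (s : seq nat) -> S l w].
Local Notation none_in s := [set w | forall l : nat, l \in (s : seq nat) -> ~ S l w].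
Hypothesis indepS : forall s : seq nat, uniq s ->
  (fine (P (all_in s)) = \prod_(l <- s) fine (P (S l)))%R.

Let measurable_all s : measurable (all_in s).
Proof.
elim: s => [|l s IH].
  by rewrite (_ : all_in [::] = setT)//; apply/seteqP; split.
rewrite (_ : all_in (l :: s) = S l `&` all_in s); first exact: measurableI.
apply/seteqP; split=> w /=.
  move=> h; split; first by apply: h; rewrite mem_head.
  by move=> m ms; apply: h; rewrite inE ms orbT.
by move=> [h1 h2] m; rewrite inE => /orP[/eqP ->|]; [|exact: h2].
Qed.

Lemma measurable_none s : measurable (none_in s).
Proof.
elim: s => [|l s IH].
  by rewrite (_ : none_in [::] = setT)//; apply/seteqP; split.
rewrite (_ : none_in (l :: s) = ~` S l `&` none_in s).
  by apply: measurableI => //; exact: measurableC.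
apply/seteqP; split=> w /=.
  move=> h; split; first by apply: h; rewrite mem_head.
  by move=> m ms; apply: h; rewrite inE ms orbT.
by move=> [h1 h2] m; rewrite inE => /orP[/eqP ->|]; [|exact: h2].
Qed.

(** A form of the claim that supports induction: independence passes to the complements one event at
    a time, by subtracting the part of the intersection that lies in [S l]. *)
Let mixed s1 s2 : uniq (s1 ++ s2) ->
  fine (P (all_in s1 `&` none_in s2)) =
  (\prod_(l <- s1) fine (P (S l))) * \prod_(l <- s2) (1 - fine (P (S l))).
Proof.
elim: s2 s1 => [|l s2 IH] s1.
  rewrite cats0 big_nil mulr1 => us; rewrite -indepS//; congr (fine (P _)).
  by apply/seteqP; split=> w; [case|move=> h; split].
rewrite -cat_rcons => u.
have u1 : uniq (s1 ++ s2).
  by move: u; rewrite cat_rcons cat_uniq /= => /and3P[? /norP[_ ?] /andP[_ ?]]; rewrite cat_uniq; apply/and3P.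
have u2 : uniq ((l :: s1) ++ s2).
  rewrite (_ : uniq _ = uniq (rcons s1 l ++ s2))//; apply: perm_uniq.
  by rewrite cat_rcons perm_sym -[l :: s2]cat1s perm_catCA /= perm_refl.
have -> : all_in s1 `&` none_in (l :: s2) = (all_in s1 `&` none_in s2) `\` S l.
  apply/seteqP; split=> w /=.
    move=> [h1 h2]; split; last by apply: h2; rewrite mem_head.
    by split=> // m ms; apply: h2; rewrite inE ms orbT.
  move=> [[h1 h2] h3]; split=> // m; rewrite inE => /orP[/eqP ->//|]; exact: h2.
have mA : measurable (all_in s1 `&` none_in s2).
  by apply: measurableI; [exact: measurable_all|exact: measurable_none].
have fin A : measurable A -> P A \is a fin_num by move=> ?; exact: fin_num_measure.
rewrite measureD//; last exact: le_lt_trans (probability_le1 P mA) (ltry 1).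
rewrite fineB ?fin//; last exact: measurableI.
have -> : (all_in s1 `&` none_in s2) `&` S l = all_in (l :: s1) `&` none_in s2.
  apply/seteqP; split=> w /=.
    move=> [[h1 h2] h3]; split=> // m; rewrite inE => /orP[/eqP ->//|]; exact: h1.
  move=> [h1 h2]; split; last by apply: h1; rewrite mem_head.
  by split=> // m ms; apply: h1; rewrite inE ms orbT.
by rewrite !IH// !big_cons; ring.
Qed.

Lemma prob_none_le (s : seq nat) (p : R) : uniq s -> 0 <= p ->
  (forall l, l \in s -> (p%:E <= P (S l))%E) ->
  (P (none_in s) <= (expR (- (p * (size s)%:R)))%:E)%E.
Proof.
move=> us p0 pS.
have fin A : measurable A -> P A \is a fin_num by move=> ?; exact: fin_num_measure.
rewrite -(fineK (fin _ (measurable_none s))) lee_fin.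
have := @mixed [::] s us; rewrite big_nil mul1r.
have -> : all_in [::] `&` none_in s = none_in s.
  by apply/seteqP; split=> w; [case|move=> h; split].
move=> ->; elim: s us pS => [|l s IH] /=.
  by rewrite big_nil mulr0 oppr0 expR0.
move=> /andP[_ us] pS; rewrite big_cons -natr1 mulrDr mulr1 opprD expRD [leRHS]mulrC.
have pl : p <= fine (P (S l)).
  by rewrite -lee_fin fineK ?fin//; apply: pS; rewrite mem_head.
apply: ler_pM.
- rewrite subr_ge0 -lee_fin fineK ?fin//; exact: probability_le1.
- rewrite big_seq; apply: prodr_ge0 => m _.
  by rewrite subr_ge0 -lee_fin fineK ?fin//; exact: probability_le1.
- by apply: le_trans (expR_ge1Dx _); lra.
- by apply: IH => // m ms; apply: pS; rewrite inE ms orbT.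
Qed.

End independent_events.

Section gaussian_blocks.
Context {R : realType} {d} {T : measurableType d} (P : probability T R).
Variables (H : set (T -> R)) (gH : gspace P H).
Variables (I : finType) (i0 : I) (X : nat -> I -> T -> R) (a : nat -> I -> R).
Hypothesis HX : forall l i, H (X l i).
Hypothesis a0 : forall l i, 0 < a l i.
Hypothesis orthX : forall l m i j, l != m -> (\int[P]_w (X l i w * X m j w) = 0)%R.
Local Notation S l := [set w | forall i, `|X l i w| < a l i].

(** By induction: the blocks after the first are flattened into a single family, indexed by the
    positions in [s] and by [I], from which [independent_slabs] separates the first block. Here
    pairwise orthogonality becomes joint independence. *)
Lemma independent_blocks (s : seq nat) : uniq s ->
  fine (P [set w | forall l : nat, l \in (s : seq nat) -> S l w]) = (\prod_(l <- s) fine (P (S l)))%R.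
Proof.
elim: s => [_|l s IH] /=.
  rewrite big_nil (_ : [set w | _] = setT); last by apply/seteqP; split.
  by rewrite [X in fine X](probability_setT P).
move=> /andP[ls us]; rewrite big_cons -IH//.
have [s0|s0] := posnP (size s).
  rewrite (size0nil s0) [X in _ * fine (P X)](_ : _ = setT); last by apply/seteqP; split.
  rewrite [X in _ * fine X](probability_setT P) mulr1; congr (fine (P _)).
  apply/seteqP; split=> w /=; first by apply; rewrite mem_head.
  by move=> h m; rewrite inE => /eqP ->.
pose Y (k : 'I_(size s) * I) := X (nth 0%N s k.1) k.2.
pose b (k : 'I_(size s) * I) := a (nth 0%N s k.1) k.2.
have := @independent_slabs _ _ _ P H gH I ('I_(size s) * I)%type (X l) Y (a l) b i0 (Ordinal s0, i0).
have -> : [set w | forall k, `|Y k w| < b k] = [set w | forall m : nat, m \in s -> S m w].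
  apply/seteqP; split=> w /=.
    move=> h m ms i; have hi : (index m s < size s)%N by rewrite index_mem.
    by have := h (Ordinal hi, i); rewrite /Y /b /= nth_index.
  by move=> h [k i]; rewrite /Y /b /=; apply: h; exact: mem_nth.
have -> : S l `&` [set w | forall m : nat, m \in s -> S m w] =
    [set w | forall m : nat, m \in l :: s -> S m w].
  apply/seteqP; split=> w /=.
    by move=> [h1 h2] m; rewrite inE => /orP[/eqP ->|]; [|exact: h2].
  move=> h; split; first by apply: h; rewrite mem_head.
  by move=> m ms; apply: h; rewrite inE ms orbT.
move=> ->.
- rewrite fineM//; apply: fin_num_measure.
    by apply: measurable_slabs => i; exact: (gspace_measurable gH (HX l i)).
  rewrite (_ : [set w | _] = [set w | forall k, `|Y k w| < b k]).
    by apply: measurable_slabs => k; exact: (gspace_measurable gH (HX _ _)).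
  apply/seteqP; split=> w /=.
    by move=> h [k i]; rewrite /Y /b /=; apply: h; exact: mem_nth.
  move=> h m ms i; have hi : (index m s < size s)%N by rewrite index_mem.
  by have := h (Ordinal hi, i); rewrite /Y /b /= nth_index.
- by move=> i; exact: HX.
- by move=> k; exact: HX.
- by move=> i; exact: a0.
- by move=> k; exact: a0.
- move=> i k; apply: orthX; apply: contraNneq ls => ->; exact: mem_nth.
Qed.

End gaussian_blocks.

(** * From independence to vanishing correlation *)

Section uncorrelated.
Context {R : realType} {d} {T : measurableType d} (P : probability T R).
Local Notation N01 := (@normal_prob R 0 1).

Lemma ge0_integral_independent (X Y : T -> R) (g : R * R -> R) :
  measurable_fun setT X -> measurable_fun setT Y ->
  (forall A B : set R, measurable A -> measurable B ->
    P (X @^-1` A `&` Y @^-1` B) = (P (X @^-1` A) * P (Y @^-1` B))%E) ->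
  @measurable_fun _ _ (measurableTypeR R * measurableTypeR R)%type (measurableTypeR R) setT g ->
  (forall z, 0 <= g z) ->
  (\int[P]_w (g (X w, Y w))%:E = \int[P]_w \int[P]_u (g (X w, Y u))%:E)%E.
Proof.
move=> mX mY XY mg g0.
pose Xm : {mfun T >-> measurableTypeR R} :=
  HB.pack X (@isMeasurableFun.Build _ _ T (measurableTypeR R) X mX).
pose Ym : {mfun T >-> measurableTypeR R} :=
  HB.pack Y (@isMeasurableFun.Build _ _ T (measurableTypeR R) Y mY).
have mXY : @measurable_fun _ _ T (measurableTypeR R * measurableTypeR R)%type setT (fun w => (X w, Y w)).
  exact: measurable_fun_pair.
pose XYm : {mfun T >-> (measurableTypeR R * measurableTypeR R)%type} :=
  HB.pack (fun w => (X w, Y w))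
    (@isMeasurableFun.Build _ _ T (measurableTypeR R * measurableTypeR R)%type _ mXY).
have mgE : @measurable_fun _ _ (measurableTypeR R * measurableTypeR R)%type _ setT (EFin \o g).
  exact/measurable_EFinP.
transitivity (\int[distribution P XYm]_z (g z)%:E)%E.
  by rewrite ge0_integral_distribution.
transitivity (\int[(distribution P Xm \x distribution P Ym)%E]_z (g z)%:E)%E.
  apply: eq_measure_integral => A mA _; apply/esym.
  apply: (@product_measure_unique _ _ _ _ _ (distribution P Xm) (distribution P Ym) (distribution P XYm)) => //.
transitivity (\int[distribution P Xm]_x \int[distribution P Ym]_y (g (x, y))%:E)%E.
  apply: (@fubini_tonelli1 _ _ _ _ _ (distribution P Xm) (distribution P Ym) (EFin \o g) mgE).
  by move=> z; rewrite lee_fin.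
rewrite ge0_integral_distribution; last 2 first.
- apply: (@measurable_fun_fubini_tonelli_F _ _ _ _ _ (distribution P Ym) (EFin \o g) mgE).
  by move=> z; rewrite lee_fin.
- by move=> x; apply: integral_ge0 => y _; rewrite lee_fin.
apply: eq_integral => w _.
apply: (@ge0_integral_distribution _ _ _ _ _ P Ym (fun y => (g (X w, y))%:E)).
  by apply/measurable_EFinP; exact: measurableT_comp (measurable_pair1 _).
by move=> y; rewrite lee_fin.
Qed.

(* By symmetry of the law of [Y], [X + Y] and [X - Y] have the same second moment. *)
Lemma independent_uncorrelated H X Y : gspace P H -> H X -> H Y ->
  (forall A B : set R, measurable A -> measurable B ->
    P (X @^-1` A `&` Y @^-1` B) = (P (X @^-1` A) * P (Y @^-1` B))%E) ->
  (\int[P]_w (X w * Y w) = 0)%R.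
Proof.
move=> gH HX HY XY; have [HD HZ cH] := gH.
have [s Xs] := cH _ HX; have [t Yt] := cH _ HY.
have [mX _ _] := Xs; have [mY t0 Ytf] := Yt.
have mg (e : R) : @measurable_fun _ _ (measurableTypeR R * measurableTypeR R)%type (measurableTypeR R)
    setT (fun z => (z.1 + e * z.2) ^+ 2).
  by apply: measurable_funX; apply: measurable_funD => //; exact: measurable_funM.
have E e : (\int[P]_w ((X w + e * Y w) ^+ 2)%:E =
    \int[P]_w \int[P]_u ((X w + e * Y u) ^+ 2)%:E)%E.
  by apply: (ge0_integral_independent mX mY XY (mg e)) => z; exact: sqr_ge0.
have cq (x e : R) : continuous (fun y : R => (x + e * y) ^+ 2).
  have c1 : continuous (fun y : R => x + e * y).
    by move=> y; apply: cvgD; [exact: cvg_cst|apply: cvgM; [exact: cvg_cst|exact: cvg_id]].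
  by move=> y; exact: (continuous_comp (c1 y) (@exprn_continuous _ 2 _)).
have sym : (\int[P]_w ((X w + 1 * Y w) ^+ 2)%:E = \int[P]_w ((X w + -1 * Y w) ^+ 2)%:E)%E.
  rewrite !E; apply: eq_integral => w _.
  rewrite (Ytf _ (cq (X w) 1) (fun y => sqr_ge0 _)) (Ytf _ (cq (X w) (-1)) (fun y => sqr_ge0 _)).
  rewrite (@normal_prob_sym R (fun z => (X w + 1 * (t * z)) ^+ 2)).
  - by apply: eq_integral => z _; rewrite mulrN mul1r mulN1r.
  - by move=> z; exact: sqr_ge0.
  - rewrite (_ : (fun z => _) = (fun z => (X w + t * z) ^+ 2)).
      exact: continuous_measurable_fun (cq (X w) t).
    by apply/funext => z; rewrite mul1r.
have i1 := sqr_integrable_cgauss Xs.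
have i2 := sqr_integrable_cgauss Yt.
have i3 := mul_integrable gH HX HY.
have V e : (\int[P]_w ((X w + e * Y w) ^+ 2) =
   \int[P]_w (X w ^+ 2) + \int[P]_w (e ^+ 2 * Y w ^+ 2) + (2 * e) * \int[P]_w (X w * Y w))%R.
  transitivity (\int[P]_w (X w ^+ 2 + e ^+ 2 * Y w ^+ 2 + (2 * e) * (X w * Y w)))%R.
    by apply: eq_Rintegral => w _; rewrite sqrrD; ring.
  have i4 : P.-integrable setT (EFin \o (fun w => e ^+ 2 * Y w ^+ 2)).
    exact: (integrableZl measurableT (e ^+ 2) i2).
  rewrite RintegralD//; last 2 first.
  - exact: (integrableD measurableT i1 i4).
  - exact: (integrableZl measurableT (2 * e) i3).
  by rewrite [X in X + _]RintegralD//; congr (_ + _); rewrite RintegralZl.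
have h3 : (\int[P]_w ((X w + 1 * Y w) ^+ 2) = \int[P]_w ((X w + -1 * Y w) ^+ 2))%R.
  by rewrite /Rintegral; have := congr1 fine sym.
have h4 : (\int[P]_w ((-1) ^+ 2 * Y w ^+ 2) = \int[P]_w (1 ^+ 2 * Y w ^+ 2))%R.
  by apply: eq_Rintegral => w _; rewrite sqrrN.
rewrite (V 1) (V (-1)) h4 in h3; move: h3; lra.
Qed.

End uncorrelated.

(** * Anisotropic grids *)

Section dyadic_grid.
Context {R : realType} {k : nat}.
Variable e : 'I_k -> R.
Hypothesis e0 : forall j, 0 < e j.
Implicit Types (z : 'rV[R]_k) (i : nat) (j : 'I_k).

(** Truncation towards 0, unlike the floor, does not increase absolute values; rounding therefore
    keeps a point in the cube, and in any [Delta]-ball around the center of the grid. *)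
Definition truncz (x : R) : R := Num.sg x * (Num.truncn `|x|)%:R.

Lemma truncz_le x : `|truncz x| <= `|x|.
Proof.
rewrite /truncz normrM normr_sg (ger0_norm (ler0n _ _)).
apply: (@le_trans _ _ (Num.truncn `|x|)%:R); last by rewrite truncn_le.
by case: (x != 0); rewrite ?mul1r ?mul0r.
Qed.

Lemma truncz_dist x : `|x - truncz x| <= 1.
Proof.
have [->|x0] := eqVneq x 0; first by rewrite /truncz sgr0 mul0r subrr normr0.
rewrite /truncz [X in `|X - _|]numEsg -mulrBr normrM normr_sg x0 mul1r.
have /andP[h1 h2] := truncn_itv (normr_ge0 x).
by rewrite ger0_norm ?subr_ge0// lerBlDr addrC natr1 ltW.
Qed.

(** For [e j = gamma j + 1], the inverse of [alpha gamma j], a step of this size in coordinate [j]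
    contributes [4 ^- i] to [Delta]. *)
Definition mesh i j : R := (4 ^- i) `^ e j.

Lemma mesh_gt0 i j : 0 < mesh i j.
Proof. by rewrite powR_gt0// invr_gt0 exprn_gt0. Qed.

Definition in_cube z : bool := [forall j, `|z 0 j| < 1].

Definition round_grid i z : 'rV[R]_k := \row_j (mesh i j * truncz (z 0 j / mesh i j)).

Lemma round_grid_dist i z j : `|z 0 j - round_grid i z 0 j| <= mesh i j.
Proof.
have h0 := mesh_gt0 i j; rewrite mxE.
have -> : z 0 j - mesh i j * truncz (z 0 j / mesh i j) =
    mesh i j * (z 0 j / mesh i j - truncz (z 0 j / mesh i j)).
  by field; rewrite gt_eqF.
by rewrite normrM gtr0_norm// ler_piMr ?truncz_dist// ltW.
Qed.

Lemma round_grid_le i z j : `|round_grid i z 0 j| <= `|z 0 j|.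
Proof.
have h0 := mesh_gt0 i j; rewrite mxE normrM gtr0_norm// mulrC -ler_pdivlMr//.
rewrite (_ : `|z 0 j| / mesh i j = `|z 0 j / mesh i j|); first exact: truncz_le.
by rewrite normrM (@gtr0_norm _ (mesh i j)^-1) ?invr_gt0.
Qed.

Lemma round_grid_cube i z : in_cube z -> in_cube (round_grid i z).
Proof.
by move=> /forallP zc; apply/forallP => j; apply: le_lt_trans (zc j); exact: round_grid_le.
Qed.

(** At level 0 the mesh is 1 and the cube is open, so every chain starts at the center. *)
Lemma round_grid0 z : in_cube z -> round_grid 0 z = 0.
Proof.
move=> /forallP zc; apply/rowP => j; rewrite !mxE /mesh expr0 invr1 powR1 mul1r divr1.
rewrite /truncz (_ : Num.truncn _ = 0%N) ?mulr0//.
by apply/truncn0Pn; rewrite -ltNge.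
Qed.

Let bound i j : nat := Num.truncn (mesh i j)^-1.

Definition grid i : seq 'rV[R]_k :=
  [seq z <- [seq \row_j (mesh i j * ((f j : nat)%:R - (bound i j)%:R)) |
     f : {dffun forall j : 'I_k, 'I_((bound i j).*2.+1)}] | in_cube z].

Lemma grid_cube i z : z \in grid i -> in_cube z.
Proof. by rewrite mem_filter => /andP[]. Qed.

Lemma round_grid_mem i z : in_cube z -> round_grid i z \in grid i.
Proof.
move=> zc; rewrite mem_filter round_grid_cube//=.
have b j : (Num.truncn `|z 0 j / mesh i j|%R <= bound i j)%N.
  apply: le_truncn; rewrite normrM (gtr0_norm (x := (mesh i j)^-1)) ?invr_gt0 ?mesh_gt0//.
  by rewrite ler_piMl ?invr_ge0 ?(ltW (mesh_gt0 i j))// ltW//; move/forallP: zc => /(_ j).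
pose n j : nat := if (0 <= z 0 j / mesh i j) then (bound i j + Num.truncn `|z 0 j / mesh i j|%R)%N
  else (bound i j - Num.truncn `|z 0 j / mesh i j|%R)%N.
have nb j : (n j < (bound i j).*2.+1)%N.
  by rewrite /n; have := b j; case: ifP => _; lia.
apply/mapP; exists [ffun j => Ordinal (nb j)]; first by rewrite mem_enum.
apply/rowP => j; rewrite !mxE ffunE /=; congr (_ * _); rewrite /truncz /n.
case: ifPn => x0.
  rewrite natrD addrC addKr; move: x0; rewrite le_eqVlt => /predU1P[<-|x0].
    by rewrite sgr0 mul0r normr0 truncn0.
  by rewrite gtr0_sg// mul1r.
by rewrite -ltNge in x0; rewrite ltr0_sg// mulN1r natrB ?b//; ring.
Qed.

(** Coordinate [j] takes at most [2 / mesh i j + 1 <= 3 / mesh i j] values; the inverse meshes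
    multiply to the power of 4. *)
Lemma size_grid i : (size (grid i))%:R <= 3 ^+ k * (4 `^ (\sum_j e j)) ^+ i.
Proof.
apply: (@le_trans _ _ (\prod_j ((bound i j).*2.+1)%:R)).
  rewrite -natr_prod ler_nat; apply: (leq_trans (size_subseq (filter_subseq _ _))).
  rewrite size_map -cardE card_dep_ffun; apply: eq_leq.
  by rewrite foldrE big_map big_enum /=; under eq_bigr do rewrite card_ord.
apply: (@le_trans _ _ (\prod_(j < k) (3 * (4 `^ e j) ^+ i))).
  apply: ler_prod => j _; rewrite ler0n /=.
  have -> : (4 `^ e j) ^+ i = (mesh i j)^-1.
    have -> : (4 `^ e j) ^+ i = (4 ^+ i) `^ e j :> R.
      by rewrite -(powR_mulrn i (powR_ge0 4 (e j))) powRAC powR_mulrn.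
    apply: (mulIf (lt0r_neq0 (mesh_gt0 i j))).
    rewrite mulVf ?gt_eqF ?mesh_gt0// /mesh -powRM ?invr_ge0 ?exprn_ge0//.
    by rewrite divff ?powR1// expf_neq0.
  have m1 : 1 <= (mesh i j)^-1.
    rewrite invf_ge1 ?mesh_gt0// /mesh.
    suff : (4 ^- i) `^ e j <= 1 `^ e j :> R by rewrite powR1.
    apply: ge0_ler_powR; rewrite ?nnegrE ?invr_ge0 ?exprn_ge0//; first exact: ltW.
    by rewrite invf_le1 ?exprn_gt0// exprn_ege1// ler1n.
  have : (bound i j)%:R <= (mesh i j)^-1 by rewrite truncn_le; apply: ltW; lra.
  rewrite -muln2 -natr1 natrM; lra.
rewrite big_split /= prodr_const card_ord prodrXl.
have -> : \prod_(j < k) 4 `^ e j = 4 `^ (\sum_j e j) :> R.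
  elim/big_rec2: _ => [|j y x _ ->]; first by rewrite powRr0.
  by rewrite powRD// pnatr_eq0 implybT.
by [].
Qed.

End dyadic_grid.

(** * Chaining thresholds *)

Section geometric_sums.
Context {R : realType}.
Implicit Types (x y A B : R).

Lemma geometric_sum_le x n : 0 <= x < 1 -> \sum_(i < n) x ^+ i <= (1 - x)^-1.
Proof.
move=> /andP[x0 x1]; have x1' : 0 < 1 - x by rewrite subr_gt0.
rewrite -[leRHS]mul1r ler_pdivlMr//.
have := subrX1 x n; have := exprn_ge0 n x0.
set S := \sum_(i < n) _; lra.
Qed.

Lemma two_sided_sum_le x y A B I n : 0 <= x < 1 -> 0 <= y < 1 -> 0 <= A -> 0 <= B ->
  \sum_(i < n) (if (i <= I)%N then A * x ^+ (I - i) else B * y ^+ (i - I)) <=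
  A / (1 - x) + B * (y / (1 - y)).
Proof.
move=> x01 y01 A0 B0; have /andP[x0 x1] := x01; have /andP[y0 y1] := y01.
pose f i := if (i <= I)%N then A * x ^+ (I - i) else B * y ^+ (i - I).
have f0 i : 0 <= f i by rewrite /f; case: ifP => _; rewrite mulr_ge0// exprn_ge0.
apply: (@le_trans _ _ (\sum_(i < I.+1 + n) f i)).
  have -> : \sum_(i < I.+1 + n) f i = \sum_(i < n + I.+1) f i by rewrite addnC.
  by rewrite big_split_ord /= lerDl sumr_ge0.
rewrite big_split_ord /=; apply: lerD.
  rewrite (reindex_inj rev_ord_inj) /=.
  under eq_bigr => i _.
    rewrite /f subSS leq_subr subKn; last by rewrite -ltnS.
    over.
  by rewrite -mulr_sumr ler_wpM2l//; exact: geometric_sum_le.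
under eq_bigr => i _.
  rewrite /f leqNgt ltnS leq_addr /= addSn subSn ?leq_addr// addKn exprS.
  over.
rewrite -mulr_sumr ler_wpM2l// -mulr_sumr ler_wpM2l//.
exact: geometric_sum_le.
Qed.

End geometric_sums.

Section scales.
Context {R : realType} {d} {T : measurableType d} (P : probability T R).
Variables (H : set (T -> R)) (gH : gspace P H).
Variables (U : eqType) (J : seq U) (lev : U -> nat) (N q : R) (n : nat).
Hypothesis J0 : (0 < size J)%N.
Hypothesis N0 : 0 <= N.
Hypothesis q4 : 4 <= q.
(** A count of the indices, at most [N * q ^+ i] of them at level [i], in the summed form in which
    it is applied. *)
Hypothesis sumJ : forall f : nat -> R, (forall i, 0 <= f i) ->
  \sum_(u <- J) f (lev u) <= N * \sum_(i < n) q ^+ i * f i.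

Local Notation slab X a := [set w | forall u, u \in J -> (`|X u w| < a u)%R].
Let nthJ (i : 'I_(size J)) : U := tnth (in_tuple J) i.

Let slabE (X : U -> T -> R) (a : U -> R) :
  slab X a = [set w | forall i, `|X (nthJ i) w| < a (nthJ i)].
Proof.
apply/seteqP; split=> w /=; first by move=> h i; apply: h; exact: mem_tnth.
move=> h u uJ; have hi : (index u J < size J)%N by rewrite index_mem.
have := h (Ordinal hi).
by rewrite /nthJ (tnth_nth u) /= nth_index.
Qed.

(** Relative to the natural size [4 ^- i] of an increment of level [i], the threshold is tighter by
    [8 ^- (I - i)] up to level [I] and looser by [2 ^+ (i - I)] beyond it, yet the thresholds sum to
    order [4 ^- I]. *)
Definition coarse_eps (I i : nat) : R :=
  if (i <= I)%N then 4 ^- I * 2 ^- (I - i) else 4 ^- I * 2 ^- (i - I).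

Lemma coarse_eps_gt0 I i : 0 < coarse_eps I i.
Proof. by rewrite /coarse_eps; case: ifP => _; rewrite mulr_gt0// invr_gt0 exprn_gt0. Qed.

Lemma sum_coarse_eps I m : \sum_(i < m) coarse_eps I i <= 3 * 4 ^- I.
Proof.
rewrite /coarse_eps.
under eq_bigr do rewrite -!exprVn.
have h01 : 0 <= (2^-1 : R) < 1 by lra.
have i0 : 0 <= (4^-1 : R) ^+ I by rewrite exprn_ge0.
apply: le_trans (two_sided_sum_le I m h01 h01 i0 i0) _.
have -> : (1 - 2^-1)^-1 = 2 :> R by field.
rewrite exprVn; lra.
Qed.

(** Level [I] dominates the entropy. Below it one index costs of order [sqrt 8 ^+ (I - i)], and
    [sqrt 8 < q] makes the sum geometric; above it the cost is of order [2 ^- (M * (i - I))], and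
    [q <= 2 ^+ M / 2] compensates the number of indices. *)
Lemma small_ball_scales (M : nat) (CM : R) : q * 2 <= 2 ^+ M -> 0 <= CM ->
  (forall X s eps rho, cgauss P X s -> 0 < eps -> 0 < rho <= 1 -> s <= rho * eps ->
    cell_cost P X eps (CM * rho ^+ M)) ->
  forall (I : nat) (X : U -> T -> R) (r sigma : R), 0 < r -> 0 < sigma ->
    (forall u, u \in J -> H (X u)) ->
    (forall u s, u \in J -> cgauss P (X u) s -> s <= sigma * r * 4 ^- lev u) ->
    ((expR (- (N * (56 + CM) * q ^+ I)))%:E <=
      P (slab X (fun u => (sigma * r * coarse_eps I (lev u))%R)))%E.
Proof.
move=> qM CM0 fine_cost I X r sigma r0 s0 HX Xs.
pose rho i : R := if (i <= I)%N then 8 ^+ (I - i) else 2 ^- (i - I).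
pose h i : R := if (i <= I)%N then 6 + 8 * Num.sqrt (rho i) else CM * rho i ^+ M.
have rho0 i : 0 < rho i by rewrite /rho; case: ifP => _; rewrite ?invr_gt0 exprn_gt0.
have h0 i : 0 <= h i.
  rewrite /h; case: ifP => _; first by rewrite addr_ge0// mulr_ge0// sqrtr_ge0.
  by rewrite mulr_ge0// exprn_ge0// ltW.
have rhoE i : rho i * coarse_eps I i = 4 ^- i.
  rewrite /rho /coarse_eps; case: ifPn => iI.
    have -> : (8 : R) ^+ (I - i) = 4 ^+ (I - i) * 2 ^+ (I - i) by rewrite -exprMn; congr (_ ^+ _); ring.
    rewrite [4 ^- I * _]mulrC mulrA mulfK ?expf_neq0//.
    rewrite -{2}(subnK iI) exprD invfM mulrA divff ?mul1r// expf_neq0//.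
  have {}iI : (I <= i)%N by rewrite ltnW// ltnNge.
  rewrite mulrCA -invfM -exprMn -invfM.
  have -> : (2 * 2 : R) = 4 by ring.
  by rewrite -exprD subnKC.
rewrite slabE.
apply: (@le_trans _ _ (expR (- \sum_(i < size J) h (lev (nthJ i))))%:E); last first.
  apply: (small_ball (Ordinal J0) gH) => i.
  - by apply: HX; exact: mem_tnth.
  - by rewrite !mulr_gt0// coarse_eps_gt0.
  - have uJ : nthJ i \in J by exact: mem_tnth.
    have [_ _ cH] := gH; have [s Xss] := cH _ (HX _ uJ).
    have ep : 0 < sigma * r * coarse_eps I (lev (nthJ i)) by rewrite !mulr_gt0// coarse_eps_gt0.
    have sr : s <= rho (lev (nthJ i)) * (sigma * r * coarse_eps I (lev (nthJ i))).
      by rewrite mulrCA rhoE; exact: Xs.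
    rewrite /h; case: ifPn => iI.
      exact: (cell_cost_coarse Xss ep (ltW (rho0 _)) sr).
    apply: (fine_cost _ _ _ _ Xss ep _ sr); rewrite rho0 /rho (negbTE iI).
    by rewrite invf_le1 ?exprn_gt0// exprn_ege1// ler1n.
rewrite lee_fin ler_expR lerN2.
have -> : \sum_(i < size J) h (lev (nthJ i)) = \sum_(u <- J) h (lev u).
  by rewrite [RHS]big_tnth.
apply: le_trans (sumJ h0) _; rewrite -mulrA ler_wpM2l//.
have q0 : 0 < q by apply: lt_le_trans q4.
have qI : 0 < q ^+ I by rewrite exprn_gt0.
(* The 14 absorbs [6 + 8 * t] for [t >= 1], and [sqrt 8 <= 3] with [q >= 4] gives the ratio 3/4. The
   two series then sum to 14 * 4 = 56 and [CM]. *)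
pose g i : R := if (i <= I)%N then 14 * (3 / 4) ^+ (I - i) else CM * 2^-1 ^+ (i - I).
apply: (@le_trans _ _ (\sum_(i < n) q ^+ I * g i)).
  apply: ler_sum => i _; rewrite /h /g; case: ifPn => iI.
    have -> : q ^+ I = q ^+ i * q ^+ (I - i) by rewrite -exprD subnKC.
    rewrite -mulrA ler_pM2l ?exprn_gt0//.
    apply: (@le_trans _ _ (14 * 3 ^+ (I - i))).
      have t1 : (1 : R) <= 3 ^+ (I - i) by rewrite exprn_ege1// ler1n.
      suff : Num.sqrt (rho i) <= 3 ^+ (I - i) by lra.
      rewrite -[leRHS]ger0_norm ?exprn_ge0// -sqrtr_sqr ler_sqrt ?sqr_ge0//.
      rewrite /rho iI exprAC; apply: lerXn2r; rewrite ?nnegrE ?sqr_ge0// expr2; lra.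
    rewrite mulrCA ler_pM2l// -exprMn; apply: lerXn2r; rewrite ?nnegrE//.
      by rewrite mulr_ge0// ltW.
    by have := q4; lra.
  have {}iI : (I <= i)%N by rewrite ltnW// ltnNge.
  have -> : q ^+ i = q ^+ I * q ^+ (i - I) by rewrite -exprD subnKC.
  rewrite -mulrA ler_pM2l ?exprn_gt0// mulrCA ler_wpM2l//.
  rewrite /rho; case: ifPn => iI'.
    have -> : i = I :> nat by apply/eqP; rewrite eqn_leq iI iI'.
    by rewrite subnn !expr0 expr1n mul1r.
  rewrite -exprVn exprAC -exprMn; apply: lerXn2r; rewrite ?nnegrE ?mulr_ge0 ?exprn_ge0 ?(ltW q0)//.
  by rewrite exprVn ler_pdivrMr ?exprn_gt0// -ler_pdivrMl// invrK mulrC.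
rewrite -mulr_sumr mulrC ler_pM2r//.
have x01 : 0 <= (3 / 4 : R) < 1 by lra.
have y01 : 0 <= (2^-1 : R) < 1 by lra.
have := two_sided_sum_le I n x01 y01 (ler0n _ 14) CM0.
have -> : (1 - 2^-1)^-1 = 2 :> R by field.
have -> : (1 - 3 / 4)^-1 = 4 :> R by field.
rewrite /g; lra.
Qed.

(** Thresholds decay like [(3 / 4) ^+ i], which is summable, but deviations like [2 ^- i]: their
    ratio grows like [(3 / 2) ^+ i], and the tail exponent is at least [B * (1 + i)]. The union
    bound is then a geometric series of ratio [q * expR (- B) <= 1 / 2]. *)
Lemma tail_scales (I : nat) (Y : U -> T -> R) (r sigma tau B : R) :
  0 < r -> 0 < sigma -> 0 < tau ->
  B = (4 ^- I / (sigma * tau)) ^+ 2 / 4 -> q * expR (- B) <= 2^-1 ->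
  (forall u, u \in J -> H (Y u)) ->
  (forall u s, u \in J -> cgauss P (Y u) s -> s <= sigma * r * (2 ^- lev u * tau)) ->
  (P (~` slab Y (fun u => (r * (4 ^- I * (3 / 4) ^+ lev u))%R)) <=
   (4 * N * expR (- B))%:E)%E.
Proof.
move=> r0 s0 t0 BE qB HY Ys; rewrite slabE.
pose a u := r * (4 ^- I * (3 / 4) ^+ lev u).
have a0 u : 0 < a u by rewrite !mulr_gt0 ?invr_gt0 ?exprn_gt0// divr_gt0.
pose F (i : 'I_(size J)) := [set w | a (nthJ i) <= `|Y (nthJ i) w|].
have mY i : measurable_fun setT (Y (nthJ i)).
  by apply: (gspace_measurable gH); apply: HY; exact: mem_tnth.
have FE i : F i = ~` [set w | `|Y (nthJ i) w| < a (nthJ i)].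
  by apply/seteqP; split=> w; rewrite /F /= leNgt => /negP.
have mF i : measurable (F i).
  by rewrite FE; apply: measurableC; exact: measurable_normr_lt.
have mG : measurable (~` [set w | forall i, `|Y (nthJ i) w| < a (nthJ i)]).
  by apply: measurableC; exact: measurable_slabs.
have := @measure_le_sum _ _ _ P _ F mF _ mG.
have cov w : (~` [set w | forall i, `|Y (nthJ i) w| < a (nthJ i)]) w -> exists i, F i w.
  by move=> /= /existsNP[i /negP wi]; exists i; rewrite /F /= leNgt.
move=> /(_ cov) h; apply: le_trans h _.
pose f i : R := 2 * (expR (- B) * expR (- B) ^+ i).
have f0 i : 0 <= f i by rewrite !mulr_ge0 ?exprn_ge0 ?expR_ge0.
have B0 : 0 <= B by rewrite BE divr_ge0// sqr_ge0.
apply: (@le_trans _ _ (\sum_(i < size J) (f (lev (nthJ i)))%:E)%E).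
  apply: lee_sum => i _.
  have uJ : nthJ i \in J by exact: mem_tnth.
  have [_ _ cH] := gH; have [s Yss] := cH _ (HY _ uJ).
  set l := lev (nthJ i).
  have sg0 : 0 < sigma * r * (2 ^- l * tau) by rewrite !mulr_gt0// invr_gt0 exprn_gt0.
  apply: le_trans (cgauss_tail Yss (Ys _ _ uJ Yss) sg0 (ltW (a0 _))) _.
  rewrite lee_fin /f ler_pM2l// -expRM_natl -expRD ler_expR.
  rewrite (_ : - B + l%:R * - B = - (B * (1 + l%:R))); last by ring.
  rewrite lerN2.
  have -> : a (nthJ i) / (sigma * r * (2 ^- l * tau)) = 4 ^- I / (sigma * tau) * (3 / 2) ^+ l.
    rewrite /a -/l.
    have -> : (3 / 4 : R) ^+ l = (3 / 2) ^+ l * 2 ^- l.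
      by rewrite -exprVn -exprMn; congr (_ ^+ _); field.
    by field; rewrite !expf_neq0// !gt_eqF.
  rewrite exprMn mulrAC -BE ler_wpM2l// exprAC.
  have -> : (3 / 2 : R) ^+ 2 = 1 + 5 / 4 by field.
  apply: le_trans (bernoulli_ineq _ _); last lra.
  by rewrite lerD2l ler_peMr//; lra.
rewrite sumEFin lee_fin.
have -> : \sum_(i < size J) f (lev (nthJ i)) = \sum_(u <- J) f (lev u).
  by rewrite [RHS]big_tnth.
apply: le_trans (sumJ f0) _.
have -> : \sum_(i < n) q ^+ i * f i = 2 * expR (- B) * \sum_(i < n) (q * expR (- B)) ^+ i.
  by rewrite mulr_sumr; apply: eq_bigr => i _; rewrite exprMn /f; ring.
have qb0 : 0 <= q * expR (- B) < 1.
  rewrite mulr_ge0 ?expR_ge0//=; first lra.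
  by apply: le_trans q4.
have g := geometric_sum_le n qb0.
have g2 : (1 - q * expR (- B))^-1 <= 2.
  by rewrite -[leRHS]invrK lef_pV2 ?posrE//; lra.
have -> : 4 * N * expR (- B) = N * (2 * expR (- B) * 2) by ring.
rewrite ler_wpM2l// ler_wpM2l ?mulr_ge0 ?expR_ge0//.
exact: le_trans g g2.
Qed.

(** If no scale is good, then either all blocks [X l] fail, which independence makes unlikely, or
    some remainder [Y l] is large, which a union bound controls. *)
Lemma exists_good_scale (X Y : nat -> U -> T -> R) (a b : nat -> U -> R)
    (ls : seq nat) (p D : R) :
  (forall l u, u \in J -> H (X l u)) -> (forall l u, u \in J -> H (Y l u)) ->
  (forall l u, 0 < a l u) ->
  (forall l m u v, l != m -> u \in J -> v \in J ->
    (\int[P]_w (X l u w * X m v w) = 0)%R) ->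
  uniq ls -> 0 <= p ->
  (forall l, l \in ls -> (p%:E <= P (slab (X l) (a l)))%E) ->
  (forall l, l \in ls -> (P (~` slab (Y l) (b l)) <= D%:E)%E) ->
  measurable [set w | exists2 l : nat, l \in ls & slab (X l) (a l) w /\ slab (Y l) (b l) w] /\
  ((1 - expR (- (p * (size ls)%:R)) - (size ls)%:R * D)%:E <=
   P [set w | exists2 l : nat, l \in ls & slab (X l) (a l) w /\ slab (Y l) (b l) w])%E.
Proof.
move=> HX HY a0 orth uls p0 pS DY.
pose S l := [set w | forall i, `|X l (nthJ i) w| < a l (nthJ i)].
pose Q l := slab (Y l) (b l).
have SE l : slab (X l) (a l) = S l by rewrite slabE.
have inJ i : nthJ i \in J by exact: mem_tnth.
have mS l : measurable (S l).
  by apply: measurable_slabs => i; apply: (gspace_measurable gH); exact: HX.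
have mQ l : measurable (Q l).
  rewrite /Q slabE; apply: measurable_slabs => i.
  by apply: (gspace_measurable gH); exact: HY.
have indep := @independent_blocks _ _ _ P H gH 'I_(size J) (Ordinal J0)
  (fun l i => X l (nthJ i)) (fun l i => a l (nthJ i)) (fun l i => HX l _ (inJ i))
  (fun l i => a0 l _) (fun l m i j lm => orth l m _ _ lm (inJ i) (inJ j)).
have none := @prob_none_le _ _ _ P S mS indep ls p uls p0.
have {}none : (P [set w | forall l : nat, l \in ls -> ~ S l w] <=
    (expR (- (p * (size ls)%:R)))%:E)%E.
  by apply: none => l lls; rewrite -SE; exact: pS.
have mnone := measurable_none mS ls.
have bad s : {subset s <= ls} ->
    measurable [set w | exists2 l : nat, l \in (s : seq nat) & ~ Q l w] /\
    (P [set w | exists2 l : nat, l \in (s : seq nat) & ~ Q l w] <= ((size s)%:R * D)%:E)%E.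
  elim: s => [_|l s IH sls].
    rewrite (_ : [set w | _] = set0); last by apply/seteqP; split=> w //= -[].
    by rewrite measure0 mul0r; split.
  have [|m1 m2] := IH; first by move=> m ms; apply: sls; rewrite inE ms orbT.
  rewrite (_ : [set w | _] = ~` Q l `|` [set w | exists2 m : nat, m \in s & ~ Q m w]).
    have mC : measurable (~` Q l) by exact: measurableC.
    split; first exact: measurableU.
    apply: le_trans (measureU2 P mC m1) _.
    rewrite /= -natr1 mulrDl mul1r addrC EFinD; apply: leeD => //.
    by apply: DY; apply: sls; rewrite mem_head.
  apply/seteqP; split=> w /=.
    by move=> [m]; rewrite inE => /orP[/eqP ->|ms] h; [left|right; exists m].
  move=> [h|[m ms h]]; first by exists l => //; rewrite mem_head.
  by exists m => //; rewrite inE ms orbT.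
have [mbad Pbad] := bad ls (fun _ h => h).
set G := [set w | _].
have mG : measurable G.
  suff : forall s, measurable [set w | exists2 l : nat, l \in (s : seq nat) & S l w /\ Q l w].
    move=> /(_ ls); congr measurable; apply/seteqP; split=> w /= [l lls [h1 h2]]; exists l => //.
      by rewrite SE.
    by move: h1; rewrite SE.
  elim=> [|l s IH].
    by rewrite (_ : [set w | _] = set0)//; apply/seteqP; split=> w //= -[].
  rewrite (_ : [set w | _] = (S l `&` Q l) `|`
     [set w | exists2 l : nat, l \in (s : seq nat) & S l w /\ Q l w]).
    by apply: measurableU => //; exact: measurableI.
  apply/seteqP; split=> w /=.
    by move=> [m]; rewrite inE => /orP[/eqP ->|ms] h; [left|right; exists m].
  move=> [h|[m ms h]]; first by exists l => //; rewrite mem_head.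
  by exists m => //; rewrite inE ms orbT.
split=> //.
have GC : (P (~` G) <= P [set w | forall l : nat, l \in ls -> ~ S l w] +
    P [set w | exists2 l : nat, l \in ls & ~ Q l w])%E.
  apply: le_trans (measureU2 P mnone mbad).
  apply: le_measure; rewrite ?inE.
  - exact: measurableC.
  - exact: measurableU.
  - move=> w /= nG; have [[l lls nQ]|h] := pselect (exists2 l, l \in ls & ~ Q l w).
      by right; exists l.
    left=> l lls Sl; apply: nG; exists l => //; rewrite SE; split=> //.
    by apply: contrapT => nQ; apply: h; exists l.
have PG : P G \is a fin_num by exact: fin_num_measure.
have := le_trans GC (leeD none Pbad).
rewrite probability_setC// -(fineK PG) -EFinB -EFinD !lee_fin; lra.
Qed.

End scales.

(** * Choice of the parameters *)

Section scale_parameters.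
Context {R : realType}.
Implicit Types (x L M : R).

Lemma ln_le_root M : 256 <= M -> 8 * ln M <= M.
Proof.
move=> M256; have M0 : 0 < M by lra.
have s16 : 16 <= Num.sqrt M.
  rewrite -[16](@ger0_norm R)// -sqrtr_sqr ler_sqrt ?sqr_ge0//; first by apply: le_trans M256; rewrite expr2; lra.
  exact: ltW.
have s0 : 0 < Num.sqrt M by lra.
have := le_ln1Dx (x := Num.sqrt M - 1).
have -> : ln M = 2 * ln (Num.sqrt M).
  by rewrite -{1}[M](sqr_sqrtr (ltW M0)) expr2 lnM ?posrE//; ring.
have -> : 1 + (Num.sqrt M - 1) = Num.sqrt M by ring.
move=> h; have {}h : ln (Num.sqrt M) <= Num.sqrt M - 1 by apply: h; lra.
have : 16 * Num.sqrt M <= M.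
  by rewrite -{2}[M](sqr_sqrtr (ltW M0)) expr2 ler_pM2r.
lra.
Qed.

(** In the application [M ^+ 8] is L = log(1/r0) and bounds the number of scales; the first term
    stands for the failure of all bands, the second for the remainders. *)
Lemma expR_sum_le N M : 0 <= N -> 1 <= M -> 32 * N <= M ->
  expR (- (2 * M ^+ 4)) + M ^+ 8 * (4 * N * expR (- (3 * M ^+ 4))) <= expR (- M ^+ 4).
Proof.
move=> N0 M1 NM; have M0 : 0 < M by lra.
set x := M ^+ 4; have xM : M <= x by apply: ler_eXnr.
have -> : M ^+ 8 = x ^+ 2 by rewrite /x -exprM.
have e1 : expR (- (2 * x)) = expR (- x) * expR (- x) by rewrite -expRD; congr expR; ring.
have e2 : expR (- (3 * x)) = expR (- x) * (expR (- x) * expR (- x)) by rewrite -!expRD; congr expR; ring.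
set E := expR (- x) in e1 e2 *.
have E0 : 0 < E by exact: expR_gt0.
have x1 : 1 <= x by lra.
have E2 : E * 2 <= 1.
  have h : 1 + x <= expR x := expR_ge1Dx x.
  have ee : E * expR x = 1 by rewrite /E expRN mulVf// gt_eqF ?expR_gt0.
  rewrite -[leRHS]ee ler_pM2l//; lra.
have E3 : 8 * N * x ^+ 2 * (E * E) <= 1.
  have hh : 1 + x / 2 <= expR (x / 2) := expR_ge1Dx _.
  have ee : E * expR x = 1 by rewrite /E expRN mulVf// gt_eqF ?expR_gt0.
  have eh : expR x = expR (x / 2) * expR (x / 2) by rewrite -expRD; congr expR; field.
  have h2 : x ^+ 2 / 4 <= expR x.
    rewrite eh; have -> : x ^+ 2 / 4 = (x / 2) * (x / 2) by field.
    by apply: ler_pM; lra.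
  have h3 : 32 * N <= expR x.
    have h3 : 1 + x <= expR x := expR_ge1Dx x.
    lra.
  have h4 : 8 * N * x ^+ 2 <= expR x * expR x.
    have -> : 8 * N * x ^+ 2 = (32 * N) * (x ^+ 2 / 4) by field.
    by apply: ler_pM => //; [rewrite mulr_ge0|rewrite divr_ge0 ?sqr_ge0].
  have e4 : (expR x * expR x) * (E * E) = 1 by rewrite mulrACA [_ * E]mulrC ee mulr1.
  by rewrite -[leRHS]e4 ler_wpM2r// mulr_ge0// ltW.
rewrite e1 e2.
have h1 : E * (E * 2) <= E * 1 by rewrite ler_pM2l.
have h2 : E * (8 * N * x ^+ 2 * (E * E)) <= E * 1 by rewrite ler_pM2l.
lra.
Qed.

Lemma exists_power_between (q Y : R) : 1 < q -> 1 <= Y ->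
  exists I : nat, q ^+ I <= Y < q ^+ I.+1.
Proof.
move=> q1 Y1.
have [n Yn] : exists n : nat, Y < q ^+ n.
  have q0 : 0 < q - 1 by lra.
  exists (Num.truncn (Y / (q - 1))).+1.
  have := truncnS_gt (Y / (q - 1)); rewrite ltr_pdivrMr//.
  set m := (_.+1)%:R => h; apply: lt_le_trans h _.
  have -> : q = 1 + (q - 1) by ring.
  apply: le_trans (bernoulli_ineq _ _); last lra.
  by rewrite addrAC subrr add0r lerDr.
elim: n Yn => [|n IH] Yn; first by move: Yn; rewrite expr0; lra.
by have [h|h] := ltP Y (q ^+ n); [exact: IH|exists n; rewrite h].
Qed.

(** [I] is the largest level with [C * q ^+ I <= ln L / 4], so that one scale succeeds with
    probability at least [L ^ (-1/4)]; [l0] is the largest number of scales with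
    [U ^+ (2 * l0) <= 1 / r0], where [U = L ^ (1 / beta)] and [L = ln (1 / r0)]. Then
    [l0 * L ^ (-1/4)] is at least [2 * sqrt L], and [B] is at least of order [L / (ln L) ^+ 2]. *)
Lemma scale_parameters (beta C sigma N Q : R) :
  0 < beta <= 1 -> 1 <= C -> 0 < sigma -> 0 <= N -> 1 <= Q ->
  exists2 L0, 3 <= L0 & forall L, L0 <= L ->
  exists I l0 : nat, let q := 4 `^ Q in
  let B := (4 ^- I / (sigma * (Num.sqrt L)^-1)) ^+ 2 / 4 in
  [/\ 4 ^- I <= 4 * (8 * C) `^ Q^-1 / (2 * ln L) `^ Q^-1,
      2 * l0%:R * ln L <= beta * L,
      q * expR (- B) <= 2^-1 &
      expR (- (expR (- (C * q ^+ I)) * l0%:R)) + l0%:R * (4 * N * expR (- B)) <=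
      expR (- (L `^ 2^-1))].
Proof.
move=> /andP[b0 b1] C1 s0 N0 Q1.
set q := 4 `^ Q.
have q4 : 4 <= q.
  by rewrite /q -[leLHS]powRr1// ler_powR// ler1n.
pose c := (4 * C) ^+ 2 / (4 * sigma ^+ 2).
have c0 : 0 < c by rewrite divr_gt0 ?mulr_gt0 ?exprn_gt0//; lra.
(* In order, the summands serve [ln_le_root], the lower bound on [l0], the lower bound on [B], the
   bound on [q * expR (- B)], [expR_sum_le], and [8 * C <= ln L]. *)
pose M0 := 256 + 6 / beta + 3 / c + q + 32 * N + expR C.
have b6 : 0 < 6 / beta by rewrite divr_gt0.
have c3 : 0 < 3 / c by rewrite divr_gt0.
have eC : 0 < expR C by exact: expR_gt0.
have M0256 : 256 <= M0 by rewrite /M0; lra.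
exists (M0 ^+ 8).
  apply: (@le_trans _ _ M0); first lra.
  by apply: ler_eXnr => //; lra.
move=> L LL0.
have M00 : 0 < M0 by lra.
have L0 : 0 < L by apply: lt_le_trans LL0; rewrite exprn_gt0.
(* The eighth root makes the estimates polynomial: [ln L <= M], while [sqrt L] is [M ^+ 4] and
   [L ^ (-1/4)] is [M ^- 2]. *)
pose M := L `^ 8^-1.
have M_gt0 : 0 < M by rewrite powR_gt0.
have ML : L = M ^+ 8.
  rewrite /M -powR_mulrn ?powR_ge0// -powRrM mulVf ?powRr1//; exact: ltW.
have MM : M0 <= M by rewrite -(@ler_pXn2r _ 8) ?nnegrE ?(ltW M00) ?(ltW M_gt0) -?ML.
have lnL : ln L = 8 * ln M by rewrite ML lnXn// mulr_natl.
have lnLM : ln L <= M by rewrite lnL; apply: ln_le_root; lra.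
have CL : 8 * C <= ln L.
  rewrite lnL ler_pM2l// -[leLHS]expRK ler_ln ?posrE//.
  by apply: le_trans MM; rewrite /M0; lra.
have lL0 : 0 < ln L by lra.
have sL : L `^ 2^-1 = M ^+ 4.
  by rewrite /M -powR_mulrn ?powR_ge0// -powRrM; congr (_ `^ _); field.
have srL : Num.sqrt L = M ^+ 4 by rewrite -sL powR12_sqrt// ltW.
have [||I /andP[I1 I2]] := @exists_power_between q (ln L / (4 * C)).
- lra.
- by rewrite ler_pdivlMr; lra.
have qI Z : (q ^+ Z) `^ Q^-1 = 4 ^+ Z.
  rewrite /q -[_ ^+ Z]powR_mulrn ?powR_ge0// -!powRrM mulrCA divff ?mulr1 ?powR_mulrn//.
  by rewrite gt_eqF//; lra.
exists I, (Num.truncn (beta * L / (2 * ln L))).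
set l0 := Num.truncn _ => q' B; rewrite {}/q'.
have l0le : l0%:R <= beta * L / (2 * ln L).
  by rewrite truncn_le divr_ge0 ?mulr_ge0 ?ltW.
have l0ge : 2 * M ^+ 6 <= l0%:R.
  have h := truncnS_gt (beta * L / (2 * ln L)); rewrite -/l0 -[l0.+1%:R]natr1 in h.
  rewrite -(lerD2r 1); apply: le_trans (ltW h).
  rewrite ler_pdivlMr ?mulr_gt0// [X in _ <= _ * X]ML.
  have m6 : 1 <= M ^+ 6 by apply: exprn_ege1; lra.
  apply: (@le_trans _ _ (3 * M ^+ 6 * (2 * M))).
    by apply: ler_pM => //; lra.
  have -> : M ^+ 8 = M ^+ 6 * M * M by ring.
  have -> : 3 * M ^+ 6 * (2 * M) = 6 * (M ^+ 6 * M) by ring.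
  have -> : beta * (M ^+ 6 * M * M) = beta * M * (M ^+ 6 * M) by ring.
  rewrite ler_pM2r ?mulr_gt0 ?exprn_gt0// -ler_pdivrMl// mulrC.
  by apply: le_trans MM; rewrite /M0; lra.
have l0M : l0%:R <= M ^+ 8.
  apply: le_trans l0le _; rewrite ler_pdivrMr ?mulr_gt0// -ML mulrC ler_pM2l//; lra.
have BM : 3 * M ^+ 4 <= B.
  rewrite /B srL.
  (* The crude bound [4 ^+ I <= q ^+ I] costs [B] only a power of [ln L]. *)
  have Y4 : 4 ^+ I <= ln L / (4 * C).
    apply: le_trans I1; apply: lerXn2r; rewrite ?nnegrE//; lra.
  have -> : (4 ^- I / (sigma * M ^- 4)) ^+ 2 / 4 = M ^+ 8 / (4 * sigma ^+ 2 * (4 ^+ I) ^+ 2).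
    by field; rewrite !expf_neq0// !gt_eqF.
  have i0 : 0 < 4 ^+ I :> R by rewrite exprn_gt0.
  have Y5 : (4 ^+ I) ^+ 2 <= (M / (4 * C)) ^+ 2.
    apply: lerXn2r; [by rewrite nnegrE ltW|by rewrite nnegrE divr_ge0//; lra|].
    by apply: le_trans Y4 _; rewrite ler_pM2r// invr_gt0; lra.
  rewrite ler_pdivlMr ?mulr_gt0 ?exprn_gt0//.
  apply: (@le_trans _ _ (3 * M ^+ 4 * (4 * sigma ^+ 2 * (M / (4 * C)) ^+ 2))).
    have m30 : 0 <= 3 * M ^+ 4 by rewrite mulr_ge0// exprn_ge0// ltW.
    by rewrite ler_wpM2l// ler_wpM2l// mulr_ge0// sqr_ge0.
  have -> : 3 * M ^+ 4 * (4 * sigma ^+ 2 * (M / (4 * C)) ^+ 2) = M ^+ 6 * (3 / c).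
    by rewrite /c; field; rewrite !gt_eqF//; lra.
  have -> : M ^+ 8 = M ^+ 6 * M ^+ 2 by ring.
  rewrite ler_pM2l ?exprn_gt0//; apply: (@le_trans _ _ M).
    by apply: le_trans MM; rewrite /M0; lra.
  by apply: ler_eXnr => //; lra.
have M4 : M <= M ^+ 4 by apply: ler_eXnr => //; lra.
split.
- have h : (ln L / (4 * C)) `^ Q^-1 <= 4 ^+ I.+1.
    rewrite -qI; apply: ge0_ler_powR; rewrite ?nnegrE ?invr_ge0 ?exprn_ge0 ?divr_ge0//; lra.
  have e1 : (8 * C) `^ Q^-1 * (ln L / (4 * C)) `^ Q^-1 = (2 * ln L) `^ Q^-1.
    rewrite -powRM; [|lra|by rewrite divr_ge0//; lra].
    by congr (_ `^ _); field; lra.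
  have p0 : 0 < (8 * C) `^ Q^-1 by rewrite powR_gt0; lra.
  rewrite ler_pdivlMr ?powR_gt0 ?mulr_gt0// -e1 ler_pdivrMl ?exprn_gt0//.
  rewrite exprS in h.
  have -> : 4 ^+ I * (4 * (8 * C) `^ Q^-1) = (8 * C) `^ Q^-1 * (4 * 4 ^+ I) by ring.
  by rewrite ler_pM2l.
- by move: l0le; rewrite ler_pdivlMr ?mulr_gt0//; lra.
- have h := expR_ge1Dx B.
  rewrite expRN ler_pdivrMr ?expR_gt0//.
  have qM : q <= M by apply: le_trans MM; rewrite /M0; lra.
  lra.
- rewrite sL; apply: le_trans (@expR_sum_le N M N0 _ _); [|lra|]; last first.
    by apply: le_trans MM; rewrite /M0; lra.
  apply: lerD.
    rewrite ler_expR lerN2.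
    have -> : 2 * M ^+ 4 = M ^- 2 * (2 * M ^+ 6) by field; rewrite gt_eqF.
    have m6 : 0 <= 2 * M ^+ 6 by rewrite mulr_ge0// exprn_ge0// ltW.
    apply: ler_pM => //; first by rewrite invr_ge0 sqr_ge0.
    have -> : M ^- 2 = expR (- (2 * ln M)).
      by rewrite expRN -{1}[M]lnK ?posrE// expRM_natl.
    rewrite ler_expR lerN2 mulrC.
    move: I1; rewrite ler_pdivlMr; lra.
  apply: ler_pM => //; first by rewrite !mulr_ge0// expR_ge0.
  by rewrite ler_wpM2l ?mulr_ge0// ler_expR lerN2.
Qed.

End scale_parameters.

(** * Measurability of the existence of a scale *)

Section exists_scale_measurable.
Context {R : realType} {k : nat}.
Implicit Types (x y : 'rV[R]_k).

Lemma rV_cvg (u : nat -> 'rV[R]_k) y :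
  (forall i j, `|y 0 j - u i 0 j| <= 4 ^- i) -> u i @[i --> \oo] --> y.
Proof.
move=> h; apply/cvg_ballP => eps eps0.
apply: filterS (near_infty_natSinv_lt (PosNum eps0)) => i /= ieps.
split=> // i0 j; rewrite (ord1 i0); apply: le_lt_trans (h i j) (le_lt_trans _ ieps).
rewrite lef_pV2 ?posrE ?exprn_gt0//.
have b : 1 + i%:R * 3 <= (1 + 3 : R) ^+ i by apply: bernoulli_ineq; lra.
have e4 : (1 + 3 : R) = 4 by ring.
rewrite e4 in b; apply: le_trans b.
by rewrite -[i.+1%:R]natr1 addrC lerD2l ler_peMr//; lra.
Qed.

Lemma cvg_le_bound (u : nat -> R) (l t : R) :
  u i @[i --> \oo] --> l -> (forall i, u i <= t) -> l <= t.
Proof.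
move=> ul ut; rewrite leNgt; apply/negP => tl.
have [i] := filter_ex (cvgr_gt l ul t tl).
by rewrite ltNge ut.
Qed.

Let unit_exp : 'I_k -> R := fun=> 1.

(** A countable dense set containing the roundings of every point towards [x]. As such roundings do
    not increase [D] ([D_round] below), a bound on a sublevel set of [D] may be tested on these
    points. *)
Definition lattice_point x (u : nat * 'rV[int]_k) : 'rV[R]_k :=
  x + \row_j (mesh unit_exp u.1 j * (u.2 0 j)%:~R).

Lemma lattice_point_round x i y :
  exists m, lattice_point x (i, m) = x + round_grid unit_exp i (y - x).
Proof.
pose t (s : R) : int := (Num.sg s == 1)%:R * (Num.truncn `|s|)%:Z -
  (Num.sg s == -1)%:R * (Num.truncn `|s|)%:Z.
have tE s : (t s)%:~R = truncz s.
  rewrite /t /truncz; have [s0|s0|<-] := ltrgtP 0 s.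
  - rewrite gtr0_sg// eqxx mul1r (_ : 1 == -1 = false) ?mul0r ?subr0 ?mul1r//.
    by apply/negbTE; rewrite gt_eqF//; lra.
  - rewrite ltr0_sg// eqxx mul1r (_ : -1 == 1 = false) ?mul0r ?sub0r ?mulN1r ?rmorphN//.
    by apply/negbTE; rewrite lt_eqF//; lra.
  - by rewrite sgr0 normr0 truncn0 !mulr0 subrr.
exists (\row_j t ((y - x) 0 j / mesh unit_exp i j)).
by congr (_ + _); apply/rowP => j; rewrite !mxE tE.
Qed.

Lemma lattice_point_cvg x y :
  (x + round_grid unit_exp i (y - x)) @[i --> \oo] --> y.
Proof.
apply: rV_cvg => i j; have := round_grid_dist unit_exp i (y - x) j; rewrite /mesh powRr1 ?invr_ge0 ?exprn_ge0//.
apply: le_trans; rewrite !mxE le_eqVlt; apply/orP; left; apply/eqP; congr `|_|; ring.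
Qed.

Context {dT} {T : measurableType dT}.
Variables (G : 'rV[R]_k -> T -> R) (D : 'rV[R]_k -> R) (x0 : 'rV[R]_k) (f : R -> R) (a b : R).
Hypothesis mG : forall y, measurable_fun setT (G y).
Hypothesis cG : forall w, continuous (fun y => G y w).
Hypothesis D_round : forall i y, D (x0 + round_grid unit_exp i (y - x0)) <= D y.
Hypothesis cf : forall r, a <= r <= b -> {for r, continuous f}.

Let S q t := [set w | forall u, D (lattice_point x0 u) < q -> G (lattice_point x0 u) w <= t].

Let SP q t w : S q t w <-> forall y, D y < q -> G y w <= t.
Proof.
split=> [h y Dy|h u]; last exact: h.
have yc := @lattice_point_cvg x0 y.
apply: (cvg_le_bound (u := fun i => G (x0 + round_grid unit_exp i (y - x0)) w)).
  exact: (@cvg_comp _ _ _ _ (fun y => G y w) _ _ _ yc (@cG w y)).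
move=> i /=; have [m me] := lattice_point_round x0 i y; rewrite -me.
by apply: h; rewrite me; apply: le_lt_trans Dy; exact: D_round.
Qed.

Let mS q t : measurable (S q t).
Proof.
rewrite (_ : S q t = ~` \bigcup_u
    [set w | D (lattice_point x0 u) < q /\ t < G (lattice_point x0 u) w]).
  apply: measurableC; apply: countable_bigcupT_measurable; first exact: countableP.
  move=> u; have [h|h] := pselect (D (lattice_point x0 u) < q).
    rewrite (_ : [set w | _] = G (lattice_point x0 u) @^-1` `]t, +oo[%classic).
      rewrite -[X in measurable X]setTI; apply: mG => //; exact: measurable_itv.
    by apply/seteqP; split=> w; rewrite /= in_itv /= andbT; [case|].
  by rewrite (_ : [set w | _] = set0)//; apply/seteqP; split=> w //= -[].
apply/seteqP; split=> w /= h.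
  by move=> [u _ [Du tG]]; have := h u Du; rewrite leNgt tG.
by move=> u Du; rewrite leNgt; apply/negP => tG; apply: h; exists u.
Qed.

(* The supremum is left-continuous and nondecreasing in the radius, so that radii from
   a countable set are enough up to an arbitrarily small error; compactness of [[a, b]]
   recovers an exact radius. *)
Lemma measurable_exists_scale : measurable [set w | exists r : R, a <= r <= b /\
  (ereal_sup [set (G y w)%:E | y in [set y | (D y < r)%R]] <= (f r)%:E)%E].
Proof.
pose q (u : nat * nat) : R := a + u.2%:R * u.1.+1%:R^-1.
rewrite (_ : [set w | _] = \bigcap_m \bigcup_u
    [set w | q u <= b /\ S (q u) (f (q u) + m.+1%:R^-1) w]).
  apply: bigcapT_measurable => m; apply: countable_bigcupT_measurable; first exact: countableP.
  move=> u; have [h|h] := pselect (q u <= b); last first.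
    by rewrite (_ : [set w | _] = set0)//; apply/seteqP; split=> w //= -[].
  rewrite (_ : [set w | _] = S (q u) (f (q u) + m.+1%:R^-1))//.
  by apply/seteqP; split=> w /=; [case|].
apply/seteqP; split=> w /=.
- move=> [r [/andP[ar rb] h]] m _.
  have Gr y : D y < r -> G y w <= f r.
    by move=> Dy; rewrite -lee_fin; apply: le_trans h; apply: ereal_sup_ubound; exists y.
  have m0 : 0 < (m.+1%:R : R)^-1 by rewrite invr_gt0.
  have rab : a <= r <= b by rewrite ar rb.
  have /cvgrPdist_lt/(_ _ m0)/nbhs_ballP[del /= del0 fdel] := cf rab.
  have [n _ /(_ n (leqnn _)) ndel] := near_infty_natSinv_lt (PosNum del0).
  have n0 : 0 < (n.+1%:R : R) by [].
  have /andP[p1 p2] : (Num.truncn ((r - a) * n.+1%:R))%:R <= (r - a) * n.+1%:R <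
      (Num.truncn ((r - a) * n.+1%:R)).+1%:R.
    by apply: truncn_itv; rewrite mulr_ge0 ?subr_ge0.
  set j := Num.truncn _ in p1 p2; exists (n, j) => //=.
  have q1 : q (n, j) <= r by rewrite /q /= -lerBrDl ler_pdivrMr.
  have q2 : r - q (n, j) < del.
    apply: le_lt_trans ndel.
    rewrite -[j.+1%:R]natr1 in p2.
    have : r - a < (j%:R + 1) / n.+1%:R by rewrite ltr_pdivlMr.
    rewrite /q /= mulrDl mul1r => /ltW h3; rewrite opprD addrA lerBlDr; apply: le_trans h3 _; by rewrite addrC.
  split; first exact: le_trans rb.
  apply/SP => y Dy; apply: le_trans (Gr y (lt_le_trans Dy q1)) _.
  have := fdel (q (n, j)); rewrite /ball /= (ger0_norm (x := r - _)) ?subr_ge0// => /(_ q2).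
  by move=> /ltr_normlW; rewrite ltrBlDl => /ltW.
- move=> h.
  have /choice[u uP] : forall m : nat, exists u, q u <= b /\ S (q u) (f (q u) + m.+1%:R^-1) w.
    by move=> m; have [u _ hu] := h m I; exists u.
  have qa u' : a <= q u' by rewrite /q lerDl mulr_ge0// invr_ge0.
  have Fab : (q (u m) @[m --> \oo]) `[a, b]%classic.
    by exists 0%N => // m _ /=; rewrite in_itv /=; apply/andP; split; [exact: qa|exact: (uP m).1].
  (* [r] is a cluster point of the radii [q (u m)]. Should the bound fail at [r] for some [y] with
     [D y < r], it would already fail at some [q (u m)] close to [r] with [m] large, since there
     [D y < q (u m)] and both [f] and the error have settled. *)
  have [r [/= rab rcl]] := segment_compact _ Fab.
  exists r; rewrite in_itv /= in rab; split=> //.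
  apply: ub_ereal_sup => _ [y /= Dy <-]; rewrite lee_fin leNgt; apply/negP => fG.
  pose eps := (G y w - f r) / 2; have eps0 : 0 < eps by rewrite divr_gt0// subr_gt0.
  have /cvgrPdist_lt/(_ _ eps0)/nbhs_ballP[del /= del0 fdel] := cf rab.
  have [n _ neps] := near_infty_natSinv_lt (PosNum eps0).
  have F1 : (q (u m) @[m --> \oo]) [set x | exists2 m, (n <= m)%N & x = q (u m)].
    by exists n => // m /= nm; exists m.
  pose del' := Num.min del (r - D y).
  have del'0 : 0 < del' by rewrite lt_min del0 subr_gt0.
  have F2 : nbhs r (ball r del') by exact: nbhsx_ballx.
  have [x [[m nm ->]]] := rcl _ _ F1 F2; rewrite /ball /= lt_min => /andP[b1 b2].
  have [_ /SP Sm] := uP m.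
  have Dq : D y < q (u m) by move: b2 => /ltr_normlW; lra.
  have h3 := Sm y Dq; have h2 := neps m nm.
  move: (fdel _ b1) => /=; rewrite distrC => /ltr_normlW h1.
  have : G y w < f r + eps + eps.
    by apply: le_lt_trans h3 _; apply: ltrD => //; rewrite -ltrBlDl.
  by rewrite /eps -addrA -splitr addrC subrK ltxx.
Qed.

End exists_scale_measurable.

(** * Anisotropic boxes *)

Lemma enorm_le {R : realType} {n} (x : 'rV[R]_n) (b : R) : 0 <= b ->
  (forall j, `|x 0 j| <= b) -> enorm x <= n%:R * b.
Proof.
move=> b0 xb; have s0 : 0 <= n%:R * b by rewrite mulr_ge0.
rewrite /enorm -[leRHS]ger0_norm// -sqrtr_sqr ler_sqrt ?sqr_ge0//.
apply: (@le_trans _ _ (\sum_(j < n) b ^+ 2)).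
  apply: ler_sum => j _; rewrite -(real_normK (num_real (x 0 j))).
  by apply: lerXn2r; rewrite ?nnegrE.
rewrite sumr_const card_ord -[_ *+ n]mulr_natl exprMn ler_wpM2r ?sqr_ge0//.
by rewrite -natrX ler_nat -[X in (X <= _)%N]expn1; case: (n) => // n'; rewrite leq_pexp2l.
Qed.

Section boxes.
Context {R : realType} {k : nat}.
Variable gamma : 'I_k -> R.
Hypothesis gamma0 : forall j, 0 < gamma j.
Implicit Types (x y z : 'rV[R]_k).

Let e (j : 'I_k) : R := gamma j + 1.

Let e_gt0 j : 0 < e j.
Proof. by rewrite /e addr_gt0. Qed.

Let e_ge1 j : 1 <= e j.
Proof. by rewrite /e lerDr ltW. Qed.

(** Anisotropic coordinates around [x]: the image of the open unit cube contains the [Delta]-ball of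
    radius [r], and a step [mesh i j] in the cube becomes [(r * 4 ^- i) ^ (gamma j + 1)]. *)
Definition box_point (r : R) x z : 'rV[R]_k := x + \row_j (r `^ (gamma j + 1) * z 0 j).

Lemma box_point0 r x : box_point r x 0 = x.
Proof. by apply/rowP => j; rewrite !mxE mulr0 addr0. Qed.

Definition near_pt delta x y : Prop :=
  forall j, `|x 0 j - y 0 j| <= delta `^ (gamma j + 1).

Lemma box_point_near r x i z : 0 < r ->
  near_pt (r * 4 ^- i) (box_point r x z) (box_point r x (round_grid e i z)).
Proof.
move=> r0 j; have := round_grid_dist e i z j; rewrite [round_grid _ _ _ _ _]mxE => h.
rewrite ![box_point _ _ _ 0 j]mxE ![(\row_j _) 0 j]mxE opprD addrACA subrr add0r -mulrBr.
rewrite normrM ger0_norm ?powR_ge0// powRM ?(ltW r0)// ?invr_ge0 ?exprn_ge0//.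
by apply: ler_wpM2l; [exact: powR_ge0|exact: h].
Qed.

Lemma box_point_cvg r x z : 0 < r <= 1 ->
  box_point r x (round_grid e i z) @[i --> \oo] --> box_point r x z.
Proof.
move=> /andP[r0 r1]; apply: rV_cvg => i j.
apply: le_trans (box_point_near x i z r0 j) _.
have h0 : 0 <= r * 4 ^- i by rewrite mulr_ge0 ?invr_ge0 ?exprn_ge0// ltW.
have i1 : 4 ^- i <= 1 :> R by rewrite invf_le1 ?exprn_gt0// exprn_ege1// ler1n.
apply: (@le_trans _ _ (r * 4 ^- i)); last by rewrite ler_piMl// invr_ge0 exprn_ge0.
apply: ge1r_powR; last exact: e_ge1.
by rewrite mulr_gt0 ?invr_gt0 ?exprn_gt0//= mulr_ile1// ?invr_ge0 ?exprn_ge0// ltW.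
Qed.

Lemma Delta_ball_box r x y : 0 < r -> Delta gamma y x < r ->
  exists2 z, in_cube z & y = box_point r x z.
Proof.
move=> r0 yx; exists (\row_j ((y 0 j - x 0 j) / r `^ e j)); last first.
  apply/rowP => j; rewrite !mxE mulrCA divff ?gt_eqF ?powR_gt0// mulr1; ring.
apply/forallP => j; rewrite mxE normrM (gtr0_norm (x := _^-1)) ?invr_gt0 ?powR_gt0//.
rewrite ltr_pdivrMr ?powR_gt0// mul1r.
have : `|y 0 j - x 0 j| `^ alpha gamma j < r.
  apply: le_lt_trans yx; rewrite /Delta (bigD1 j)//= lerDl.
  by apply: sumr_ge0 => i _; exact: powR_ge0.
move=> h; have {}h : (`|y 0 j - x 0 j| `^ alpha gamma j) `^ e j < r `^ e j.
  by apply: gt0_ltr_powR; rewrite ?nnegrE ?powR_ge0// ltW.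
by move: h; rewrite -powRrM /alpha mulVf ?powRr1// gt_eqF//; exact: e_gt0.
Qed.

Lemma box_point_dist r x z : 0 < r <= 1 -> in_cube z -> enorm (box_point r x z - x) <= k%:R * r.
Proof.
move=> /andP[r0 r1] zc.
apply: enorm_le => [|j]; first exact: ltW.
rewrite !mxE addrAC subrr add0r normrM ger0_norm ?powR_ge0//.
apply: (@le_trans _ _ (r `^ e j * 1)).
  by rewrite ler_wpM2l ?powR_ge0// ltW//; move/forallP : zc => /(_ j).
by rewrite mulr1; apply: ge1r_powR; [rewrite r0|exact: e_ge1].
Qed.

Variable d : nat.

(** [(i, z, c)] is a link of a chain, from the point [z] of the grid of level [i + 1] to its
    rounding at level [i], for the component [c] of the field. The shift of levels accounts for a
    factor [4 ^ Qdim gamma] in the count of links. *)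
Definition chain_index n : seq (nat * 'rV[R]_k * 'I_d) :=
  [seq (p, c) | p <- [seq (i, z) | i <- iota 0 n, z <- grid e i.+1], c <- enum 'I_d].

Lemma mem_chain_index n i z c :
  ((i, z, c) \in chain_index n) = (i < n)%N && (z \in grid e i.+1).
Proof.
apply/allpairsP/andP => /=.
  move=> [[p c']] /= [/allpairsPdep[i' [z' [i'n z'g ->]]] _ [-> -> _]].
  by move: i'n; rewrite mem_iota add0n => /andP[_ ->].
move=> [i_n zg]; exists ((i, z), c); split=> //=; last by rewrite mem_enum.
by apply/allpairsPdep; exists i, z; rewrite mem_iota add0n.
Qed.

Lemma sum_chain_index n (f : nat -> R) : (forall i, 0 <= f i) ->
  \sum_(u <- chain_index n) f u.1.1 <=
  (d%:R * 3 ^+ k * 4 `^ Qdim gamma) * \sum_(i < n) (4 `^ Qdim gamma) ^+ i * f i.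
Proof.
move=> f0; rewrite big_allpairs_dep big_allpairs_dep /=.
rewrite [\sum_(i < n) _](_ : _ = \sum_(i <- iota 0 n) (4 `^ Qdim gamma) ^+ i * f i); last first.
  by rewrite -(big_mkord xpredT (fun i => (4 `^ Qdim gamma) ^+ i * f i)) /index_iota subn0.
rewrite mulr_sumr; apply: ler_sum => i _.
rewrite (eq_bigr (fun=> d%:R * f i)); last first.
  move=> z _; rewrite big_const_seq count_predT -cardE card_ord iter_addr addr0 mulr_natl//.
rewrite big_const_seq count_predT iter_addr addr0 -[_ *+ size _]mulr_natl.
have h := size_grid e_gt0 i.+1.
have h2 : (size (grid e i.+1))%:R * (d%:R * f i) <=
    3 ^+ k * 4 `^ (\sum_j e j) ^+ i.+1 * (d%:R * f i).
  by rewrite ler_wpM2r// mulr_ge0.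
apply: le_trans h2 _; rewrite /Qdim -/e exprS le_eqVlt; apply/orP; left; apply/eqP; ring.
Qed.

Lemma chain_index_neq0 n : (0 < d)%N -> (0 < n)%N -> (0 < size (chain_index n))%N.
Proof.
move=> d0 n0; rewrite -has_predT; apply/hasP.
exists (0%N, round_grid e 1 0, Ordinal d0) => //.
rewrite mem_chain_index n0 round_grid_mem//.
by apply/forallP => j; rewrite mxE normr0.
Qed.

(** Each point of the chain is the rounding of the preceding one, not of [z] itself, so that all
    links belong to [chain_index n]; hence the induction quantifies over [z]. *)
Lemma chain_bound n (F : 'rV[R]_k -> 'I_d -> R) (eta : nat -> R) :
  (forall u, u \in chain_index n -> `|F u.1.2 u.2 - F (round_grid e u.1.1 u.1.2) u.2| <= eta u.1.1) ->
  forall i z c, (i <= n)%N -> in_cube z ->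
  `|F (round_grid e i z) c - F 0 c| <= \sum_(m < i) eta m.
Proof.
move=> h; elim=> [|i IH] z c i_n zc; first by rewrite round_grid0// subrr normr0 big_ord0.
have z1 := round_grid_mem e i.+1 zc.
have uJ : (i, round_grid e i.+1 z, c) \in chain_index n by rewrite mem_chain_index i_n.
rewrite big_ord_recr /= addrC -(subrK (F (round_grid e i (round_grid e i.+1 z)) c)
  (F (round_grid e i.+1 z) c)) -addrA.
apply: le_trans (ler_normD _ _) _; apply: lerD; first exact: (h _ uJ).
by apply: IH; [exact: ltnW|exact: round_grid_cube].
Qed.

End boxes.

(** * Increments of the white noise *)

Section second_moments.
Context {R : realType} {dT} {T : measurableType dT} (P : probability T R).
Implicit Types (f g : T -> R).

Definition sqmean f : \bar R := (\int[P]_w (f w ^+ 2)%:E)%E.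

Lemma sqmean_ae f g : measurable_fun setT f -> measurable_fun setT g ->
  {ae P, forall w, f w = g w} -> sqmean f = sqmean g.
Proof.
move=> mf mg fg; apply: ae_eq_integral => //.
- by apply/measurable_EFinP; exact: measurable_funX.
- by apply/measurable_EFinP; exact: measurable_funX.
- by apply: filterS fg => w fgw _; rewrite fgw.
Qed.

Lemma sqmeanD f g (a b : R) : measurable_fun setT f -> measurable_fun setT g ->
  (sqmean f <= a%:E)%E -> (sqmean g <= b%:E)%E ->
  (sqmean (fun w => (f w + g w)%R) <= (2 * a + 2 * b)%:E)%E.
Proof.
move=> mf mg fa gb.
have msq (h : T -> R) : measurable_fun setT h ->
    measurable_fun setT (fun w => (h w ^+ 2)%:E : \bar R).
  by move=> mh; apply/measurable_EFinP; exact: measurable_funX.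
apply: (@le_trans _ _ (\int[P]_w (2%:E * (f w ^+ 2)%:E + 2%:E * (g w ^+ 2)%:E))%E).
  apply: ge0_le_integral => //.
  - by move=> w _; rewrite lee_fin sqr_ge0.
  - by apply: msq; exact: measurable_funD.
  - by apply: emeasurable_funD; apply: measurable_funeM; exact: msq.
  - move=> w _; rewrite -!EFinM -EFinD lee_fin.
    have : 0 <= (f w - g w) ^+ 2 by exact: sqr_ge0.
    rewrite sqrrB sqrrD; lra.
rewrite ge0_integralD//; last 4 first.
- by move=> w _; rewrite mule_ge0// lee_fin sqr_ge0.
- by apply: measurable_funeM; exact: msq.
- by move=> w _; rewrite mule_ge0// lee_fin sqr_ge0.
- by apply: measurable_funeM; exact: msq.
rewrite !ge0_integralZl//; try exact: msq; try by move=> w _; rewrite lee_fin sqr_ge0.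
rewrite (_ : (2 * a + 2 * b)%:E = 2%:E * a%:E + 2%:E * b%:E)%E//.
by apply: leeD; rewrite lee_pmul2l.
Qed.

Lemma sqmeanN f : sqmean (fun w => - f w) = sqmean f.
Proof. by apply: eq_integral => w _; rewrite sqrrN. Qed.

Lemma sqmean_L2norm {d} (X : T -> 'rV[R]_d) (C : R) (j : 'I_d) :
  (forall i, measurable_fun setT (fun w => X w 0 i)) -> 0 <= C ->
  (L2norm P X <= C%:E)%E -> (sqmean (fun w => X w 0%R j) <= (C ^+ 2)%:E)%E.
Proof.
move=> mX C0 XC.
have menorm : measurable_fun setT (fun w => enorm (X w)).
  apply: measurableT_comp.
    by apply: continuous_measurable_fun; exact: sqrt_continuous.
  by apply: measurable_sum => i; exact: measurable_funX.
have E2 : (\int[P]_w ((enorm (X w)) ^+ 2)%:E = L2norm P X `^ 2)%E.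
  rewrite /L2norm poweR_Lnorm//; apply: eq_integral => w _ /=.
  by rewrite ger0_norm ?sqrtr_ge0// powR_mulrn// sqrtr_ge0.
apply: (@le_trans _ _ (\int[P]_w ((enorm (X w)) ^+ 2)%:E)%E).
  apply: ge0_le_integral => //.
  - by move=> w _; rewrite lee_fin sqr_ge0.
  - by apply/measurable_EFinP; exact: measurable_funX.
  - by apply/measurable_EFinP; exact: measurable_funX.
  - move=> w _; rewrite lee_fin /enorm sqr_sqrtr; last by apply: sumr_ge0 => i _; exact: sqr_ge0.
    by rewrite (bigD1 j)//= lerDl; apply: sumr_ge0 => i _; exact: sqr_ge0.
have L0 : (0 <= L2norm P X)%E by exact: Lnorm_ge0.
have Lf : L2norm P X \is a fin_num by rewrite ge0_fin_numE// (le_lt_trans XC)// ltry.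
rewrite E2 -(fineK Lf) poweR_EFin lee_fin powR_mulrn ?fine_ge0//.
by apply: lerXn2r; rewrite ?nnegrE ?fine_ge0// -lee_fin fineK.
Qed.

Lemma cgauss_sqmean X s C : cgauss P X s -> 0 <= C -> (sqmean X <= (C ^+ 2)%:E)%E ->
  s <= C / Num.sqrt normal_sqr.
Proof.
move=> Xs C0; rewrite /sqmean (cgauss_sqr Xs) lee_fin => h.
have [_ s0 _] := Xs.
have n0 : 0 < Num.sqrt (@normal_sqr R) by rewrite sqrtr_gt0 normal_sqr_gt0.
rewrite ler_pdivlMr// -[leRHS]ger0_norm// -sqrtr_sqr.
rewrite -[leLHS]ger0_norm ?mulr_ge0 ?(ltW n0)// -sqrtr_sqr ler_sqrt ?sqr_ge0//.
by rewrite exprMn sqr_sqrtr// ltW// normal_sqr_gt0.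
Qed.

End second_moments.

Section white_noise_increments.
Context {R : realType} {dT} {T : measurableType dT} (P : probability T R).
Context {k d : nat}.
Variables (V : set R -> 'rV[R]_k -> T -> 'rV[R]_d) (v : 'rV[R]_k -> T -> 'rV[R]_d).
Variables (D : set 'rV[R]_k) (gamma : 'I_k -> R) (c0 a0 : R).
Hypothesis VG : gaussian_field P [set p | borel_Rplus p.1]
  (fun p : set R * 'rV[R]_k => V p.1 p.2).
Hypothesis VW : forall x, D x -> white_noise P (fun A => V A x).
Hypothesis Vv : forall x, D x -> {ae P, forall w, V `[0%R, +oo[%classic x w = v x w}.
Hypothesis Vind : forall A B, borel_Rplus A -> borel_Rplus B -> A `&` B = set0 ->
  indep2 P (sigma_of (fun (p : 'rV[R]_k * 'I_d) w => V A p.1 w 0 p.2))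
           (sigma_of (fun (p : 'rV[R]_k * 'I_d) w => V B p.1 w 0 p.2)).
Hypothesis mv : forall x j, measurable_fun setT (fun w => v x w 0 j).
Hypothesis gamma0 : forall j, 0 < gamma j.
Hypothesis c00 : 0 <= c0.
Hypothesis a00 : 0 <= a0.
Hypothesis Vb : forall (a : R) (b : \bar R), a0 <= a -> (a%:E <= b)%E ->
  forall x y, D x -> D y ->
  (L2norm P (fun w => V (co_itv a b) x w - v x w - V (co_itv a b) y w + v y w)%R <=
   c0%:E * ((\sum_(j < k) (a `^ gamma j * `|x 0%R j - y 0%R j|))%:E + b^-1))%E.

(** The Gaussian space to which the small ball estimates are applied: the span of the components of
    the noise at points of [D], where it is centered. The field [v] is related to it by almost sure
    identities. *)
Inductive vspan : (T -> R) -> Prop :=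
| vspan_coord A x j : borel_Rplus A -> D x -> vspan (fun w => V A x w 0 j)
| vspanD X Y : vspan X -> vspan Y -> vspan (fun w => X w + Y w)
| vspanZ a X : vspan X -> vspan (fun w => a * X w).

Let vspan_repr X : vspan X ->
  exists n (t : 'I_n -> set R * 'rV[R]_k) (c : 'I_n -> 'rV[R]_d),
    (forall i, borel_Rplus (t i).1) /\
    X = (fun w => \sum_(i < n) \sum_(j < d) c i 0 j * V (t i).1 (t i).2 w 0 j).
Proof.
elim=> [A x j bA Dx|{}X Y _ [n1 [t1 [c1 [h1 ->]]]] _ [n2 [t2 [c2 [h2 ->]]]]|a {}X _ [n [t [c [h ->]]]]].
- exists 1%N, (fun=> (A, x)), (fun=> delta_mx 0 j); split=> //.
  apply/funext => w; rewrite big_ord_recl big_ord0 addr0 /= (bigD1 j)//= mxE !eqxx mul1r.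
  by rewrite big1 ?addr0// => i /negbTE ij; rewrite mxE ij andbF mul0r.
- exists (n1 + n2)%N,
    (fun i => match fintype.split i with inl a => t1 a | inr b => t2 b end),
    (fun i => match fintype.split i with inl a => c1 a | inr b => c2 b end).
  split; first by move=> i; case: (fintype.split i).
  apply/funext => w; rewrite big_split_ord /=; congr (_ + _); apply: eq_bigr => i _.
    by rewrite (unsplitK (inl i)).
  by rewrite (unsplitK (inr i)).
- exists n, t, (fun i => a *: c i); split=> //.
  apply/funext => w; rewrite big_distrr /=; apply: eq_bigr => i _.
  by rewrite big_distrr /=; apply: eq_bigr => j _; rewrite mxE mulrA.
Qed.

Let vspan_gaussian X : vspan X -> gaussian_rv P X.
Proof. by move=> /vspan_repr[n [t [c [h ->]]]]; exact: VG. Qed.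

Let vspan_mean X : vspan X ->
  P.-integrable setT (EFin \o X) /\ (\int[P]_w (X w)%:E = 0)%E.
Proof.
elim=> [A x j bA Dx|{}X Y _ [i1 e1] _ [i2 e2]|a {}X _ [i1 e1]].
- have [nu [/(_ A bA) [_ cA _] _ _]] := VW Dx.
  have E0 : (\int[P]_w (V A x w 0 j)%:E = 0)%E.
    by have := cA j; rewrite unlock.
  split=> //; have [s Xs] := gaussian_rv_cgauss (vspan_gaussian (vspan_coord j bA Dx)) E0.
  have i1 : P.-integrable setT (EFin \o (fun=> 1 : R)).
    by apply: (bounded_integrable 1) => // w; rewrite normr1.
  have [mX _ _] := Xs.
  apply: (le_integrable measurableT _ _ (integrableD measurableT i1 (sqr_integrable_cgauss Xs))).
    exact/measurable_EFinP.
  move=> w _ /=; rewrite lee_fin [leRHS]ger0_norm ?addr_ge0 ?sqr_ge0//.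
  have : 0 <= (`|V A x w 0 j| - 1) ^+ 2 by exact: sqr_ge0.
  rewrite sqrrB real_normK ?num_real//.
  have := normr_ge0 (V A x w 0 j); lra.
- split; first exact: (integrableD measurableT i1 i2).
  transitivity (\int[P]_w ((X w)%:E + (Y w)%:E))%E; first by [].
  by rewrite (integralD measurableT i1 i2) [X in (X + _)%E]e1 [X in (_ + X)%E]e2 adde0.
- split; first exact: (integrableZl measurableT a i1).
  transitivity (\int[P]_w (a%:E * (X w)%:E))%E; first by [].
  by rewrite integralZl// e1 mule0.
Qed.

Lemma vspan_gspace : gspace P vspan.
Proof.
split; [exact: vspanD|exact: vspanZ|].
by move=> X vX; apply: gaussian_rv_cgauss; [exact: vspan_gaussian|have [] := vspan_mean vX].
Qed.

Let mV X : vspan X -> measurable_fun setT X.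
Proof. by move=> vX; exact: (gspace_measurable vspan_gspace vX). Qed.

Lemma vspanB X Y : vspan X -> vspan Y -> vspan (fun w => X w - Y w).
Proof.
move=> vX vY; rewrite (_ : (fun w => _) = (fun w => X w + -1 * Y w)).
  by apply: vspanD => //; exact: vspanZ.
by apply/funext => w; rewrite mulN1r.
Qed.

Lemma V_orthogonal A B x y i j : borel_Rplus A -> borel_Rplus B -> A `&` B = set0 ->
  D x -> D y -> (\int[P]_w (V A x w 0 i * V B y w 0 j) = 0)%R.
Proof.
move=> bA bB AB Dx Dy.
apply: (independent_uncorrelated vspan_gspace).
- exact: vspan_coord.
- exact: vspan_coord.
- move=> E F mE mF; apply: (Vind bA bB AB).
    by apply: sub_sigma_algebra; exists (x, i), E.
  by apply: sub_sigma_algebra; exists (y, j), F.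
Qed.

Definition incr A x y j (w : T) : R := V A x w 0 j - V A y w 0 j.

Lemma vspan_incr A x y j : borel_Rplus A -> D x -> D y -> vspan (incr A x y j).
Proof. by move=> bA Dx Dy; apply: vspanB; exact: vspan_coord. Qed.

Lemma incr_orthogonal A B x y x' y' i j : borel_Rplus A -> borel_Rplus B ->
  A `&` B = set0 -> D x -> D y -> D x' -> D y' ->
  (\int[P]_w (incr A x y i w * incr B x' y' j w) = 0)%R.
Proof.
move=> bA bB AB Dx Dy Dx' Dy'; have g := vspan_gspace.
have vc C z l : borel_Rplus C -> D z -> vspan (fun w => V C z w 0 l) by exact: vspan_coord.
have one z l : D z -> (\int[P]_w (incr A x y i w * V B z w 0 l) = 0)%R.
  move=> Dz.
  have i1 := mul_integrable g (vc A x i bA Dx) (vc B z l bB Dz).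
  have i2 := mul_integrable g (vc A y i bA Dy) (vc B z l bB Dz).
  transitivity (\int[P]_w (V A x w 0 i * V B z w 0 l - V A y w 0 i * V B z w 0 l))%R.
    by apply: eq_Rintegral => w _; rewrite /incr mulrBl.
  by rewrite RintegralB// !V_orthogonal// subr0.
have i1 := mul_integrable g (vspan_incr i bA Dx Dy) (vc B x' j bB Dx').
have i2 := mul_integrable g (vspan_incr i bA Dx Dy) (vc B y' j bB Dy').
transitivity (\int[P]_w (incr A x y i w * V B x' w 0 j - incr A x y i w * V B y' w 0 j))%R.
  by apply: eq_Rintegral => w _; rewrite -mulrBr.
by rewrite RintegralB// !one// subr0.
Qed.

Lemma borel_co_itv (a : R) (b : \bar R) : 0 <= a -> borel_Rplus (co_itv a b).
Proof.
move=> a_ge0; split; last first.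
  by move=> t [at_ _]; rewrite /= in_itv /= andbT; exact: le_trans at_.
case: b => [b| |].
- rewrite (_ : co_itv _ _ = `[a, b[%classic); first exact: measurable_itv.
  by apply/seteqP; split=> t /=; rewrite in_itv /co_itv /= lte_fin => /andP.
- rewrite (_ : co_itv _ _ = `[a, +oo[%classic); first exact: measurable_itv.
  apply/seteqP; split=> t /=; rewrite in_itv /= andbT; first by case.
  by move=> h; split=> //; rewrite ltry.
- rewrite (_ : co_itv _ _ = set0); first exact: measurable0.
  by apply/seteqP; split=> t //= -[].
Qed.

Local Notation Rp := (`[0%R, +oo[%classic : set R).

Let borel_Rp : borel_Rplus Rp.
Proof. by split=> //; exact: measurable_itv. Qed.

Let V_set0 x : D x -> {ae P, forall w, V set0 x w = 0}.
Proof.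
move=> Dx; have [nu [_ Vadd _]] := VW Dx.
have b0 : borel_Rplus (set0 : set R) by split=> //; exact: measurable0.
apply: filterS (Vadd _ _ b0 b0 (setI0 _)) => w; rewrite setU0 => h.
by apply: (addrI (V set0 x w)); rewrite addr0 -h.
Qed.

Let incr_bound a b x y j K : a0 <= a -> (a%:E <= b)%E -> D x -> D y -> 0 <= K ->
  (c0%:E * ((\sum_(j < k) (a `^ gamma j * `|x 0%R j - y 0%R j|))%:E + b^-1) <= K%:E)%E ->
  (sqmean P (fun w => (incr (co_itv a b) x y j w - incr Rp x y j w)%R) <= (K ^+ 2)%:E)%E.
Proof.
move=> a0a ab Dx Dy K0 hK.
have a_ge0 : 0 <= a by exact: le_trans a0a.
have bA := borel_co_itv b a_ge0.
have mA z i : D z -> measurable_fun setT (fun w => V (co_itv a b) z w 0 i).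
  by move=> Dz; apply: mV; exact: vspan_coord.
have mR z i : D z -> measurable_fun setT (fun w => V Rp z w 0 i).
  by move=> Dz; apply: mV; exact: vspan_coord.
have h := le_trans (Vb a0a ab Dx Dy) hK.
apply: le_trans (sqmean_L2norm j _ K0 h); last first.
  move=> i.
  rewrite (_ : (fun w => _) = (fun w => V (co_itv a b) x w 0 i - v x w 0 i -
      V (co_itv a b) y w 0 i + v y w 0 i)); last by apply/funext => w; rewrite !mxE.
  apply: measurable_funD => //; apply: measurable_funB; last exact: mA.
  by apply: measurable_funB => //; exact: mA.
rewrite le_eqVlt; apply/orP; left; apply/eqP; apply: sqmean_ae.
- apply: measurable_funB; apply: measurable_funB; by [exact: mA|exact: mR].
- rewrite (_ : (fun w => _) = (fun w => V (co_itv a b) x w 0 j - v x w 0 j -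
      V (co_itv a b) y w 0 j + v y w 0 j)); last by apply/funext => w; rewrite !mxE.
  apply: measurable_funD => //; apply: measurable_funB; last exact: mA.
  by apply: measurable_funB => //; exact: mA.
- apply: filterS2 (Vv Dx) (Vv Dy) => w hx hy.
  by rewrite /incr !mxE hx hy; ring.
Qed.

(** A coordinate gap of at most [delta ^ (gamma j + 1)] bounds the [j]-th term by
    [(a * delta) ^ gamma j * delta]. The exponents of [Delta] are the ones for which frequencies far
    below [1 / delta] contribute far less than [delta]. *)
Let sum_near a delta tau x y : 0 <= a -> 0 < delta -> near_pt gamma delta x y ->
  (forall j, (a * delta) `^ gamma j * delta <= tau) ->
  \sum_(j < k) (a `^ gamma j * `|x 0%R j - y 0%R j|) <= k%:R * tau.
Proof.
move=> a_ge0 d0 xy ht.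
apply: (@le_trans _ _ (\sum_(j < k) tau)); last first.
  by rewrite sumr_const card_ord mulr_natl.
apply: ler_sum => j _; apply: le_trans (ht j).
apply: (@le_trans _ _ (a `^ gamma j * delta `^ (gamma j + 1))).
  by rewrite ler_wpM2l ?powR_ge0.
rewrite powRD ?(gt_eqF d0) ?implybT// powRr1 ?(ltW d0)// mulrA -powRM// ltW//.
Qed.

Let c1 : R := c0 * (k%:R + 1).

(* For [b = a] the band is empty, so the hypothesis on the bands bounds the whole
   increment as well. *)
Let incr_all delta x y j : 0 < delta -> a0 * delta <= 1 -> near_pt gamma delta x y -> D x -> D y ->
  (sqmean P (incr Rp x y j) <= ((c1 * delta) ^+ 2)%:E)%E.
Proof.
move=> d0 ad xy Dx Dy.
have a0d : a0 <= delta^-1 by rewrite -[leRHS]mul1r ler_pdivlMr.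
have di0 : 0 < delta^-1 by rewrite invr_gt0.
have K0 : 0 <= c1 * delta by rewrite !mulr_ge0 ?addr_ge0// ltW.
apply: le_trans (incr_bound j a0d (lexx _) Dx Dy K0 _); last first.
  rewrite inver gt_eqF// invrK -EFinD -EFinM lee_fin /c1 -mulrA ler_wpM2l//.
  rewrite mulrDl mul1r lerD2r; apply: sum_near xy _ => //; first exact: ltW.
  by move=> i; rewrite mulVf ?gt_eqF// powR1 mul1r.
rewrite le_eqVlt; apply/orP; left; apply/eqP.
have e0 : co_itv delta^-1 (delta^-1)%:E = set0.
  by apply/seteqP; split=> t //= -[h1]; rewrite lte_fin ltNge h1.
have b0 : borel_Rplus (set0 : set R) by split=> //; exact: measurable0.
rewrite -sqmeanN e0; apply: sqmean_ae.
- by apply: measurableT_comp => //; apply: mV; exact: vspan_incr.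
- by apply: measurable_funB; apply: mV; exact: vspan_incr.
- apply: filterS2 (V_set0 Dx) (V_set0 Dy) => w hx hy.
  by rewrite {2}/incr hx hy subrr sub0r.
Qed.

(** The first condition on [tau] controls the frequencies below [a], the second those above [a']. *)
Lemma incr_rest_far a a' delta tau x y j : a0 <= a -> 0 < a -> a <= a' -> 0 < delta ->
  near_pt gamma delta x y -> D x -> D y ->
  (forall j, (a * delta) `^ gamma j * delta <= tau) -> a'^-1 <= tau ->
  (sqmean P (fun w => (incr (co_itv a a'%:E) x y j w - incr Rp x y j w)%R) <=
   ((c1 * tau) ^+ 2)%:E)%E.
Proof.
move=> a0a a_gt0 aa' d0 xy Dx Dy h1 h2.
have a'0 : 0 < a' by exact: lt_le_trans aa'.
have tau0 : 0 <= tau by apply: le_trans h2; rewrite invr_ge0 ltW.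
apply: incr_bound => //; first by rewrite !mulr_ge0 ?addr_ge0.
rewrite inver gt_eqF// -EFinD -EFinM lee_fin /c1 -mulrA ler_wpM2l//.
rewrite mulrDl mul1r; apply: lerD => //.
by apply: sum_near xy h1 => //; exact: ltW.
Qed.

(** If [1 / a' <= delta], the band is the whole increment plus a small remainder. Otherwise the term
    [1 / b] of the assumption is too large for [b = a'], and the band is written as the difference
    of two half-lines, for which this term vanishes. *)
Lemma incr_band a a' delta x y j : a0 <= a -> 0 < a -> a <= a' -> 0 < delta ->
  a * delta <= 1 -> near_pt gamma delta x y -> D x -> D y ->
  (sqmean P (incr (co_itv a a'%:E) x y j) <= (4 * (c1 * delta) ^+ 2)%:E)%E.
Proof.
move=> a0a a_gt0 aa' d0 ad xy Dx Dy.
have a'0 : 0 < a' by exact: lt_le_trans aa'.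
have a_ge0 : 0 <= a by exact: ltW.
have a0' : a0 <= a' by exact: le_trans aa'.
have pw b i : 0 <= b -> b * delta <= 1 -> (b * delta) `^ gamma i * delta <= delta.
  move=> b0 bd; rewrite ler_piMl ?(ltW d0)//.
  suff : (b * delta) `^ gamma i <= 1 `^ gamma i by rewrite powR1.
  by apply: ge0_ler_powR; rewrite ?nnegrE ?mulr_ge0// ltW.
have c10 : 0 <= c1 by rewrite mulr_ge0// addr_ge0.
have cd0 : 0 <= c1 * delta by rewrite mulr_ge0// ltW.
have e4 : 4 * (c1 * delta) ^+ 2 = 2 * (c1 * delta) ^+ 2 + 2 * (c1 * delta) ^+ 2 by ring.
have mI A : borel_Rplus A -> measurable_fun setT (incr A x y j).
  by move=> bA; apply: mV; exact: vspan_incr.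
have bA b : borel_Rplus (co_itv a b) by exact: borel_co_itv.
have bA' b : borel_Rplus (co_itv a' b) by apply: borel_co_itv; exact: ltW.
rewrite e4; have [da|da] := leP a'^-1 delta.
  rewrite (_ : incr (co_itv a a'%:E) x y j = (fun w =>
    (incr (co_itv a a'%:E) x y j w - incr Rp x y j w) + incr Rp x y j w)); last first.
    by apply/funext => w; rewrite subrK.
  apply: sqmeanD.
  - by apply: measurable_funB; exact: mI.
  - exact: mI.
  - by apply: (@incr_rest_far _ _ delta) => // i; exact: pw.
  - apply: incr_all => //; apply: le_trans ad.
    by rewrite ler_wpM2r// ltW.
have a'd : a' * delta <= 1.
  by rewrite -ler_pdivlMl// mulr1 ltW.
have far b : a0 <= b -> 0 <= b -> b * delta <= 1 ->
    (sqmean P (fun w => (incr (co_itv b +oo%E) x y j w - incr Rp x y j w)%R) <= ((c1 * delta) ^+ 2)%:E)%E.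
  move=> a0b b0 bd; apply: incr_bound => //; first by rewrite leey.
  rewrite invey adde0 -EFinM lee_fin /c1 -mulrA ler_wpM2l//.
  apply: (@le_trans _ _ (k%:R * delta)); last by rewrite ler_wpM2r ?lerDl// ltW.
  by apply: sum_near xy _ => // i; exact: pw.
apply: (@le_trans _ _ (sqmean P (fun w => (incr (co_itv a +oo%E) x y j w - incr Rp x y j w) +
   - (incr (co_itv a' +oo%E) x y j w - incr Rp x y j w)))); last first.
  apply: sqmeanD.
  - by apply: measurable_funB; exact: mI.
  - by apply: measurableT_comp => //; apply: measurable_funB; exact: mI.
  - exact: far.
  - by rewrite sqmeanN; apply: far => //; exact: ltW.
rewrite le_eqVlt; apply/orP; left; apply/eqP; apply: sqmean_ae.
- exact: mI.
- apply: measurable_funD; first by apply: measurable_funB; exact: mI.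
  by apply: measurableT_comp => //; apply: measurable_funB; exact: mI.
- have addV z : D z -> {ae P, forall w, V (co_itv a +oo%E) z w =
      V (co_itv a a'%:E) z w + V (co_itv a' +oo%E) z w}.
    move=> Dz; have [nu [_ Vadd _]] := VW Dz.
    have -> : co_itv a +oo%E = co_itv a a'%:E `|` co_itv a' +oo%E.
      apply/seteqP; split=> t; rewrite /co_itv /= ?lte_fin ?ltry.
        by move=> [h _]; have [h'|h'] := ltP t a'; [left|right].
      by move=> [[h _]|[h _]]; split=> //; exact: le_trans h.
    apply: Vadd => //; apply/seteqP; split=> t //; rewrite /co_itv /= lte_fin.
    by move=> [[_ h1] [h2 _]]; move: h1; rewrite ltNge h2.
  apply: filterS2 (addV x Dx) (addV y Dy) => w hx hy.
  by rewrite /incr hx hy !mxE; ring.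
Qed.

Lemma incr_rest_near a a' delta x y j : a0 <= a -> 0 < a -> a <= a' -> 0 < delta ->
  a * delta <= 1 -> near_pt gamma delta x y -> D x -> D y ->
  (sqmean P (fun w => (incr (co_itv a a'%:E) x y j w - incr Rp x y j w)%R) <=
   ((4 * (c1 * delta)) ^+ 2)%:E)%E.
Proof.
move=> a0a a_gt0 aa' d0 ad xy Dx Dy.
have h1 := incr_band j a0a a_gt0 aa' d0 ad xy Dx Dy.
have a0d : a0 * delta <= 1 by apply: le_trans ad; rewrite ler_wpM2r// ltW.
have h2 := incr_all j d0 a0d xy Dx Dy.
rewrite -sqmeanN in h2.
have bA := borel_co_itv a'%:E (ltW a_gt0).
have m1 := mV (vspan_incr j bA Dx Dy).
have m2 : measurable_fun setT (fun w => - incr Rp x y j w).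
  by apply: measurableT_comp => //; apply: mV; exact: vspan_incr.
have := sqmeanD m1 m2 h1 h2.
move/le_trans; apply; rewrite lee_fin.
have := sqr_ge0 (c1 * delta); rewrite exprMn; lra.
Qed.

Hypothesis d0 : (0 < d)%N.

Let e (j : 'I_k) : R := gamma j + 1.
Let q : R := 4 `^ Qdim gamma.

Definition entropy_factor : R := d%:R * 3 ^+ k * 4 `^ Qdim gamma.
(** The 4 is that of [incr_rest_near]; the added 1 keeps the factor positive when [c0 = 0]. *)
Definition sd_factor : R := 4 * (c0 * (k%:R + 1)) / Num.sqrt normal_sqr + 1.

Let m : R := 4 * (c0 * (k%:R + 1)) / Num.sqrt normal_sqr.

Let ns0 : 0 < Num.sqrt (@normal_sqr R).
Proof. by rewrite sqrtr_gt0 normal_sqr_gt0. Qed.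

Let m0 : 0 <= m.
Proof. by rewrite /m divr_ge0 ?mulr_ge0 ?addr_ge0// ltW. Qed.

Lemma sd_factor_gt0 : 0 < sd_factor.
Proof. by rewrite /sd_factor -/m; have := m0; lra. Qed.

Lemma entropy_factor_ge0 : 0 <= entropy_factor.
Proof. by rewrite /entropy_factor !mulr_ge0 ?exprn_ge0 ?powR_ge0. Qed.

(** * Bands and radii around one base point *)

Section one_base_point.
Variables (x0 : 'rV[R]_k) (r0 U kappa : R).
Hypothesis r001 : 0 < r0 <= 1.
Hypothesis U1 : 1 <= U.
Hypothesis ar0 : a0 * r0 <= 1.
Hypothesis boxD : forall r z, 0 < r <= r0 -> in_cube z -> D (box_point gamma r x0 z).
Hypothesis kappa0 : 0 < kappa.
Hypothesis Ukappa : U^-1 <= kappa.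
Hypothesis Ugamma : forall j, U^-1 `^ gamma j <= kappa.

Definition scale_radius l : R := r0 / U ^+ (2 * l + 2).
Let freq l : R := U ^+ (2 * l + 1) / r0.

Let r0_gt0 : 0 < r0. Proof. by case/andP: r001. Qed.
Let U0 : 0 < U. Proof. by apply: lt_le_trans U1. Qed.

Lemma scale_radius_gt0 l : 0 < scale_radius l.
Proof. by rewrite divr_gt0// exprn_gt0. Qed.

Lemma scale_radius_le l : scale_radius l <= r0.
Proof. by rewrite ler_pdivrMr ?exprn_gt0// ler_peMr ?(ltW r0_gt0)// exprn_ege1. Qed.

Let freq_gt0 l : 0 < freq l.
Proof. by rewrite divr_gt0// exprn_gt0. Qed.

Let freq_ge l : a0 <= freq l.
Proof.
rewrite ler_pdivlMr//; apply: le_trans ar0 _; exact: exprn_ege1.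
Qed.

Let freq_le l l' : (l <= l')%N -> freq l <= freq l'.
Proof.
by move=> ll'; rewrite ler_wpM2r ?invr_ge0 ?(ltW r0_gt0)// ler_weXn2l// leq_add2r leq_mul2l ll' orbT.
Qed.

Let freq_radius l : freq l * scale_radius l = U^-1.
Proof.
rewrite /freq /scale_radius (_ : (2 * l + 2 = (2 * l + 1).+1)%N) ?exprS; last by rewrite addnS.
by field; rewrite expf_neq0 ?gt_eqF.
Qed.

Let freqS l : (freq l.+1)^-1 = scale_radius l / U.
Proof.
rewrite /freq /scale_radius (_ : (2 * l.+1 + 1 = (2 * l + 2).+1)%N) ?exprS; last by rewrite mulnS addn1 addnC.
by field; rewrite expf_neq0 ?gt_eqF.
Qed.

Let pt l (z : 'rV[R]_k) := box_point gamma (scale_radius l) x0 z.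

(** [X l] is the contribution of band [l] to the increment along a link, [Z l] the whole increment,
    and [Y l] minus the remainder. *)
Let X l (u : nat * 'rV[R]_k * 'I_d) : T -> R :=
  incr (co_itv (freq l) (freq l.+1)%:E) (pt l u.1.2) (pt l (round_grid e u.1.1 u.1.2)) u.2.
Let Z l (u : nat * 'rV[R]_k * 'I_d) : T -> R :=
  incr `[0%R, +oo[%classic (pt l u.1.2) (pt l (round_grid e u.1.1 u.1.2)) u.2.
Let Y l u w := X l u w - Z l u w.

Let ptD l z : in_cube z -> D (pt l z).
Proof. by move=> zc; apply: boxD => //; rewrite scale_radius_gt0 scale_radius_le. Qed.

Let bA l : borel_Rplus (co_itv (freq l) (freq l.+1)%:E).
Proof. by apply: borel_co_itv; exact: ltW. Qed.

Let index_cube n (u : nat * 'rV[R]_k * 'I_d) : u \in chain_index gamma d n -> in_cube u.1.2.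
Proof.
by case: u => [[i z] c]; rewrite mem_chain_index => /andP[_ /grid_cube].
Qed.

Let HX n l u : u \in chain_index gamma d n -> vspan (X l u).
Proof.
move=> uJ; have zc := index_cube uJ.
by apply: vspan_incr; [exact: bA|exact: ptD|apply: ptD; exact: round_grid_cube].
Qed.

Let HY n l u : u \in chain_index gamma d n -> vspan (Y l u).
Proof.
move=> uJ; have zc := index_cube uJ; apply: vspanB; first exact: HX uJ.
apply: vspan_incr; [|exact: ptD|by apply: ptD; exact: round_grid_cube].
by split=> //; exact: measurable_itv.
Qed.

Let delta l i := scale_radius l * 4 ^- i.

Let delta0 l i : 0 < delta l i.
Proof. by rewrite mulr_gt0 ?scale_radius_gt0// invr_gt0 exprn_gt0. Qed.

Let delta_le l i : delta l i <= scale_radius l.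
Proof.
rewrite ler_piMr ?(ltW (scale_radius_gt0 l))//.
by rewrite invf_le1 ?exprn_gt0// exprn_ege1// ler1n.
Qed.

Let freq_delta l i : freq l * delta l i <= U^-1.
Proof. by rewrite -(freq_radius l) ler_wpM2l ?(ltW (freq_gt0 l)). Qed.

Let freq_delta1 l i : freq l * delta l i <= 1.
Proof. by apply: le_trans (freq_delta l i) _; rewrite invf_le1. Qed.

Let X_sd n l u s : u \in chain_index gamma d n -> cgauss P (X l u) s ->
  s <= sd_factor * scale_radius l * 4 ^- u.1.1.
Proof.
move=> uJ Xs; have zc := index_cube uJ.
have C0 : 0 <= 2 * (c0 * (k%:R + 1) * delta l u.1.1).
  have dl := ltW (delta0 l u.1.1).
  by rewrite mulr_ge0// mulr_ge0// mulr_ge0// addr_ge0.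
have near := box_point_near gamma x0 u.1.1 u.1.2 (scale_radius_gt0 l).
have h := incr_band u.2 (freq_ge l) (freq_gt0 l)
  (freq_le (leqnSn l)) (delta0 l u.1.1) (freq_delta1 l u.1.1) near (ptD l zc)
  (ptD l (round_grid_cube e u.1.1 zc)).
have := cgauss_sqmean Xs C0; rewrite exprMn (_ : 2 ^+ 2 = 4)// ?expr2; last by ring.
move=> /(_ h) /le_trans; apply.
rewrite -[leRHS]mulrA -/(delta l u.1.1) /sd_factor -/m.
apply: (@le_trans _ _ (m * delta l u.1.1)); last by rewrite ler_wpM2r ?lerDl// ltW.
rewrite (_ : _ / _ = m * delta l u.1.1 / 2); last by rewrite /m; field; rewrite gt_eqF.
have : 0 <= m * delta l u.1.1 by rewrite mulr_ge0// ltW.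
lra.
Qed.

(* The geometric mean of the two bounds on the remainder: [scale_radius l * 4 ^- i],
   which is small for fine levels, and [scale_radius l * kappa], which is small for
   coarse ones. *)
Let Y_sd n l u s : u \in chain_index gamma d n -> cgauss P (Y l u) s ->
  s <= sd_factor * scale_radius l * (2 ^- u.1.1 * Num.sqrt kappa).
Proof.
move=> uJ Ys; have zc := index_cube uJ; have [_ s0 _] := Ys.
have rl0 := scale_radius_gt0 l.
have near := box_point_near gamma x0 u.1.1 u.1.2 rl0.
have C0 : 0 <= 4 * (c0 * (k%:R + 1) * delta l u.1.1).
  have dl := ltW (delta0 l u.1.1).
  by rewrite mulr_ge0// mulr_ge0// mulr_ge0// addr_ge0.
have C1 : 0 <= c0 * (k%:R + 1) * (scale_radius l * kappa).
  exact: mulr_ge0 (mulr_ge0 c00 (addr_ge0 (ler0n _ _) ler01)) (mulr_ge0 (ltW rl0) (ltW kappa0)).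
have h0 := incr_rest_near u.2 (freq_ge l) (freq_gt0 l)
  (freq_le (leqnSn l)) (delta0 l u.1.1) (freq_delta1 l u.1.1) near (ptD l zc)
  (ptD l (round_grid_cube e u.1.1 zc)).
have h1 := incr_rest_far u.2 (freq_ge l) (freq_gt0 l)
  (freq_le (leqnSn l)) (delta0 l u.1.1) near (ptD l zc)
  (ptD l (round_grid_cube e u.1.1 zc)) (tau := scale_radius l * kappa).
have {}h1 := h1 _ _.
have s1 : s <= m * delta l u.1.1.
  apply: le_trans (cgauss_sqmean Ys C0 h0) _.
  by rewrite le_eqVlt; apply/orP; left; apply/eqP; rewrite /m; field; rewrite gt_eqF.
have s2 : s <= m * (scale_radius l * kappa).
  apply: le_trans (cgauss_sqmean Ys C1 (h1 _ _)) _.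
  - move=> j; rewrite mulrC; apply: ler_pM; rewrite ?powR_ge0 ?(ltW (delta0 _ _))//.
    apply: le_trans (Ugamma j); apply: ge0_ler_powR; rewrite ?nnegrE ?invr_ge0 ?(ltW U0)//.
    - exact: ltW.
    - by rewrite mulr_ge0// ltW.
  - by rewrite freqS ler_wpM2l// ltW.
  - rewrite (_ : m * _ = 4 * (c0 * (k%:R + 1) * (scale_radius l * kappa) / Num.sqrt normal_sqr)).
      have : 0 <= c0 * (k%:R + 1) * (scale_radius l * kappa) / Num.sqrt normal_sqr.
        by rewrite divr_ge0// ltW.
      lra.
    by rewrite /m; field; rewrite gt_eqF.
apply: (@le_trans _ _ (m * scale_radius l * (2 ^- u.1.1 * Num.sqrt kappa))); last first.
  rewrite ler_wpM2r ?mulr_ge0 ?invr_ge0 ?exprn_ge0 ?sqrtr_ge0// ler_wpM2r ?(ltW rl0)//.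
  by rewrite /sd_factor -/m; have := m0; lra.
have w0 : 0 <= 2 ^- u.1.1 * Num.sqrt kappa by rewrite mulr_ge0 ?invr_ge0 ?exprn_ge0 ?sqrtr_ge0.
have t0 := mulr_ge0 (mulr_ge0 m0 (ltW rl0)) w0.
rewrite -ler_sqr ?nnegrE//.
have -> : (m * scale_radius l * (2 ^- u.1.1 * Num.sqrt kappa)) ^+ 2 =
    (m * delta l u.1.1) * (m * (scale_radius l * kappa)).
  have e4 : (2 ^- u.1.1) ^+ 2 = 4 ^- u.1.1 :> R.
    by rewrite exprVn exprAC (_ : 2 ^+ 2 = 4)// expr2; ring.
  have sq a b c s' : (a * b * (c * s')) ^+ 2 = a * (b * c ^+ 2) * (a * (b * s' ^+ 2)) :> R by ring.
  by rewrite sq e4 sqr_sqrtr ?(ltW kappa0).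
by rewrite expr2; apply: ler_pM.
Qed.

Let freq_disjoint l l' : (l < l')%N ->
  co_itv (freq l) (freq l.+1)%:E `&` co_itv (freq l') (freq l'.+1)%:E = set0.
Proof.
move=> ll'; apply/seteqP; split=> t //; rewrite /co_itv /= !lte_fin => -[[_ h1] [h2 _]].
by move: h1; rewrite ltNge (le_trans _ h2)// freq_le.
Qed.

Let X_orthogonal n l l' u u' : l != l' -> u \in chain_index gamma d n ->
  u' \in chain_index gamma d n -> (\int[P]_w (X l u w * X l' u' w) = 0)%R.
Proof.
move=> ll' uJ u'J; apply: (incr_orthogonal u.2 u'.2 (bA l) (bA l')).
- by move: ll'; rewrite neq_ltn => /orP[|] h; [|rewrite setIC]; exact: freq_disjoint.
- exact: ptD (index_cube uJ).
- by apply: ptD; apply: round_grid_cube; exact: index_cube uJ.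
- exact: ptD (index_cube u'J).
- by apply: ptD; apply: round_grid_cube; exact: index_cube u'J.
Qed.

(** The depth [n] enters neither the probability nor the bounds on the links, which is what allows
    it to tend to infinity afterwards. *)
Lemma good_scales (n I l0 M : nat) (CM B : R) : (0 < n)%N -> 4 <= q ->
  q * 2 <= 2 ^+ M -> 0 <= CM ->
  (forall X s eps rho, cgauss P X s -> 0 < eps -> 0 < rho <= 1 -> s <= rho * eps ->
    cell_cost P X eps (CM * rho ^+ M)) ->
  B = (4 ^- I / (sd_factor * Num.sqrt kappa)) ^+ 2 / 4 -> q * expR (- B) <= 2^-1 ->
  exists2 G : set T, measurable G /\
    ((1 - expR (- (expR (- (entropy_factor * (56 + CM) * q ^+ I)) * l0%:R))
        - l0%:R * (4 * entropy_factor * expR (- B)))%:E <= P G)%E &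
    forall w, G w -> exists2 l, (l < l0)%N & forall u, u \in chain_index gamma d n ->
      `|Z l u w| <= scale_radius l *
         (sd_factor * coarse_eps I u.1.1 + 4 ^- I * (3 / 4) ^+ u.1.1).
Proof.
move=> n0 q4 qM CM0 fine BE qB.
have g := vspan_gspace.
have sig0 := sd_factor_gt0.
have N0 := entropy_factor_ge0.
have J0 := chain_index_neq0 gamma d0 n0.
have sumJ := @sum_chain_index R k gamma gamma0 d n.
have tau0 : 0 < Num.sqrt kappa by rewrite sqrtr_gt0.
have pS l : ((expR (- (entropy_factor * (56 + CM) * q ^+ I)))%:E <=
    P [set w | forall u, u \in chain_index gamma d n ->
      (`|X l u w| < sd_factor * scale_radius l * coarse_eps I u.1.1)%R])%E.
  apply: (small_ball_scales g J0 N0 q4 sumJ qM CM0 fine I (scale_radius_gt0 l) sig0).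
  - by move=> u uJ; exact: HX uJ.
  - by move=> u s uJ; exact: X_sd uJ.
have DY l : (P (~` [set w | forall u, u \in chain_index gamma d n ->
      (`|Y l u w| < scale_radius l * (4 ^- I * (3 / 4) ^+ u.1.1))%R]) <=
    (4 * entropy_factor * expR (- B))%:E)%E.
  apply: (tail_scales g N0 q4 sumJ (scale_radius_gt0 l) sig0 tau0 BE qB).
  - by move=> u uJ; exact: HY uJ.
  - by move=> u s uJ; exact: Y_sd uJ.
have [|mG PG] := exists_good_scale g J0 (fun l u => @HX n l u) (fun l u => @HY n l u) _
  (@X_orthogonal n) (iota_uniq 0 l0) (expR_ge0 _) (fun l _ => pS l) (fun l _ => DY l).
  by move=> l u; exact: mulr_gt0 (mulr_gt0 sig0 (scale_radius_gt0 l)) (coarse_eps_gt0 _ _).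
rewrite size_iota in PG; eexists; first by split; [exact: mG|exact: PG].
move=> w /= [l]; rewrite mem_iota add0n => /andP[_ ll0] [hX hY]; exists l => // u uJ.
have -> : Z l u w = X l u w - Y l u w by rewrite /Y opprB addrCA subrr addr0.
apply: le_trans (ler_normB _ _) _; rewrite mulrDr; apply: lerD.
  by apply: le_trans (ltW (hX u uJ)) _; rewrite [leRHS]mulrCA [leRHS]mulrA.
exact: ltW (hY u uJ).
Qed.

End one_base_point.

End white_noise_increments.

(** * Assembling the proof *)

Section preliminaries.
Context {R : realType}.

Lemma powR_continuous (p x : R) : 0 < x -> {for x, continuous (fun y : R => y `^ p)}.
Proof.
move=> x0; apply: differentiable_continuous; apply/derivable1_diffP.
by apply: derivable_powR; rewrite in_itv /= andbT.
Qed.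

Lemma loglog_continuous (K Q r : R) : 0 < r -> 1 < ln r^-1 ->
  {for r, continuous (fun s : R => K * (s / ln (ln s^-1) `^ Q^-1))}.
Proof.
move=> r0 lr.
have llr : 0 < ln (ln r^-1) by rewrite ln_gt0.
have c1 : (ln s^-1) @[s --> r] --> ln r^-1.
  apply: (@cvg_comp _ _ _ (fun s : R => s^-1) (@ln R) _ (nbhs r^-1)).
    by apply: inv_continuous; rewrite gt_eqF.
  by apply: continuous_ln; rewrite invr_gt0.
have c2 : (ln (ln s^-1)) @[s --> r] --> ln (ln r^-1).
  apply: (@cvg_comp _ _ _ (fun s : R => ln s^-1) (@ln R) _ (nbhs (ln r^-1)) _ c1).
  by apply: continuous_ln; lra.
have c3 : (ln (ln s^-1) `^ Q^-1) @[s --> r] --> ln (ln r^-1) `^ Q^-1.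
  apply: (@cvg_comp _ _ _ (fun s : R => ln (ln s^-1)) (fun y => y `^ Q^-1) _ (nbhs (ln (ln r^-1))) _ c2).
  exact: powR_continuous.
apply: cvgM; first exact: cvg_cst.
apply: cvgM; first exact: cvg_id.
by apply: cvgV => //; rewrite gt_eqF// powR_gt0.
Qed.

Lemma coord_diff_continuous {S : topologicalType} {d} (f : S -> 'rV[R]_d) (c : R) j :
  continuous f -> continuous (fun y => f y 0 j - c).
Proof.
move=> cf y; apply: cvgB; last exact: cvg_cst.
apply: (@cvg_comp _ _ _ f (fun M : 'rV[R]_d => M 0 j) _ (nbhs (f y))); first exact: cf.
exact: coord_continuous.
Qed.

Lemma coord_dist_continuous {S : topologicalType} {d} (f : S -> 'rV[R]_d) (c : R) j :
  continuous f -> continuous (fun y => `|f y 0 j - c|).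
Proof. by move=> cf y; apply: cvg_norm; exact: coord_diff_continuous. Qed.

Lemma enorm_diff_continuous {S : topologicalType} {d} (f : S -> 'rV[R]_d) (c : 'rV[R]_d) :
  continuous f -> continuous (fun y => enorm (f y - c)).
Proof.
move=> cf y; rewrite /enorm.
apply: (@cvg_comp _ _ _ (fun y => \sum_(j < d) (f y - c) 0 j ^+ 2) (@Num.sqrt R) _
  (nbhs (\sum_(j < d) (f y - c) 0 j ^+ 2))); last exact: sqrt_continuous.
apply: (@cvg_big _ _ _ _ _ _ _ (nbhs y)) => [|j _]; first exact: add_continuous.
have cj := @coord_diff_continuous _ _ f (c 0 j) j cf y.
have -> : (fun z => (f z - c) 0 j ^+ 2) = (fun z => (f z 0 j - c 0 j) * (f z 0 j - c 0 j)).
  by apply/funext => z; rewrite !mxE expr2.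
by rewrite !mxE expr2; apply: cvgM.
Qed.

Lemma measurable_enorm_diff {dT} {T : measurableType dT} {d} (X Y : T -> 'rV[R]_d) :
  (forall j, measurable_fun setT (fun w => X w 0 j)) ->
  (forall j, measurable_fun setT (fun w => Y w 0 j)) ->
  measurable_fun setT (fun w => enorm (X w - Y w)).
Proof.
move=> mX mY; apply: measurableT_comp.
  by apply: continuous_measurable_fun; exact: sqrt_continuous.
apply: measurable_sum => j; apply: measurable_funX.
rewrite (_ : (fun w => _) = (fun w => X w 0 j - Y w 0 j)).
  exact: measurable_funB.
by apply/funext => w; rewrite !mxE.
Qed.

Lemma Delta_round_le {k} (gamma : 'I_k -> R) (e : 'I_k -> R) i (x y : 'rV[R]_k) :
  (forall j, 0 < gamma j) -> Delta gamma (x + round_grid e i (y - x)) x <= Delta gamma y x.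
Proof.
move=> g0; apply: ler_sum => j _.
apply: ge0_ler_powR; rewrite ?nnegrE ?normr_ge0//.
  by rewrite /alpha invr_ge0 addr_ge0// ltW.
rewrite [X in `|X - _| <= _]mxE addrAC subrr add0r.
by apply: le_trans (round_grid_le e i (y - x) j) _; rewrite !mxE.
Qed.

(** A pigeonhole over finitely many scales: a scale that fails at one depth fails at all larger
    ones, so a common depth would rule out all scales if each of them failed somewhere. *)
Lemma bounded_choice (l0 : nat) (A : nat -> nat -> Prop) :
  (forall m n l, (m <= n)%N -> A n l -> A m l) ->
  (forall n, exists2 l, (l < l0)%N & A n l) -> exists2 l, (l < l0)%N & forall n, A n l.
Proof.
move=> mono; elim: l0 => [|l0 IH] h; first by have [] := h 0%N.
have [hl|/existsNP[n nA]] := pselect (forall n, A n l0); first by exists l0.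
have [|l ll0 Al] := IH.
  move=> m; have [l] := h (maxn m n); rewrite ltnS leq_eqVlt => /predU1P[->|ll0] Al.
    by exfalso; apply: nA; apply: mono Al; exact: leq_maxr.
  by exists l => //; apply: mono Al; exact: leq_maxl.
by exists l => //; exact: ltnW.
Qed.

(** The good events of different depths are not known to be nested, since the good scale may change
    with the depth. Their upper limit keeps the lower bound by continuity from above. *)
Lemma infinitely_often_probability {dT} {T : measurableType dT} (P : probability T R)
    (G : nat -> set T) (c : \bar R) :
  (forall n, measurable (G n)) -> (forall n, (c <= P (G n))%E) ->
  let io := [set w | forall n, exists2 m, (n <= m)%N & G m w] in
  measurable io /\ (c <= P io)%E.
Proof.
move=> mG PG io; pose F n := \bigcup_m G (n + m)%N.
have mF n : measurable (F n) by exact: bigcupT_measurable.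
have ioE : io = \bigcap_n F n.
  apply/seteqP; split=> w /= h n.
    by move=> _; have [m nm Gm] := h n; exists (m - n)%N => //; rewrite subnKC.
  by have [m _ Gm] := h n I; exists (n + m)%N => //; exact: leq_addr.
have mio : measurable io by rewrite ioE; exact: bigcapT_measurable.
split=> //; rewrite ioE in mio *.
have F0 : (P (F 0%N) < +oo)%E.
  by rewrite -ge0_fin_numE//; exact: fin_num_measure.
have Fni : nonincreasing_seq F.
  apply/nonincreasing_seqP => n; apply/subsetPset => w [m _ Gm].
  by exists m.+1 => //; rewrite addnS -addSn.
have cv := nonincreasing_cvg_mu F0 mF mio Fni.
apply: (cvge_to_ge cv); apply: nearW => n /=.
apply: le_trans (PG n) _; apply: le_measure; rewrite ?inE//.
by move=> w Gw; exists 0%N => //; rewrite addn0.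
Qed.

End preliminaries.

Section oscillation.
Context {R : realType} {k d : nat}.
Variable gamma : 'I_k -> R.
Hypothesis gamma0 : forall j, 0 < gamma j.

(** The links sum to [3 * sigma], by [sum_coarse_eps], plus 4, the sum of the powers of 3/4, in
    units of [r * 4 ^- I]. Continuity extends the bound from grid points to the ball. *)
Lemma oscillation_le (f : 'rV[R]_k -> 'rV[R]_d) (x0 : 'rV[R]_k) (r sigma : R) (I : nat) :
  continuous f -> 0 < r <= 1 -> 0 <= sigma ->
  (forall n u, u \in chain_index gamma d n ->
    `|f (box_point gamma r x0 u.1.2) 0 u.2 -
      f (box_point gamma r x0 (round_grid (fun j => gamma j + 1) u.1.1 u.1.2)) 0 u.2| <=
    r * (sigma * coarse_eps I u.1.1 + 4 ^- I * (3 / 4) ^+ u.1.1)) ->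
  forall y, Delta gamma y x0 < r ->
    enorm (f y - f x0) <= d%:R * ((3 * sigma + 4) * r * 4 ^- I).
Proof.
move=> cf r01 s0 h y; have /andP[r0 r1] := r01.
move=> /(Delta_ball_box gamma0 r0)[z zc ->].
have i0 : 0 <= 4 ^- I :> R by rewrite invr_ge0 exprn_ge0.
apply: enorm_le => [|c]; first by rewrite !mulr_ge0// ?addr_ge0 ?mulr_ge0// ltW.
have step i : `|f (box_point gamma r x0 (round_grid (fun j => gamma j + 1) i z)) 0 c - f x0 0 c| <=
    (3 * sigma + 4) * r * 4 ^- I.
  have := chain_bound (F := fun z c => f (box_point gamma r x0 z) 0 c)
    (eta := fun i => r * (sigma * coarse_eps I i + 4 ^- I * (3 / 4) ^+ i)) (h i) c (leqnn i) zc.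
  rewrite box_point0 => /le_trans; apply.
  rewrite -mulr_sumr big_split /= -!mulr_sumr.
  have g := @geometric_sum_le R (3 / 4) i _.
  have {}g : \sum_(m < i) (3 / 4 : R) ^+ m <= 4.
    apply: le_trans (g _) _; first lra.
    by rewrite (_ : (1 - 3 / 4)^-1 = 4)//; field.
  have -> : (3 * sigma + 4) * r * 4 ^- I = r * (sigma * (3 * 4 ^- I) + 4 ^- I * 4) by ring.
  rewrite ler_pM2l//; apply: lerD; last by rewrite ler_wpM2l.
  by rewrite ler_wpM2l// sum_coarse_eps.
have -> : (f (box_point gamma r x0 z) - f x0) 0 c = f (box_point gamma r x0 z) 0 c - f x0 0 c.
  by rewrite !mxE.
pose g x := `|f x 0 c - f x0 0 c|.
have cg : continuous g by exact: coord_dist_continuous.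
apply: (@cvg_le_bound _ (fun i => g (box_point gamma r x0 (round_grid (fun j => gamma j + 1) i z))) _ _ _ step).
exact: (@cvg_comp _ _ _ _ g _ _ _ (@box_point_cvg _ _ _ gamma0 r x0 z r01) (@cg _)).
Qed.

End oscillation.

Section loglog.
Context {R : realType}.

Lemma lnV_ge (r s : R) : 0 < r -> r <= s -> ln s^-1 <= ln r^-1.
Proof.
move=> r0 rs; have s0 : 0 < s by exact: lt_le_trans rs.
by rewrite ler_ln ?posrE ?invr_gt0// lef_pV2.
Qed.

(** With L = log(1/r0), log(1/r) is at most [2 * L <= L ^+ 2]: the iterated logarithm grows at most
    by a factor 2 over the range of radii. *)
Lemma loglog_le (r0 r : R) : 0 < r0 -> r0 ^+ 2 <= r -> r <= r0 -> 3 <= ln r0^-1 ->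
  0 < ln (ln r^-1) /\ ln (ln r^-1) <= 2 * ln (ln r0^-1).
Proof.
move=> r00 r1 r2 L3.
have rp : 0 < r by apply: lt_le_trans r1; rewrite exprn_gt0.
have l1 := lnV_ge rp r2.
have l2 := lnV_ge (exprn_gt0 2 r00) r1.
split; first by rewrite ln_gt0//; lra.
have e2 : ln (r0 ^+ 2)^-1 = 2 * ln r0^-1.
  by rewrite -exprVn lnXn ?invr_gt0// mulr_natl.
have -> : 2 * ln (ln r0^-1) = ln (ln r0^-1 * ln r0^-1) by rewrite lnM ?posrE; [ring|lra|lra].
rewrite ler_ln ?posrE; [|lra|by rewrite mulr_gt0; lra].
apply: le_trans l2 _; rewrite e2 ler_wpM2r; lra.
Qed.

End loglog.

Theorem proposition2p3 (R : realType) (disp : measure_display)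
    (T : measurableType disp) (P : probability T R)
    (k d : nat) (hk : (0 < k)%N) (hd : (0 < d)%N)
    (v : 'rV[R]_k -> T -> 'rV[R]_d)
    (v_gaussian : gaussian_field P [set: 'rV[R]_k] v)
    (v_centered : forall x, centered P (v x))
    (v_continuous : forall w, continuous (fun x => v x w))
    (v_iid : iid_components P v)
    (lo hi : 'rV[R]_k) (lo_hi : forall j, lo 0 j < hi 0 j)
    (gamma : 'I_k -> R)
    (hA : assumptionA P v (closed_box lo hi) gamma) :
  exists (K rho : R), 0 < rho /\
    forall r0 : R, 0 < r0 < rho ->
    forall x0 : 'rV[R]_k, closed_box lo hi x0 ->
      ((1 - expR (- (ln r0^-1 `^ 2^-1)))%:E <=
       P [set w | exists r : R, (r0 ^+ 2 <= r <= r0)%R /\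
            (ereal_sup [set (enorm (v y w - v x0 w))%:E
                       | y in [set y | (Delta gamma y x0 < r)%R]] <=
             (K * (r / ln (ln r^-1) `^ (Qdim gamma)^-1))%:E)%E])%E.
Proof.
have mv x j : measurable_fun setT (fun w => v x w 0 j).
  have [mX _] := v_gaussian 1%N (fun=> x) (fun=> delta_mx 0 j) (fun=> I).
  move: mX; congr measurable_fun; apply/funext => w.
  rewrite big_ord_recl big_ord0 addr0 /= (bigD1 j)//= mxE !eqxx mul1r.
  by rewrite big1 ?addr0// => i /negbTE ij; rewrite mxE ij andbF mul0r.
have [gamma0 [V [eps0 [eps00 VG [VW Vv Vind] [c0 [a0 [c00 a00 Vb _]]]]]]] := hA.
have Q1 : 1 <= Qdim gamma.
  rewrite /Qdim (bigD1 (Ordinal hk))//= -addrA addrCA lerDl addr_ge0// ?(ltW (gamma0 _))//.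
  by apply: sumr_ge0 => j _; rewrite addr_ge0// ltW.
have Q0 : 0 < Qdim gamma by lra.
pose q : R := 4 `^ Qdim gamma.
have q4 : 4 <= q by rewrite /q -[leLHS]powRr1// ler_powR// ler1n.
(* At this order [M] the cost of fine cells decays faster than the number of links grows. *)
have [M qM] : exists M, q * 2 <= 2 ^+ M.
  exists (Num.truncn (q * 2)).+1; apply: ltW; apply: lt_le_trans (truncnS_gt _) _.
  by rewrite -natrX ler_nat ltnW// ltn_expl.
have [CM CM0 fine] := @cell_cost_fine R M.
pose N : R := @entropy_factor R k d gamma.
have N1 : 1 <= N.
  rewrite /N /entropy_factor -/q; apply: mulr_ege1; last lra.
  by apply: mulr_ege1; [rewrite ler1n|rewrite exprn_ege1// ler1n].
pose C := N * (56 + CM).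
have C1 : 1 <= C by apply: mulr_ege1 => //; lra.
pose sigma := @sd_factor R k c0.
have sigma0 : 0 < sigma by exact: sd_factor_gt0.
(* A positive number below 1 and all [gamma j]; thus [U = L ^ (1 / beta)] makes [1 / U] and every
   [(1 / U) ^ gamma j] at most [1 / L]. *)
pose beta : R := (1 + \sum_j (gamma j)^-1)^-1.
have sg0 : 0 <= \sum_j (gamma j)^-1.
  by apply: sumr_ge0 => j _; rewrite invr_ge0 ltW.
have beta0 : 0 < beta by rewrite invr_gt0; lra.
have beta1 : beta <= 1 by rewrite invf_le1; lra.
have betag j : beta <= gamma j.
  rewrite -[leRHS]invrK lef_pV2 ?posrE ?invr_gt0 ?gamma0//; last lra.
  rewrite (bigD1 j)//= addrCA lerDl addr_ge0//.
  by apply: sumr_ge0 => i _; rewrite invr_ge0 ltW.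
have [||L0 L03 params] := @scale_parameters R beta C sigma N (Qdim gamma) _ C1 sigma0 _ Q1.
- by rewrite beta0.
- lra.
(* The first factors come from [oscillation_le], the last one from the bound on [4 ^- I] in
   [scale_parameters]. *)
pose K := d%:R * (3 * sigma + 4) * (4 * (8 * C) `^ (Qdim gamma)^-1).
(* The three bounds ensure [L0 <= ln (1 / r0)], that the boxes stay in the enlargement of the closed
   box, and [a0 * r0 <= 1]. *)
pose rho := Num.min (expR (- L0)) (Num.min (eps0 / (k%:R + 1)) (a0 + 1)^-1).
have k1 : 0 < k%:R + 1 :> R by rewrite ltr_wpDl.
exists K, rho; split.
  by rewrite !lt_min expR_gt0 divr_gt0//= invr_gt0; lra.
move=> r0 /andP[r00]; rewrite !lt_min => /and3P[r0L r0e r0a] x0 x0I.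
pose L := ln r0^-1.
have LL0 : L0 <= L.
  rewrite /L -[leLHS]expRK ler_ln ?posrE ?expR_gt0 ?invr_gt0//.
  by rewrite -[leLHS]invrK lef_pV2 ?posrE ?invr_gt0 ?expR_gt0// -expRN ltW.
have L3 : 3 <= L by lra.
have Lp : 0 < L by lra.
have r01 : r0 <= 1.
  by apply: le_trans (ltW r0L) _; rewrite expR_le1; lra.
have r001 : 0 < r0 <= 1 by rewrite r00.
have [I [l0 [h1 h2 h3 h4]]] := params L LL0.
rewrite -/q in h3 h4.
pose U := L `^ beta^-1; pose kappa := L^-1.
have U1 : 1 <= U.
  by rewrite /U -[leLHS](powRr0 L) ler_powR ?invr_ge0 ?(ltW beta0)//; lra.
have U0 : 0 < U by lra.
have kappa0 : 0 < kappa by rewrite invr_gt0.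
have Ub : U `^ beta = L by rewrite /U -powRrM mulVf ?powRr1 ?gt_eqF// ltW.
have powV (x p : R) : 0 < x -> x^-1 `^ p = (x `^ p)^-1.
  move=> x_gt0; apply: (mulIf (lt0r_neq0 (powR_gt0 p x_gt0))).
  by rewrite -powRM ?invr_ge0 ?(ltW x_gt0)// mulVf ?gt_eqF// powR1 mulVf// gt_eqF// powR_gt0.
have Ukappa : U^-1 <= kappa.
  rewrite lef_pV2 ?posrE// -Ub -[leRHS]powRr1 ?(ltW U0)//.
  by rewrite ler_powR.
have Ugamma j : U^-1 `^ gamma j <= kappa.
  by rewrite powV// lef_pV2 ?posrE ?powR_gt0// -Ub ler_powR.
have ar0 : a0 * r0 <= 1.
  have : r0 * (a0 + 1) < 1 by rewrite -ltr_pdivlMr ?div1r//; lra.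
  by rewrite mulrDr mulr1 [r0 * a0]mulrC; lra.
pose D := enlargement (closed_box lo hi) eps0.
have boxD r z : 0 < r <= r0 -> in_cube z -> D (box_point gamma r x0 z).
  move=> /andP[rp rr0] zc; exists x0 => //.
  apply: le_lt_trans (box_point_dist gamma0 x0 _ zc) _; first by rewrite rp (le_trans rr0).
  rewrite ltr_pdivlMr// in r0e; apply: le_lt_trans r0e.
  rewrite mulrC; apply: ler_pM => //; first exact: ltW.
  by rewrite lerDl.
pose B := (4 ^- I / (sigma * Num.sqrt kappa)) ^+ 2 / 4.
have BE : (4 ^- I / (sigma * (Num.sqrt L)^-1)) ^+ 2 / 4 = B.
  by rewrite /B /kappa sqrtrV// ltW.
rewrite BE in h3 h4.
pose c : \bar R := (1 - expR (- (expR (- (C * q ^+ I)) * l0%:R)) - l0%:R * (4 * N * expR (- B)))%:E.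
pose Rp : set R := `[0%R, +oo[%classic.
pose Z l (u : nat * 'rV[R]_k * 'I_d) : T -> R :=
  incr V Rp (box_point gamma (scale_radius r0 U l) x0 u.1.2)
    (box_point gamma (scale_radius r0 U l) x0 (round_grid (fun j => gamma j + 1) u.1.1 u.1.2)) u.2.
pose good n l w := forall u, u \in chain_index gamma d n ->
  `|Z l u w| <= scale_radius r0 U l *
         (sigma * coarse_eps I u.1.1 + 4 ^- I * (3 / 4) ^+ u.1.1).
have /choice[G Gp] : forall n : nat, exists G : set T, [/\ measurable G, (c <= P G)%E &
    forall w, G w -> exists2 l, (l < l0)%N & good n.+1 l w].
  move=> n; have [G [mG PG] Gw] := good_scales VG VW Vv Vind mv gamma0 c00 a00 Vb hd
    r001 U1 ar0 boxD kappa0 Ukappa Ugamma l0 (ltn0Sn n) q4 qM CM0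
    (fun X s eps rho => fine _ T P X s eps rho) (erefl B) h3.
  by exists G; split.
have [mio Pio] := infinitely_often_probability (fun n => let: And3 h _ _ := Gp n in h)
  (fun n => let: And3 _ h _ := Gp n in h).
set io := [set w | _] in mio Pio.
set E := [set w | _].
have mE : measurable E.
  apply: (measurable_exists_scale (G := fun y w => enorm (v y w - v x0 w))
    (D := fun y => Delta gamma y x0) (x0 := x0)
    (f := fun r => K * (r / ln (ln r^-1) `^ (Qdim gamma)^-1))).
  - by move=> y; exact: measurable_enorm_diff.
  - by move=> w; exact: enorm_diff_continuous (v_continuous w).
  - by move=> i y; exact: Delta_round_le.
  - move=> r /andP[ar rb]; have rp : 0 < r by apply: lt_le_trans ar; rewrite exprn_gt0.
    by apply: loglog_continuous => //; have := lnV_ge rp rb; rewrite -/L; lra.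
have rad l : (l < l0)%N -> r0 ^+ 2 <= scale_radius r0 U l <= r0.
  move=> ll0; rewrite (scale_radius_le r001 U1) andbT ler_pdivlMr ?exprn_gt0//.
  rewrite expr2 -mulrA ler_piMr ?(ltW r00)// -ler_pdivlMl// mulr1.
  apply: (@le_trans _ _ (U ^+ (2 * l0))); first by rewrite ler_weXn2l// -[X in (_ + X <= _)%N]muln1 -mulnDr addn1 leq_mul2l.
  rewrite -[U]lnK ?posrE// -expRM_natl -[leRHS]lnK ?posrE ?invr_gt0// ler_expR.
  rewrite -/L /U ln_powR.
  have -> : (2 * l0)%:R * (beta^-1 * ln L) = 2 * l0%:R * ln L / beta by rewrite natrM; ring.
  by rewrite ler_pdivrMr// [leRHS]mulrC.
(* The links of all scales and depths are countably many, so a single null set serves them all;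
   numbering them by [nth] makes the quantifiers range over [nat]. *)
have aeV : {ae P, forall w, forall l n m, (m < size (chain_index gamma d n))%N ->
    let u := nth (0%N, 0, Ordinal hd) (chain_index gamma d n) m in
    Z l u w = v (box_point gamma (scale_radius r0 U l) x0 u.1.2) w 0 u.2 -
      v (box_point gamma (scale_radius r0 U l) x0 (round_grid (fun j => gamma j + 1) u.1.1 u.1.2)) w 0 u.2}.
  apply: ae_foralln => l; apply: ae_foralln => n; apply: ae_foralln => m.
  have [mn|mn] := boolP (m < size (chain_index gamma d n))%N; last by apply: aeW => w.
  set u := nth _ _ _; have uJ : u \in chain_index gamma d n by exact: mem_nth.
  have zc : in_cube u.1.2.
    by move: uJ; case: u => [[i z] j]; rewrite mem_chain_index => /andP[_ /grid_cube].
  have rl : 0 < scale_radius r0 U l <= r0.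
    by rewrite (scale_radius_gt0 r001 U1) (scale_radius_le r001 U1).
  have z1 := Vv _ (boxD _ _ rl zc).
  have z2 := Vv _ (boxD _ _ rl (round_grid_cube (fun j => gamma j + 1) u.1.1 zc)).
  by apply: filterS2 z1 z2 => w e1 e2 _; rewrite /Z /incr e1 e2.
have ioE : {ae P, forall w, io w -> E w}.
  apply: filterS aeV => w Zw iow.
  have mono m n l : (m <= n)%N -> good n l w -> good m l w.
    move=> mn h [[i z] j] uJ; apply: h; move: uJ; rewrite !mem_chain_index => /andP[im ->].
    by rewrite (leq_trans im).
  have [|l ll0 gl] := @bounded_choice l0 (fun n l => good n l w) mono.
    move=> n; have [m nm Gm] := iow n; have [_ _ /(_ w Gm)[l ll0 gl]] := Gp m.
    by exists l => //; apply: mono gl; exact: ltnW.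
  have /andP[rl1 rl2] := rad l ll0.
  have rl0 := scale_radius_gt0 r001 U1 l.
  set r := scale_radius r0 U l in rl0 rl1 rl2 gl.
  exists r; rewrite rl1 rl2; split=> //.
  apply: ub_ereal_sup => _ [y /= yr <-]; rewrite lee_fin.
  have osc := @oscillation_le R k d gamma gamma0 (fun y => v y w) x0 r sigma I
    (v_continuous w) _ (ltW sigma0) _ y yr.
  apply: le_trans (osc _ _) _.
  - by rewrite rl0 (le_trans rl2).
  - move=> n u uJ; have := gl n u uJ; congr (_ <= _); congr `|_|.
    have un : (index u (chain_index gamma d n) < size (chain_index gamma d n))%N by rewrite index_mem.
    by have := Zw l n _ un; rewrite /= nth_index.
  - have [ll1 ll2] := loglog_le r00 rl1 rl2 L3.
    pose dl : R := d%:R * (3 * sigma + 4).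
    have dl0 : 0 <= dl by rewrite mulr_ge0// addr_ge0// mulr_ge0// ltW.
    have -> : d%:R * ((3 * sigma + 4) * r * 4 ^- I) = dl * (r * 4 ^- I) by rewrite /dl; ring.
    have -> : K * (r / ln (ln r^-1) `^ (Qdim gamma)^-1) =
        dl * (r * (4 * (8 * C) `^ (Qdim gamma)^-1 / ln (ln r^-1) `^ (Qdim gamma)^-1)).
      by rewrite /K -/dl; ring.
    rewrite ler_wpM2l// ler_wpM2l ?(ltW rl0)//; apply: le_trans h1 _.
    rewrite ler_wpM2l ?mulr_ge0 ?powR_ge0//.
    rewrite lef_pV2 ?posrE ?powR_gt0//; last lra.
    by apply: ge0_ler_powR; rewrite ?nnegrE ?invr_ge0 ?(ltW Q0) ?(ltW ll1)//; lra.
(* [io] is contained in [E] only up to a null set; the measurability of [E] gives subadditivity for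
   the union of [E] and that set. *)
have PioE : (P io <= P E)%E.
  have [S [mS PS0 subS]] := ioE.
  apply: (@le_trans _ _ (P (E `|` S))).
    apply: le_measure; rewrite ?inE//; first exact: measurableU.
    move=> w iow; have [|nE] := pselect (E w); first by left.
    by right; apply: subS => /= h; exact: nE (h iow).
  by apply: le_trans (measureU2 P mE mS) _; rewrite [X in (_ + X)%E]PS0 adde0.
apply: le_trans PioE; apply: le_trans Pio; rewrite lee_fin.
move: h4; rewrite /L; lra.
Qed.
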